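(* Let $\frac12 < s < \frac32$ and let $p\in\left(\frac{16s+2}{6s+1},\ \frac{6}{3-2s}\right]$. Then $\mathcal{E}^s\hookrightarrow L^p(\mathbb{R}^3)$ continuously; that is, $\mathcal{E}^s\subset L^p(\mathbb{R}^3)$ and there is a constant $C=C(p,s)>0$ such that $\|\varphi\|_{L^p(\mathbb{R}^3)}\le C\|\varphi\|_{\mathcal{E}^s}$ for all $\varphi\in\mathcal{E}^s$.
   Context: For $0<s<\frac32$, $\dot H^s(\mathbb{R}^3)$ is the homogeneous Sobolev space, the completion of $C_0^\infty(\mathbb{R}^3)$ (realized as a subspace of $L^{6/(3-2s)}(\mathbb{R}^3)$) for the norm $\|\varphi\|_{\dot H^s(\mathbb{R}^3)}=\left(\int_{\mathbb{R}^3}|\xi|^{2s}|\hat\varphi(\xi)|^2\,d\xi\right)^{1/2}=\|(-\Delta)^{s/2}\varphi\|_{L^2(\mathbb{R}^3)}$ (up to the normalization of the Fourier transform), and $\dot H^s_{rad}(\mathbb{R}^3)$ is its subspace of radially symmetric functions. Define $$\mathcal{E}^s=\left\{\varphi\in\dot H^s_{rad}(\mathbb{R}^3)\ :\ \iint_{\mathbb{R}^3\times\mathbb{R}^3}\frac{|\varphi(x)|^2|\varphi(y)|^2}{|x-y|}\,dx\,dy<\infty\right\},$$ with norm $$\|\varphi\|_{\mathcal{E}^s}=\left(\|\varphi\|_{\dot H^s(\mathbb{R}^3)}^2+\left(\iint_{\mathbb{R}^3\times\mathbb{R}^3}\frac{|\varphi(x)|^2|\varphi(y)|^2}{|x-y|}\,dx\,dy\right)^{\frac12}\right)^{\frac12}.$$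 *)

(* Defs.v *)
From HB Require Import structures.
From mathcomp Require Import all_boot all_order all_algebra.
From mathcomp Require Import all_classical all_reals all_analysis.
From mathcomp Require Import complex.

Set Implicit Arguments.
Unset Strict Implicit.
Unset Printing Implicit Defensive.

Import Order.TTheory GRing.Theory Num.Theory.
Import numFieldNormedType.Exports ComplexField.Normc.

Local Open Scope classical_set_scope.
Local Open Scope ring_scope.
Local Open Scope complex_scope.

(* Functions are complex-valued, so that real-valued ones are included.  An
   element of a function space is a pointwise defined Borel function on R^3;
   every space and norm below is invariant under a.e. modification within
   Borel functions. *)

Notation R3 R := (R * R * R)%type.

(* The same carrier, with the Borel sigma-algebra on which the library's
   lebesgue_measure is defined. *)
Definition M3_display (R : realType) : measure_display :=
  let d := (R.-ocitv.-measurable).-sigma%mdisp in ((d, d).-prod, d).-prod%mdisp.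
Definition M3 (R : realType) : measurableType (M3_display R) :=
  (measurableTypeR R * measurableTypeR R * measurableTypeR R)%type.

Section Euclidean.
Variable R : realType.

Definition dot3 (x y : R3 R) : R :=
  x.1.1 * y.1.1 + x.1.2 * y.1.2 + x.2 * y.2.

(* The library's norm on a product is the sup norm. *)
Definition eucl (x : R3 R) : R := Num.sqrt (dot3 x x).

End Euclidean.

(* The library has this as an instance on _ \x _, but it is shadowed there by
   the instances for probability measures. *)
Lemma sigma_finite_product d1 d2 (T1 : measurableType d1)
    (T2 : measurableType d2) (R : realType)
    (m1 : {sigma_finite_measure set T1 -> \bar R})
    (m2 : {sigma_finite_measure set T2 -> \bar R}) :
  sigma_finite [set: T1 * T2] (m1 \x m2)%E.
Proof.
have /sigma_finiteP[F [TF ndF Foo]] := sigma_finiteT m1.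
have /sigma_finiteP[G [TG ndG Goo]] := sigma_finiteT m2.
exists (fun n => F n `*` G n).
  rewrite -setXTT TF TG predeqE => -[x y]; split.
    move=> [/= [n _ Fnx] [k _ Gky]]; exists (maxn n k) => //; split.
    - by move: x Fnx; exact/subsetPset/ndF/leq_maxl.
    - by move: y Gky; exact/subsetPset/ndG/leq_maxr.
  by move=> [n _ []/= ? ?]; split; exists n.
move=> k; have [? ?] := Foo k; have [? ?] := Goo k.
split; first exact: measurableX.
by rewrite product_measure1E// lte_mul_pinfty// ge0_fin_numE.
Qed.

Definition leb2 {R : realType} := (@lebesgue_measure R \x @lebesgue_measure R)%E.
HB.instance Definition _ (R : realType) := Measure.on (@leb2 R).
HB.instance Definition _ (R : realType) :=
  Measure_isSigmaFinite.Build _ _ _ (@leb2 R)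
    (sigma_finite_product (@lebesgue_measure R) (@lebesgue_measure R)).

Definition leb3_fun (R : realType) := (@leb2 R \x @lebesgue_measure R)%E.
HB.instance Definition _ (R : realType) := Measure.on (@leb3_fun R).
HB.instance Definition _ (R : realType) :=
  Measure_isSigmaFinite.Build _ _ _ (@leb3_fun R)
    (sigma_finite_product (@leb2 R) (@lebesgue_measure R)).

Definition leb3 {R : realType} : {sigma_finite_measure set (M3 R) -> \bar R} :=
  @leb3_fun R.

Definition cabs {R : realType} (z : R[i]) : R := normc z.

Section ComplexFunctions.
Variable R : realType.
Implicit Types (phi : R3 R -> R[i]) (p : R).

Definition cmeasurable phi : Prop :=
  measurable_fun [set: M3 R] (fun x => complex.Re (phi x)) /\
  measurable_fun [set: M3 R] (fun x => complex.Im (phi x)).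

Definition cintegral phi : R[i] :=
  Rintegral leb3 [set: M3 R] (fun x => complex.Re (phi x)) +i*
  Rintegral leb3 [set: M3 R] (fun x => complex.Im (phi x)).

Definition Lpnorm p phi : \bar R :=
  Lnorm leb3 p%:E (fun x => (cabs (phi x))%:E).

Definition Lpspace p phi : Prop := cmeasurable phi /\ (Lpnorm p phi < +oo)%E.

(* Unitary normalization:
   (2 pi)^(-3/2) \int exp(- i x.xi) phi(x) dx. *)
Definition fourier phi (xi : R3 R) : R[i] :=
  (Num.sqrt (2 * pi) ^- 3)%:C *
  cintegral (fun x => (cos (dot3 x xi) -i* sin (dot3 x xi)) * phi x).

Definition radial phi : Prop :=
  exists g : R3 R -> R[i],
    (forall x y, eucl x = eucl y -> g x = g y) /\
    {ae leb3, forall x, phi x = g x}.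

End ComplexFunctions.

Section TestFunctions.
Variable R : realType.

(* Iterated directional derivatives up to order k exist and are continuous. *)
Fixpoint Ck (k : nat) (f : R3 R -> R) : Prop :=
  continuous f /\
  (if k is k'.+1 then
     forall v : R3 R,
       (forall x, derivable f x v) /\ Ck k' (fun x => 'D_v f x)
   else True).

Definition smooth (f : R3 R -> R) : Prop := forall k, Ck k f.

Definition test_function (phi : R3 R -> R[i]) : Prop :=
  [/\ smooth (fun x => complex.Re (phi x)),
      smooth (fun x => complex.Im (phi x)) &
      compact (closure [set x | phi x != 0])].

End TestFunctions.

Section HomogeneousSobolev.
Variables (R : realType) (s : R).
Implicit Types (phi : R3 R -> R[i]) (u : nat -> R3 R -> R[i]).

Definition Hnorm_test phi : \bar R :=
  ((\int[leb3]_xi (eucl xi `^ (2 * s) * cabs (fourier phi xi) ^+ 2)%:E)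
     `^ 2^-1)%E.

(* u represents phi in the completion of the test functions: u is Cauchy for
   the H^s norm, and phi is its limit in L^(6/(3-2s)). *)
Definition represents u phi : Prop :=
  [/\ forall n, test_function (u n),
      forall e : R, 0 < e -> exists N : nat, forall m n : nat,
        (N <= m)%N -> (N <= n)%N -> (Hnorm_test (u m \- u n)%R < e%:E)%E &
      (fun n => Lpnorm (6 / (3 - 2 * s)) (u n \- phi)) @ \oo --> 0%E].

Definition Hspace phi : Prop :=
  Lpspace (6 / (3 - 2 * s)) phi /\ exists u, represents u phi.

(* For 0 < s < 3/2 the limit of the norms does not depend on the representing
   sequence: the infimum is over a singleton when phi is in the space, and
   over the empty set otherwise. *)
Definition Hnorm phi : \bar R :=
  ereal_inf [set l | exists u,
    represents u phi /\ (fun n => Hnorm_test (u n)) @ \oo --> l].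

Definition Hspace_rad phi : Prop := Hspace phi /\ radial phi.

(* On the null set x = y the quotient is 0, by the convention 0^-1 = 0. *)
Definition coulomb phi : \bar R :=
  (\int[leb3 \x leb3]_z
     (cabs (phi z.1) ^+ 2 * cabs (phi z.2) ^+ 2 / eucl ((z.1 : R3 R) - z.2)%R)%:E)%E.

Definition Espace phi : Prop := Hspace_rad phi /\ (coulomb phi < +oo)%E.

Definition Enorm phi : \bar R :=
  ((Hnorm phi ^+ 2 + coulomb phi `^ 2^-1) `^ 2^-1)%E.

End HomogeneousSobolev.

(* Main.v *)
Require Import Defs.
From HB Require Import structures.
From mathcomp Require Import all_boot all_order all_algebra.
From mathcomp Require Import all_classical all_reals all_analysis.
From mathcomp Require Import measurable_realfun complex ring lra.

(* The Sobolev norm enters only through the sum over dyadic h of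
   h^(-2s) |f - avg h f|^2 in L^2, where avg h is the average over a cube of
   half-side h. For a test function this sum is bounded by the Sobolev norm: the
   averages are Fourier multipliers with 0 <= 1 - m_h <= min(2, 2 h^2 |xi|^2),
   and a Plancherel inequality follows by regularizing with the Poisson kernel.
   The bound passes to limits in L^q, q = 6/(3-2s), and gives the endpoint p = q
   by comparing the size of the averages with that of f. For smaller p only the
   decay at infinity matters. A radial f of Coulomb energy 1 has mass at most of
   order r^(1/2) in the ball of radius r, and rotating a cube of side h at
   distance r around the sphere gives |avg h f| <= c h^(-1/2) r^(-3/4). With
   h = r^(1/(4s)), f is then either at most of order r^(-3/4 - 1/(8s)), where
   the mass bound makes the integral of |f|^p converge exactly when
   p > (16s+2)/(6s+1), or it is dominated by its oscillations at scales
   below h. *)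

Set Implicit Arguments.
Unset Strict Implicit.
Unset Printing Implicit Defensive.

Import Order.TTheory GRing.Theory Num.Theory.
Import numFieldNormedType.Exports.

Local Open Scope classical_set_scope.
Local Open Scope ring_scope.

(** * Volume-preserving maps of the space *)

(** Averages are preferred to frequency cut-offs because they are local: at distance r they see only
    the mass near that distance, which rotations and the Coulomb energy control. The scale
    r^(1/(4s)) is the one with h^(2s) = r^(1/2): there the oscillation term and the mass term ask
    for the same smallness of |f|^(p - 2). Membership and the norm inequality are obtained
    separately. [Hnorm] is an infimum of limits, and proving it finite would take a triangle
    inequality for [Hnorm_test]. In the inequality an infinite right-hand side is harmless, and a
    finite one yields a representing sequence with norms eventually below any larger number. For
    membership, the Cauchy condition bounds [u n - u N] directly, hence the Besov norm of
    [phi - u N], which differs from [phi] only in a cube. Hence the two functions in the decay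
    estimates: [f] with the symmetry and the Coulomb bound, [w] with the Besov bound, equal far from
    the origin. *)

#[global] Arguments leb3 : simpl never.

Section MeasurePreserving.
Variable R : realType.
Local Notation mu := (@lebesgue_measure R).
Local Open Scope ereal_scope.

(** The translated measure agrees with [mu] on half-open intervals, and these determine it. *)
Lemma ge0_integral_shift (a : R) (f : R -> \bar R) :
  measurable_fun [set: R] f -> (forall x, 0 <= f x) ->
  \int[mu]_x f (a + x)%R = \int[mu]_x f x.
Proof.
move=> mf f0.
have mT : measurable_fun [set: measurableTypeR R]
    (fun x : measurableTypeR R => (a + x)%R : measurableTypeR R).
  by apply: measurable_funD.
have := @ge0_integral_pushforward _ _ _ _ R _ mT mu setT f measurableT mf.
rewrite preimage_setT => <-; last by move=> y _.
apply: eq_measure_integral => /= A mA _; symmetry.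
apply: (lebesgue_measure_unique (mu := [the measure _ _ of pushforward mu _])) => // _ [[b c]] _ <-.
rewrite /= /pushforward.
rewrite [X in _ = mu X](_ : _ = `](b - a)%R, (c - a)%R]%classic); last first.
  by apply/seteqP; split => x /=; rewrite !in_itv/=; lra.
rewrite !lebesgue_measure_itv/= !lte_fin ltrD2r; case: ifP => // _.
by rewrite -!EFinD; congr (_%:E); lra.
Qed.

Lemma ge0_integral_opp (f : R -> \bar R) :
  measurable_fun [set: R] f -> (forall x, 0 <= f x) ->
  \int[mu]_x f (- x)%R = \int[mu]_x f x.
Proof.
move=> mf f0.
have mT : measurable_fun [set: measurableTypeR R]
    (fun x : measurableTypeR R => (- x)%R : measurableTypeR R).
  exact: oppr_measurable.
have := @ge0_integral_pushforward _ _ _ _ R _ mT mu setT f measurableT mf.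
rewrite preimage_setT => <-; last by move=> y _.
by apply: eq_measure_integral => /= A mA _; rewrite lebesgue_measureN.
Qed.

(** Three orders of integration, one for each coordinate in the innermost place: a shear or a
    reflection changes a single coordinate, which has to be integrated first. *)
Lemma integral_leb3_x (f : M3 R -> \bar R) : measurable_fun setT f ->
  (forall x, 0 <= f x) ->
  \int[leb3]_p f p = \int[mu]_z \int[mu]_y \int[mu]_x f ((x, y), z).
Proof.
move=> mf f0.
rewrite (fubini_tonelli2 f)//; apply: eq_integral => z _.
rewrite /fubini_G (fubini_tonelli2 (fun q => f (q, z)))//.
by apply: measurableT_comp mf _; exact: measurable_fun_pair.
Qed.

Lemma integral_leb3_y (f : M3 R -> \bar R) : measurable_fun setT f ->
  (forall x, 0 <= f x) ->
  \int[leb3]_p f p = \int[mu]_z \int[mu]_x \int[mu]_y f ((x, y), z).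
Proof.
move=> mf f0.
rewrite (fubini_tonelli2 f)//; apply: eq_integral => z _.
rewrite /fubini_G (fubini_tonelli1 (fun q => f (q, z)))//.
by apply: measurableT_comp mf _; exact: measurable_fun_pair.
Qed.

Lemma integral_leb3_z (f : M3 R -> \bar R) : measurable_fun setT f ->
  (forall x, 0 <= f x) ->
  \int[leb3]_p f p = \int[mu]_x \int[mu]_y \int[mu]_z f ((x, y), z).
Proof.
move=> mf f0.
rewrite (fubini_tonelli1 f)//.
rewrite (fubini_tonelli1 (fubini_F mu f))//.
  by apply: measurable_fun_fubini_tonelli_F.
by move=> q; apply: integral_ge0.
Qed.

(** Phrased through integrals rather than measures of sets, so that composition and change of
    variables are immediate. *)
Definition mpres (T : R3 R -> R3 R) :=
  measurable_fun [set: M3 R] (T : M3 R -> M3 R) /\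
  forall f : M3 R -> \bar R, measurable_fun setT f -> (forall x, 0 <= f x) ->
    \int[leb3]_x f (T x) = \int[leb3]_x f x.

Lemma mpres_comp S T : mpres S -> mpres T -> mpres (S \o T).
Proof.
move=> [mS iS] [mT iT]; split; first exact: (measurableT_comp mS mT).
move=> f mf f0; rewrite -(iS f)//.
by rewrite -(iT (fun x => f (S x)))//; exact: (measurableT_comp mf mS).
Qed.

Lemma measurable_R3 (d : measure_display) (T : measurableType d)
    (f : T -> R3 R) :
  measurable_fun setT (fun t => (f t).1.1) ->
  measurable_fun setT (fun t => (f t).1.2) ->
  measurable_fun setT (fun t => (f t).2) ->
  measurable_fun setT (f : T -> M3 R).
Proof.
move=> m1 m2 m3; apply/measurable_fun_pairP; split => //.
by apply/measurable_fun_pairP; split.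
Qed.

Lemma measurable_c1 : measurable_fun setT (fun x : M3 R => x.1.1 : R).
Proof. exact: (measurableT_comp measurable_fst measurable_fst). Qed.
Lemma measurable_c2 : measurable_fun setT (fun x : M3 R => x.1.2 : R).
Proof. exact: (measurableT_comp measurable_snd measurable_fst). Qed.
Lemma measurable_c3 : measurable_fun setT (fun x : M3 R => x.2 : R).
Proof. exact: measurable_snd. Qed.

Lemma mpres_shear1 (c : R -> R -> R) :
  measurable_fun setT (fun p : M3 R => c p.1.2 p.2) ->
  mpres (fun p => (c p.1.2 p.2 + p.1.1, p.1.2, p.2)%R).
Proof.
move=> mc; set T := (fun p : R3 R => _).
have mT : measurable_fun [set: M3 R] (T : M3 R -> M3 R).
  apply: measurable_R3 => /=; [|exact: measurable_c2|exact: measurable_c3].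
  by apply: measurable_funD => //; exact: measurable_c1.
split => // f mf f0.
  have mfT : measurable_fun setT (fun p : M3 R => f (_ p)) := measurableT_comp mf mT.
  rewrite (integral_leb3_x mf f0) (integral_leb3_x mfT (fun=> f0 _)).
apply: eq_integral => z _; apply: eq_integral => y _.
apply: (ge0_integral_shift (c y z) (f := fun x => f ((x, y), z))) => //.
by apply: (measurableT_comp mf); apply: measurable_R3 => //; exact: measurable_id.
Qed.

Lemma mpres_shear2 (c : R -> R -> R) :
  measurable_fun setT (fun p : M3 R => c p.1.1 p.2) ->
  mpres (fun p => (p.1.1, c p.1.1 p.2 + p.1.2, p.2)%R).
Proof.
move=> mc; set T := (fun p : R3 R => _).
have mT : measurable_fun [set: M3 R] (T : M3 R -> M3 R).
  apply: measurable_R3 => /=; [exact: measurable_c1| |exact: measurable_c3].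
  by apply: measurable_funD => //; exact: measurable_c2.
split => // f mf f0.
  have mfT : measurable_fun setT (fun p : M3 R => f (_ p)) := measurableT_comp mf mT.
  rewrite (integral_leb3_y mf f0) (integral_leb3_y mfT (fun=> f0 _)).
apply: eq_integral => z _; apply: eq_integral => x _.
apply: (ge0_integral_shift (c x z) (f := fun y => f ((x, y), z))) => //.
by apply: (measurableT_comp mf); apply: measurable_R3 => //; exact: measurable_id.
Qed.

Lemma mpres_shear3 (c : R -> R -> R) :
  measurable_fun setT (fun p : M3 R => c p.1.1 p.1.2) ->
  mpres (fun p => (p.1.1, p.1.2, c p.1.1 p.1.2 + p.2)%R).
Proof.
move=> mc; set T := (fun p : R3 R => _).
have mT : measurable_fun [set: M3 R] (T : M3 R -> M3 R).
  apply: measurable_R3 => /=; [exact: measurable_c1|exact: measurable_c2|].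
  by apply: measurable_funD => //; exact: measurable_c3.
split => // f mf f0.
  have mfT : measurable_fun setT (fun p : M3 R => f (_ p)) := measurableT_comp mf mT.
  rewrite (integral_leb3_z mf f0) (integral_leb3_z mfT (fun=> f0 _)).
apply: eq_integral => x _; apply: eq_integral => y _.
apply: (ge0_integral_shift (c x y) (f := fun z => f ((x, y), z))) => //.
by apply: (measurableT_comp mf); apply: measurable_R3 => //; exact: measurable_id.
Qed.

Lemma mpres_opp : mpres (fun p => - p)%R.
Proof.
have mN : measurable_fun setT (-%R : R -> R) by exact: oppr_measurable.
have r1 : mpres (fun p => (- p.1.1, p.1.2, p.2)%R).
  have mT : measurable_fun [set: M3 R] (fun p : M3 R => (- p.1.1, p.1.2, p.2)%R : M3 R).
    by apply: measurable_R3 => /=;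
      [exact: measurableT_comp mN measurable_c1|exact: measurable_c2|exact: measurable_c3].
  split => // f mf f0.
  have mfT : measurable_fun setT (fun p : M3 R => f (_ p)) := measurableT_comp mf mT.
  rewrite (integral_leb3_x mf f0) (integral_leb3_x mfT (fun=> f0 _)).
  apply: eq_integral => z _; apply: eq_integral => y _.
  apply: (ge0_integral_opp (f := fun x => f ((x, y), z))) => //.
  by apply: (measurableT_comp mf); apply: measurable_R3 => //; exact: measurable_id.
have r2 : mpres (fun p => (p.1.1, - p.1.2, p.2)%R).
  have mT : measurable_fun [set: M3 R] (fun p : M3 R => (p.1.1, - p.1.2, p.2)%R : M3 R).
    by apply: measurable_R3 => /=;
      [exact: measurable_c1|exact: measurableT_comp mN measurable_c2|exact: measurable_c3].
  split => // f mf f0.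
  have mfT : measurable_fun setT (fun p : M3 R => f (_ p)) := measurableT_comp mf mT.
  rewrite (integral_leb3_y mf f0) (integral_leb3_y mfT (fun=> f0 _)).
  apply: eq_integral => z _; apply: eq_integral => x _.
  apply: (ge0_integral_opp (f := fun y => f ((x, y), z))) => //.
  by apply: (measurableT_comp mf); apply: measurable_R3 => //; exact: measurable_id.
have r3 : mpres (fun p => (p.1.1, p.1.2, - p.2)%R).
  have mT : measurable_fun [set: M3 R] (fun p : M3 R => (p.1.1, p.1.2, - p.2)%R : M3 R).
    by apply: measurable_R3 => /=;
      [exact: measurable_c1|exact: measurable_c2|exact: measurableT_comp mN measurable_c3].
  split => // f mf f0.
  have mfT : measurable_fun setT (fun p : M3 R => f (_ p)) := measurableT_comp mf mT.
  rewrite (integral_leb3_z mf f0) (integral_leb3_z mfT (fun=> f0 _)).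
  apply: eq_integral => x _; apply: eq_integral => y _.
  apply: (ge0_integral_opp (f := fun z => f ((x, y), z))) => //.
  by apply: (measurableT_comp mf); apply: measurable_R3 => //; exact: measurable_id.
exact: mpres_comp (mpres_comp r1 r2) r3.
Qed.

Lemma mpres_shift (a : R3 R) : mpres (fun p => a + p)%R.
Proof.
have h1 := mpres_shear1 (c := fun _ _ => a.1.1) (@measurable_cst _ _ _ _ _ _).
have h2 := mpres_shear2 (c := fun _ _ => a.1.2) (@measurable_cst _ _ _ _ _ _).
have h3 := mpres_shear3 (c := fun _ _ => a.2) (@measurable_cst _ _ _ _ _ _).
have := mpres_comp (mpres_comp h1 h2) h3.
by congr mpres; apply/funext => -[[x y] z]; case: a {h1 h2 h3} => -[].
Qed.

Definition rot12 (c s : R) (p : R3 R) : R3 R :=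
  (c * p.1.1 - s * p.1.2, s * p.1.1 + c * p.1.2, p.2)%R.
Definition rot23 (c s : R) (p : R3 R) : R3 R :=
  (p.1.1, c * p.1.2 - s * p.2, s * p.1.2 + c * p.2)%R.

(* A rotation is a product of three shears, each of which is a translation in
   one variable. *)
Lemma mpres_rot12 (c s : R) : (c ^+ 2 + s ^+ 2 = 1)%R -> mpres (rot12 c s).
Proof.
have main c' s' : (c' ^+ 2 + s' ^+ 2 = 1)%R -> (s' != 0)%R -> mpres (rot12 c' s').
  move=> e s0.
  have h1 := mpres_shear1 (c := fun y _ => (c' - 1) / s' * y)%R
    (measurable_funM (@measurable_cst _ _ _ _ _ _) measurable_c2).
  have h2 := mpres_shear2 (c := fun x _ => s' * x)%R
    (measurable_funM (@measurable_cst _ _ _ _ _ _) measurable_c1).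
  have := mpres_comp (mpres_comp h1 h2) h1.
  congr mpres; apply/funext => -[[x y] z]; rewrite /rot12/=.
  have e1 : (s' * ((c' - 1) / s' * y + x) + y = s' * x + c' * y)%R by field.
  rewrite e1; congr (_, _, _).
  have e2 : ((c' - 1) / s' * (1 + c') = - s')%R.
    by apply: (mulIf s0); rewrite mulrAC divfK//; lra.
  have -> : ((c' - 1) / s' * (s' * x + c' * y) + ((c' - 1) / s' * y + x) =
    ((c' - 1) / s' * (1 + c')) * y + c' * x)%R by field.
  by rewrite e2; ring.
(* The shears divide by [s]. For s = 0, where c is 1 or -1, the map is a product of two quarter
   turns. *)
have [-> |s0 e] := eqVneq s 0%R; last exact: main.
rewrite expr0n/= addr0 => c1.
have c0 : (- c != 0)%R by rewrite oppr_eq0; apply/eqP => h; move: c1; rewrite h; lra.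
have h1 := main 0%R 1%R ltac:(lra) ltac:(lra).
have h2 := main 0%R (- c)%R ltac:(lra) c0.
have := mpres_comp h1 h2; congr mpres; apply/funext => -[[x y] z].
by rewrite /rot12/=; congr (_, _, _); ring.
Qed.

Lemma mpres_rot23 (c s : R) : (c ^+ 2 + s ^+ 2 = 1)%R -> mpres (rot23 c s).
Proof.
have main c' s' : (c' ^+ 2 + s' ^+ 2 = 1)%R -> (s' != 0)%R -> mpres (rot23 c' s').
  move=> e s0.
  have h1 := mpres_shear2 (c := fun _ y => (c' - 1) / s' * y)%R
    (measurable_funM (@measurable_cst _ _ _ _ _ _) measurable_c3).
  have h2 := mpres_shear3 (c := fun _ x => s' * x)%R
    (measurable_funM (@measurable_cst _ _ _ _ _ _) measurable_c2).
  have := mpres_comp (mpres_comp h1 h2) h1.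
  congr mpres; apply/funext => -[[z x] y]; rewrite /rot23/=.
  have e1 : (s' * ((c' - 1) / s' * y + x) + y = s' * x + c' * y)%R by field.
  rewrite e1; congr (_, _, _).
  have e2 : ((c' - 1) / s' * (1 + c') = - s')%R.
    by apply: (mulIf s0); rewrite mulrAC divfK//; lra.
  have -> : ((c' - 1) / s' * (s' * x + c' * y) + ((c' - 1) / s' * y + x) =
    ((c' - 1) / s' * (1 + c')) * y + c' * x)%R by field.
  by rewrite e2; ring.
have [-> |s0 e] := eqVneq s 0%R; last exact: main.
rewrite expr0n/= addr0 => c1.
have c0 : (- c != 0)%R by rewrite oppr_eq0; apply/eqP => h; move: c1; rewrite h; lra.
have h1 := main 0%R 1%R ltac:(lra) ltac:(lra).
have h2 := main 0%R (- c)%R ltac:(lra) c0.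
have := mpres_comp h1 h2; congr mpres; apply/funext => -[[z x] y].
by rewrite /rot23/=; congr (_, _, _); ring.
Qed.

End MeasurePreserving.

(** * Cube averages *)

(** The open ball of the sup norm, hence of the product topology: continuity and compactness
    translate directly into statements about cubes. *)
Definition cube {R : realType} (x : R3 R) (h : R) : set (M3 R) :=
  (`]x.1.1 - h, x.1.1 + h[ `*` `]x.1.2 - h, x.1.2 + h[) `*` `]x.2 - h, x.2 + h[.

HB.lock Definition kern {R : realType} (h : R) (x y : R3 R) : R :=
  (8 * h ^+ 3)^-1 * \1_(cube x h) y.

HB.lock Definition avg {R : realType} (h : R) (f : R3 R -> R) (x : R3 R) : R :=
  Rintegral leb3 setT (fun y : M3 R => kern h x y * f y).

Section Averages.
Variable R : realType.
Local Notation mu := (@lebesgue_measure R).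
Local Notation L := (@leb3 R).
Implicit Types (f g : R3 R -> R) (x y z : R3 R) (h k : R).

Lemma cubeP x h y : cube x h y <->
  [/\ `|y.1.1 - x.1.1| < h, `|y.1.2 - x.1.2| < h & `|y.2 - x.2| < h].
Proof. by rewrite /cube /= !in_itv/= !ltr_distl; split => [[[]]|[]]. Qed.

Lemma measurable_cube x h : measurable (cube x h).
Proof. by apply: measurableX => //; apply: measurableX. Qed.

Lemma leb3_cube x h : 0 < h -> L (cube x h) = (8 * h ^+ 3)%:E.
Proof.
move=> h0; rewrite /leb3 /= /leb3_fun product_measure1E//; last exact: measurableX.
set A : set (measurableTypeR R) := `]_, _[%classic.
set B : set (measurableTypeR R) := `]_, _[%classic.
transitivity ((mu A * mu B) * mu `](x.2 - h)%R, (x.2 + h)%R[%classic)%E.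
  by congr (_ * _)%E; apply: (@product_measure1E _ _ _ _ _ mu mu A B); exact: measurable_itv.
rewrite /A /B !lebesgue_measure_itv/= !lte_fin.
rewrite !ifT; [|lra|lra|lra].
by rewrite -!EFinD -!EFinM; congr EFin; ring.
Qed.

Lemma kernE h x y : kern h x y = (8 * h ^+ 3)^-1 * \1_(cube x h) y.
Proof. by rewrite kern.unlock. Qed.

Lemma avgE h f x : avg h f x = \int[L]_y (kern h x y * f y).
Proof. by rewrite avg.unlock. Qed.

Lemma kern_ge0 h x y : 0 < h -> 0 <= kern h x y.
Proof. by move=> h0; rewrite kernE mulr_ge0// invr_ge0 mulr_ge0// exprn_ge0// ltW. Qed.

Lemma kern_eq h x y x' y' : (cube x h y <-> cube x' h y') ->
  kern h x y = kern h x' y'.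
Proof.
move=> e; rewrite !kernE !indicE; congr (_ * (nat_of_bool _)%:R).
by apply/idP/idP; rewrite !inE => /e.
Qed.

Lemma kern_sym h x y : kern h x y = kern h y x.
Proof. by apply: kern_eq; rewrite !cubeP; split => -[]; split; rewrite distrC. Qed.

Lemma measurable_sub3 (d : measure_display) (T : measurableType d) (a b : T -> R3 R) :
  measurable_fun setT (a : T -> M3 R) -> measurable_fun setT (b : T -> M3 R) ->
  measurable_fun setT ((fun t => a t - b t) : T -> M3 R).
Proof.
move=> ma mb; apply: measurable_R3; apply: measurable_funB.
- exact: measurableT_comp (@measurable_c1 R) ma.
- exact: measurableT_comp (@measurable_c1 R) mb.
- exact: measurableT_comp (@measurable_c2 R) ma.
- exact: measurableT_comp (@measurable_c2 R) mb.
- exact: measurableT_comp (@measurable_c3 R) ma.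
- exact: measurableT_comp (@measurable_c3 R) mb.
Qed.

Lemma measurable_kern2 h :
  measurable_fun setT (fun p : M3 R * M3 R => kern h p.1 p.2).
Proof.
under eq_fun do rewrite kernE.
apply: measurable_funM => //.
rewrite (_ : (fun p => _) = (fun p : M3 R * M3 R =>
   \1_(cube 0 h) ((p.2 : R3 R) - p.1 : M3 R) : R)); last first.
  apply/funext => p; rewrite !indicE; congr ((nat_of_bool _)%:R).
  by apply/idP/idP; rewrite !inE !cubeP/= !subr0.
have m1 : measurable_fun setT (\1_(cube 0 h) : M3 R -> R).
  by apply: measurable_indic; exact: measurable_cube.
apply: (measurableT_comp m1).
by apply: measurable_sub3; [exact: measurable_snd|exact: measurable_fst].
Qed.

Lemma measurable_kern h x : measurable_fun setT (kern h x : M3 R -> R).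
Proof.
rewrite (_ : kern h x = fun y => (8 * h ^+ 3)^-1 * \1_(cube x h) y); last first.
  by apply/funext => y; rewrite kernE.
by apply: measurable_funM => //; apply: measurable_indic; exact: measurable_cube.
Qed.

Lemma integral_kern h x (f : M3 R -> \bar R) : 0 < h ->
  measurable_fun setT f -> (forall y, (0 <= f y)%E) ->
  (\int[L]_y ((kern h x y)%:E * f y) =
   ((8 * h ^+ 3)^-1)%:E * \int[L]_(y in cube x h) f y)%E.
Proof.
move=> h0 mf f0.
have h3 : 0 <= (8 * h ^+ 3)^-1 by rewrite invr_ge0 mulr_ge0// exprn_ge0// ltW.
rewrite [X in (_ * X)%E]integral_mkcond -ge0_integralZl//.
- apply: eq_integral => y _; rewrite kernE EFinM -muleA; congr (_ * _)%E.
  rewrite indicE patchE; case: ifPn => _; first by rewrite mul1e.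
  by rewrite mul0e.
- by apply/(measurable_restrictT _ (measurable_cube _ _)); exact: measurable_funTS.
- by move=> y _; rewrite patchE; case: ifPn.
Qed.

Lemma integral_kern1 h x : 0 < h -> (\int[L]_y (kern h x y)%:E = 1)%E.
Proof.
move=> h0; have := @integral_kern h x (cst 1%E) h0 (@measurable_cst _ _ _ _ _ _) (fun _ => @lee01 R).
under eq_integral do rewrite /= mule1.
move=> ->; rewrite integral_cst//; last exact: measurable_cube.
rewrite [X in (_ * (_ * X))%E](_ : _ = (8 * h ^+ 3)%:E); last exact: leb3_cube.
by rewrite mul1e -EFinM mulVf// mulf_neq0// ?expf_neq0// gt_eqF.
Qed.

Lemma kern_le h x y : 0 < h -> kern h x y <= (8 * h ^+ 3)^-1.
Proof.
move=> h0; rewrite kernE ler_piMr ?invr_ge0 ?mulr_ge0 ?exprn_ge0 ?(ltW h0)//.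
Qed.

(** Tonelli applies to the positive and to the negative part; infinite values are sent to a default
    by [fine], which is measurable. *)
Lemma measurable_Rintegral2 d1 d2 (T1 : measurableType d1) (T2 : measurableType d2)
    (m : {sigma_finite_measure set T2 -> \bar R}) (g : T1 * T2 -> R) :
  measurable_fun setT g ->
  measurable_fun setT (fun t => \int[m]_u g (t, u)).
Proof.
move=> mg; have mG : measurable_fun setT (EFin \o g) by apply/measurable_EFinP.
apply: (measurableT_comp (f := fine)); first exact: fine_measurable.
rewrite (_ : (fun t => _) = (fun t => \int[m]_u (EFin \o g)^\+%E (t, u) -
    \int[m]_u (EFin \o g)^\-%E (t, u))%E); last first.
  apply/funext => t; rewrite integralE.
  by congr (_ - _)%E; apply: eq_integral => u _; rewrite ?funeposE ?funenegE.
apply: emeasurable_funB.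
- apply: (measurable_fun_fubini_tonelli_F (EFin \o g)^\+%E) => //.
  exact: measurable_funepos.
- apply: (measurable_fun_fubini_tonelli_F (EFin \o g)^\-%E) => //.
  exact: measurable_funeneg.
Qed.

Lemma measurable_avg h f : measurable_fun setT (f : M3 R -> R) ->
  measurable_fun setT (avg h f : M3 R -> R).
Proof.
move=> mf.
rewrite (_ : avg h f = fun x => \int[L]_y (kern h x y * f y)); last first.
  by apply/funext => x; rewrite avgE.
apply: (@measurable_Rintegral2 _ _ _ _ L (fun p : M3 R * M3 R => kern h p.1 p.2 * f p.2)).
apply: measurable_funM; first exact: measurable_kern2.
exact: measurableT_comp mf measurable_snd.
Qed.

Lemma mpres_Rintegral (T : R3 R -> R3 R) f : mpres T ->
  measurable_fun setT (f : M3 R -> R) ->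
  \int[L]_x f (T x) = \int[L]_x f x.
Proof.
move=> [mT iT] mf; rewrite /Rintegral; congr fine.
have mf' : measurable_fun [set: M3 R] (EFin \o f) by apply/measurable_EFinP.
rewrite integralE [in RHS]integralE; congr (_ - _)%E.
- etransitivity; last by apply: (iT _ (measurable_funepos mf')) => x; exact: funepos_ge0.
  by apply: eq_integral => x _; rewrite !funeposE.
- etransitivity; last by apply: (iT _ (measurable_funeneg mf')) => x; exact: funeneg_ge0.
  by apply: eq_integral => x _; rewrite !funenegE.
Qed.

Lemma avg_shift h f x : measurable_fun setT (f : M3 R -> R) ->
  avg h f x = \int[L]_y (kern h 0 y * f (x + y)).
Proof.
move=> mf; rewrite avgE -(mpres_Rintegral (mpres_shift x)); last first.
  by apply: measurable_funM => //; exact: measurable_kern.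
apply: eq_Rintegral => y _; congr (_ * _); apply: kern_eq.
by rewrite !cubeP/= !subr0 ![x.1.1 + _]addrC ![x.1.2 + _]addrC ![x.2 + _]addrC !addrK.
Qed.

Lemma measurable_powR_norm d (T : measurableType d) (g : T -> R) (q : R) :
  measurable_fun setT g -> measurable_fun setT (fun t => `|g t| `^ q).
Proof.
move=> mg; have m1 := measurableT_comp (@normr_measurable R setT) mg.
exact: (measurableT_comp (measurable_powR q) m1).
Qed.

(** For t > eta, write t = t^(1 - q) t^q, where the first factor is at most eta^(1 - q). With a
    suitable [eta] this takes the place of Hoelder's inequality. *)
Lemma young_split (q eta t : R) : 1 <= q -> 0 < eta -> 0 <= t ->
  t <= eta + eta `^ (1 - q) * t `^ q.
Proof.
move=> q1 e0 t0; have [te|et] := leP t eta.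
  by rewrite (le_trans te)// lerDl mulr_ge0// powR_ge0.
apply: (@le_trans _ _ (eta `^ (1 - q) * t `^ q)); last by rewrite lerDr ltW.
have t0' : 0 < t by rewrite (lt_trans e0).
rewrite -{1}(@powRr1 _ t)// (_ : 1 = (1 - q) + q); last by rewrite subrK.
rewrite powRD; last by rewrite (gt_eqF t0') implybT.
rewrite subrK ler_wpM2r ?powR_ge0//.
rewrite -(opprB q 1) !powRN lef_pV2 ?posrE ?powR_gt0//.
by rewrite ge0_ler_powR// ?nnegrE ?subr_ge0// ltW.
Qed.

(** [young_split] integrated against the kernel, which has mass 1 and height 1 / (8 h^3). *)
Lemma avg_young (q eta M : R) h f x : 1 <= q -> 0 < eta -> 0 < h ->
  measurable_fun setT (f : M3 R -> R) ->
  (\int[L]_(y in cube x h) (`|f y| `^ q)%:E <= M%:E)%E ->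
  `|avg h f x| <= eta + eta `^ (1 - q) * (M / (8 * h ^+ 3)).
Proof.
move=> q1 e0 h0 mf fM.
have mkf : measurable_fun setT (fun y : M3 R => kern h x y * f y).
  by apply: measurable_funM => //; exact: measurable_kern.
have mq : measurable_fun [set: M3 R] (fun y => (`|f y| `^ q)%:E).
  by apply/measurable_EFinP; exact: measurable_powR_norm.
have h3 : 0 < 8 * h ^+ 3 by rewrite mulr_gt0// exprn_gt0.
suff : (`|\int[L]_y (kern h x y * f y)%:E| <=
   (eta + eta `^ (1 - q) * (M / (8 * h ^+ 3)))%:E)%E.
  by rewrite avgE /Rintegral; case: integral.
apply: (le_trans (le_abse_integral _ _ _)) => //; first exact/measurable_EFinP.
have eq2 : (\int[L]_y ((kern h x y)%:E * (eta%:E + (eta `^ (1 - q))%:E * (`|f y| `^ q)%:E)) <=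
   (eta + eta `^ (1 - q) * (M / (8 * h ^+ 3)))%:E)%E.
  have e1 : 0 <= eta `^ (1 - q) by rewrite powR_ge0.
  rewrite integral_kern//; last 2 first.
  - by apply: emeasurable_funD => //; apply: measurable_funeM.
  - by move=> y; rewrite -EFinM -EFinD lee_fin addr_ge0 ?mulr_ge0 ?powR_ge0// ltW.
  have J : (\int[L]_(y in cube x h) (eta%:E + (eta `^ (1 - q))%:E * (`|f y| `^ q)%:E) <=
     (eta * (8 * h ^+ 3) + eta `^ (1 - q) * M)%:E)%E.
    rewrite ge0_integralD//; last 4 first.
    - exact: measurable_cube.
    - by move=> y _; rewrite lee_fin ltW.
    - by move=> y _; rewrite -EFinM lee_fin mulr_ge0 ?powR_ge0.
    - by apply: measurable_funTS; apply: measurable_funeM.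
    rewrite EFinD; apply: leeD.
      by rewrite integral_cst ?(EFinM eta) -?(leb3_cube x h0)//; exact: measurable_cube.
    rewrite ge0_integralZl_EFin//; last 2 first.
    - exact: measurable_cube.
    - exact: measurable_funTS.
    by rewrite EFinM lee_wpmul2l.
  apply: (le_trans (lee_wpmul2l _ J)); first by rewrite lee_fin invr_ge0 ltW.
  by rewrite -EFinM lee_fin le_eqVlt; apply/orP; left; apply/eqP; field; rewrite gt_eqF.
apply: le_trans eq2; apply: ge0_le_integral => //.
- by apply: measurableT_comp => //; exact/measurable_EFinP.
- apply: emeasurable_funM; first by apply/measurable_EFinP; exact: measurable_kern.
  by apply: emeasurable_funD => //; apply: measurable_funeM.
- move=> y _; rewrite -(EFinM (_ `^ _)) -EFinD -EFinM abse_EFin lee_fin normrM ger0_norm ?kern_ge0//.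
  by rewrite ler_wpM2l ?kern_ge0// young_split.
Qed.

Definition Lq (q : R) f := measurable_fun setT (f : M3 R -> R) /\
  (\int[L]_y (`|f y| `^ q)%:E < +oo)%E.

Lemma Lq_bound q f : Lq q f ->
  exists M : R, 0 < M /\ (\int[L]_y (`|f y| `^ q)%:E <= M%:E)%E.
Proof.
move=> [mf fi]; have i0 : (0 <= \int[L]_y (`|f y| `^ q)%:E)%E.
  by apply: integral_ge0 => y _; rewrite lee_fin powR_ge0.
move: fi i0; case: integral => // r _; rewrite lee_fin => r0.
by exists (r + 1); rewrite lee_fin lerDl; split => //; rewrite ltr_pwDr.
Qed.

Lemma le_integral_cube x h f q M : measurable_fun setT (f : M3 R -> R) ->
  (\int[L]_y (`|f y| `^ q)%:E <= M%:E)%E ->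
  (\int[L]_(y in cube x h) (`|f y| `^ q)%:E <= M%:E)%E.
Proof.
move=> mf; apply: le_trans; apply: ge0_subset_integral => //.
- exact: measurable_cube.
- by apply/measurable_EFinP; exact: measurable_powR_norm.
Qed.

Lemma Lq_avg_bound q f h : 1 <= q -> 0 < h -> Lq q f ->
  exists M : R, forall x, `|avg h f x| <= M.
Proof.
move=> q1 h0 fq; have [M [M0 fM]] := Lq_bound fq.
exists (1 + 1 `^ (1 - q) * (M / (8 * h ^+ 3))) => x.
by apply: avg_young => //; [exact: fq.1|exact: le_integral_cube fq.1 fM].
Qed.

Lemma bounded_kern_integrable h x g (M : R) : 0 < h ->
  measurable_fun setT (g : M3 R -> R) -> (forall y, `|g y| <= M) ->
  L.-integrable setT (fun y => (kern h x y * g y)%:E).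
Proof.
move=> h0 mg gM; have M0 : 0 <= M by rewrite (le_trans _ (gM 0)).
apply: (@le_integrable _ _ _ L setT measurableT _ (fun y => (kern h x y * M)%:E)) => //.
- by apply/measurable_EFinP; apply: measurable_funM => //; exact: measurable_kern.
- move=> y _; rewrite /= lee_fin !normrM ler_wpM2l//.
  by rewrite (le_trans (gM y))// ger0_norm.
apply/integrableP; split.
  by apply/measurable_EFinP; apply: measurable_funM => //; exact: measurable_kern.
rewrite (eq_integral (fun y : M3 R => M%:E * (kern h x y)%:E)%E); last first.
  by move=> y _; rewrite abse_EFin -EFinM (ger0_norm (mulr_ge0 (kern_ge0 x y h0) M0)) mulrC.
rewrite ge0_integralZl_EFin//.
- by rewrite integral_kern1// mule1 ltry.
- by move=> y _; rewrite lee_fin kern_ge0.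
- by apply/measurable_EFinP; exact: measurable_kern.
Qed.

Lemma Lq_kern_integrable q f h x : 1 <= q -> 0 < h -> Lq q f ->
  L.-integrable setT (fun y => (kern h x y * f y)%:E).
Proof.
move=> q1 h0 fq; have mf := fq.1.
have mkf : measurable_fun [set: M3 R] (fun y => (kern h x y * f y)%:E).
  by apply/measurable_EFinP; apply: measurable_funM => //; exact: measurable_kern.
have [M [M0 fM]] := Lq_bound fq.
apply/integrableP; split => //.
apply: (@le_lt_trans _ _ (\int[L]_y ((kern h x y)%:E * (1 + (`|f y| `^ q)%:E)))%E).
  apply: ge0_le_integral => //.
  - exact: measurableT_comp.
  - apply: emeasurable_funM; first by apply/measurable_EFinP; exact: measurable_kern.
    by apply: emeasurable_funD => //; apply/measurable_EFinP; exact: measurable_powR_norm.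
  - move=> y _; rewrite -EFinD -EFinM abse_EFin lee_fin normrM ger0_norm ?kern_ge0//.
    rewrite ler_wpM2l ?kern_ge0//.
    by have := @young_split q 1 `|f y| q1 ltr01 (normr_ge0 _); rewrite powR1 mul1r.
rewrite (eq_integral (fun y : M3 R => (kern h x y)%:E + (kern h x y)%:E * (`|f y| `^ q)%:E)%E); last first.
  by move=> y _; rewrite muleDr ?mule1// ge0_adde_def// inE ?lee_fin ?powR_ge0.
rewrite ge0_integralD//.
- rewrite integral_kern1// integral_kern//.
  + apply: lte_add_pinfty; first exact: ltry.
    apply: (@le_lt_trans _ _ (((8 * h ^+ 3)^-1)%:E * M%:E)%E).
      apply: lee_wpmul2l; first by rewrite lee_fin invr_ge0 mulr_ge0// exprn_ge0// ltW.
      exact: le_integral_cube.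
    by rewrite -EFinM ltry.
  + by apply/measurable_EFinP; exact: measurable_powR_norm.
- by move=> y _; rewrite lee_fin kern_ge0.
- by apply/measurable_EFinP; exact: measurable_kern.
- by move=> y _; rewrite -EFinM lee_fin mulr_ge0 ?kern_ge0 ?powR_ge0.
- apply: emeasurable_funM; first by apply/measurable_EFinP; exact: measurable_kern.
  by apply/measurable_EFinP; exact: measurable_powR_norm.
Qed.

Lemma avgB h x f g :
  L.-integrable setT (fun y => (kern h x y * f y)%:E) ->
  L.-integrable setT (fun y => (kern h x y * g y)%:E) ->
  avg h (fun y => f y - g y) x = avg h f x - avg h g x.
Proof.
move=> fi gi; rewrite !avgE -RintegralB//.
by apply: eq_Rintegral => y _; rewrite mulrBr.
Qed.

Lemma Lq_abs q f : Lq q f -> Lq q (fun y => `|f y|).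
Proof.
move=> [mf fi]; split; first exact: measurableT_comp.
by under eq_integral do rewrite normr_id.
Qed.

(** By Fubini both sides integrate [f z] against the convolution of the two kernels, taken in either
    order. *)
Lemma avg_comm q f h k x : 1 <= q -> 0 < h -> 0 < k -> Lq q f ->
  avg h (avg k f) x = avg k (avg h f) x.
Proof.
move=> q1.
have key (a b : R) : 0 < a -> 0 < b -> Lq q f ->
    (avg a (avg b f) x)%:E =
    (\int[L]_z (\int[L]_y ((kern a x y * kern b y z) * f z)%:E))%E.
  move=> a0 b0 fq; have mf := fq.1.
  have mG : measurable_fun setT (fun p : M3 R * M3 R => (kern a x p.1 * kern b p.1 p.2 * f p.2)%:E).
    apply/measurable_EFinP; apply: measurable_funM; last exact: measurableT_comp mf measurable_snd.
    apply: measurable_funM; last exact: measurable_kern2.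
    exact: measurableT_comp (measurable_kern a x) measurable_fst.
  have iG : (L \x L)%E.-integrable setT (fun p : M3 R * M3 R => (kern a x p.1 * kern b p.1 p.2 * f p.2)%:E).
    apply: (iffRL (@integrable12ltyP _ _ _ _ R L L _ mG)).
    have [M fM] := Lq_avg_bound q1 b0 (Lq_abs fq).
    have M0 : 0 <= M by rewrite (le_trans _ (fM 0)).
    rewrite (eq_integral (fun y : M3 R => (kern a x y * avg b (fun z => `|f z|) y)%:E)); last first.
      move=> y _; rewrite EFinM.
      rewrite (eq_integral (fun z : M3 R => (kern a x y)%:E * (kern b y z * `|f z|)%:E)%E); last first.
        move=> z _ /=; rewrite -EFinM 2!normrM mulrA.
        by rewrite (ger0_norm (kern_ge0 x y a0)) (ger0_norm (kern_ge0 y z b0)).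
      have ib := Lq_kern_integrable y q1 b0 (Lq_abs fq).
      rewrite integralZl//; congr (_ * _)%E.
      by rewrite avgE /Rintegral fineK//; exact: integrable_fin_num.
    have := bounded_kern_integrable x a0 (measurable_avg b (Lq_abs fq).1) fM.
    move=> /integrableP[_]; apply: le_lt_trans; apply: ge0_le_integral => //.
    - move=> y _; rewrite lee_fin mulr_ge0 ?kern_ge0//.
      by rewrite avgE; apply: Rintegral_ge0 => z _; rewrite mulr_ge0 ?kern_ge0.
    - by apply/measurable_EFinP; apply: measurable_funM;
        [exact: measurable_kern|exact: (measurable_avg b (Lq_abs fq).1)].
    - apply: measurableT_comp => //; apply/measurable_EFinP; apply: measurable_funM;
        [exact: measurable_kern|exact: (measurable_avg b (Lq_abs fq).1)].
    - by move=> y _; rewrite abse_EFin lee_fin ler_norm.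
  have := Fubini iG => /= <-.
  have [M fM] := Lq_avg_bound q1 b0 fq.
  have ia := bounded_kern_integrable x a0 (measurable_avg b mf) fM.
  rewrite avgE /Rintegral fineK; last exact: integrable_fin_num ia.
  apply: eq_integral => y _; rewrite EFinM.
  have ib := Lq_kern_integrable y q1 b0 fq.
  rewrite avgE /Rintegral fineK; last exact: integrable_fin_num ib.
  rewrite -integralZl//; apply: eq_integral => z _.
  by rewrite -EFinM mulrA.
move=> h0 k0 fq.
suff e : ((avg h (avg k f) x)%:E = (avg k (avg h f) x)%:E)%E by exact: (congr1 fine e).
apply: (etrans (key h k h0 k0 fq)); apply: esym; apply: (etrans (key k h k0 h0 fq)); apply: esym.
apply: eq_integral => z _.
have cst (a b : R) : 0 < a -> 0 < b -> (\int[L]_y ((kern a x y * kern b y z) * f z)%:E =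
    (\int[L]_y (kern a x y * kern b y z)%:E) * (f z)%:E)%E.
  move=> a0 b0; rewrite -integralZr//.
  have mk : measurable_fun setT (kern b ^~ z : M3 R -> R).
    by under eq_fun do rewrite kern_sym; exact: measurable_kern.
  apply: (bounded_kern_integrable x (M := (8 * b ^+ 3)^-1) a0 mk) => y.
  by rewrite ger0_norm ?kern_ge0// kern_le.
apply: (etrans (cst h k h0 k0)); apply: esym; apply: (etrans (cst k h k0 h0)); apply: esym; congr (_ * _)%E.
have mm a b : measurable_fun [set: M3 R] (fun y => (kern a x y * kern b y z)%:E).
  apply/measurable_EFinP; apply: measurable_funM; first exact: measurable_kern.
  under eq_fun do rewrite kern_sym; exact: measurable_kern.
(* The reflection y -> x + z - y exchanges the two kernels. *)
have [mT iT] := mpres_comp (mpres_shift (x + z)) (@mpres_opp R).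
rewrite -[RHS]iT//; last by move=> y; rewrite lee_fin mulr_ge0 ?kern_ge0.
apply: eq_integral => y _ /=; congr EFin; rewrite mulrC; congr (_ * _).
- apply: kern_eq; rewrite !cubeP/=.
  have e u v w : u + v - w - u = v - w :> R by ring.
  by rewrite !e.
- apply: kern_eq; rewrite !cubeP/=.
  have e u v w : v - (u + v - w) = w - u :> R by ring.
  by rewrite !e.
Qed.

Lemma powRDp (a u v : R) : 0 < a -> a `^ (u + v) = a `^ u * a `^ v.
Proof. by move=> a0; rewrite powRD// (gt_eqF a0) implybT. Qed.

Lemma powRXp (a u : R) (n : nat) : (a `^ u) ^+ n = a `^ (u * n%:R).
Proof. by rewrite -powR_mulrn ?powR_ge0// -powRrM. Qed.

(** Cauchy-Schwarz up to a factor 2: with q = 2 and eta = e the two terms of [avg_young] are both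
    [e]. *)
Lemma avg_L2 (e : R) h g x : 0 < e -> 0 < h -> measurable_fun setT (g : M3 R -> R) ->
  (\int[L]_(y in cube x h) (g y ^+ 2)%:E <= (e ^+ 2 * (8 * h ^+ 3))%:E)%E ->
  `|avg h g x| <= 2 * e.
Proof.
move=> e0 h0 mg gi.
have := @avg_young 2 e (e ^+ 2 * (8 * h ^+ 3)) h g x (ler1n _ 2) e0 h0 mg.
have -> : (\int[L]_(y in cube x h) (`|g y| `^ 2)%:E = \int[L]_(y in cube x h) (g y ^+ 2)%:E)%E.
  by apply: eq_integral => y _; rewrite powR_mulrn// real_normK// num_real.
move=> /(_ gi) /le_trans; apply.
have -> : 1 - 2 = -1 :> R by lra.
rewrite powR_inv1 ?(ltW e0)// mulfK; last by rewrite mulf_neq0 ?expf_neq0 ?gt_eqF.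
have -> : e^-1 * e ^+ 2 = e by rewrite expr2 mulKf ?gt_eqF.
lra.
Qed.

End Averages.

(** * Dyadic Besov norm and the endpoint embedding *)

HB.lock Definition dy {R : realType} (z : int) : R := 2 `^ z%:~R.

Section Besov.
Variable R : realType.
Local Notation mu := (@lebesgue_measure R).
Local Notation L := (@leb3 R).
Implicit Types (f g : R3 R -> R) (x y : R3 R) (h k s : R) (z : int).

Lemma dyE z : dy z = 2 `^ z%:~R :> R. Proof. by rewrite dy.unlock. Qed.

Lemma dy_gt0 z : 0 < dy z :> R. Proof. by rewrite dyE powR_gt0. Qed.

Lemma dyS z : dy (z + 1) = 2 * dy z :> R.
Proof. by rewrite !dyE intrD powRDp// powRr1// mulrC. Qed.

Lemma dyD z z' : dy (z + z') = dy z * dy z' :> R.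
Proof. by rewrite !dyE intrD powRDp. Qed.

Lemma dyadic_above (y : R) : 0 < y -> exists z, y <= dy z <= 2 * y.
Proof.
move=> y0; have l2 : 0 < ln (2 : R) by rewrite ln_gt0// ltr1n.
pose w := ln y / ln 2; have yw : y = 2 `^ w.
  by rewrite /powR gt_eqF//= divfK ?gt_eqF// lnK.
exists (Num.floor w + 1); rewrite {1}yw dyE ler_powR ?ler1n//=; last first.
  by rewrite ltW// floorD1_gt.
by rewrite -dyE dyS ler_pM2l// yw dyE ler_powR ?ler1n// ge_floor.
Qed.

Definition Ek s f z x : R := dy z `^ (- (2 * s)) * (f x - avg (dy z) f x) ^+ 2.

(* Scale 1 is counted twice. *)
Definition Bfun s f x : \bar R :=
  \big[+%E/0%E]_(0 <= k <oo) (Ek s f k%:Z x + Ek s f (- k%:Z) x)%:E.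

Definition Bnorm s f : \bar R := (\int[L]_x Bfun s f x)%E.

Lemma Ek_ge0 s f z x : 0 <= Ek s f z x.
Proof. by rewrite mulr_ge0 ?powR_ge0 ?sqr_ge0. Qed.

Lemma Bfun_ge0 s f x : (0 <= Bfun s f x)%E.
Proof. by apply: nneseries_ge0 => k _ _; rewrite lee_fin addr_ge0 ?Ek_ge0. Qed.

Lemma Bfun_ge s f z x : ((Ek s f z x)%:E <= Bfun s f x)%E.
Proof.
have t (k : nat) : ((Ek s f k%:Z x + Ek s f (- k%:Z) x)%:E <= Bfun s f x)%E.
  have := @nneseries_lim_ge R (fun k : nat => (Ek s f k%:Z x + Ek s f (- k%:Z) x)%:E) xpredT 0 k.+1.
  have g0 n : (0 <= n)%N -> true -> (0 <= (Ek s f n%:Z x + Ek s f (- n%:Z) x)%:E)%E.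
    by move=> _ _; rewrite lee_fin addr_ge0 ?Ek_ge0.
  move=> /(_ g0); apply: le_trans; rewrite big_nat_recr//= leeDr//.
  by apply: sume_ge0 => i _; exact: g0.
case: z => n; first by apply: (le_trans _ (t n)); rewrite lee_fin lerDl Ek_ge0.
by rewrite NegzE; apply: (le_trans _ (t n.+1)); rewrite lee_fin lerDr Ek_ge0.
Qed.

Lemma measurable_Ek s f z : measurable_fun setT (f : M3 R -> R) ->
  measurable_fun setT (Ek s f z : M3 R -> R).
Proof.
move=> mf; apply: measurable_funM => //; apply: measurable_funX.
by apply: measurable_funB => //; exact: measurable_avg.
Qed.

Lemma measurable_Bfun s f : measurable_fun setT (f : M3 R -> R) ->
  measurable_fun setT (Bfun s f : M3 R -> \bar R).
Proof.
move=> mf; apply: ge0_emeasurable_sum.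
  by move=> k y _ _; rewrite lee_fin addr_ge0 ?Ek_ge0.
by move=> k _; apply/measurable_EFinP; apply: measurable_funD; exact: measurable_Ek.
Qed.

Lemma osc_L2 s f z : measurable_fun setT (f : M3 R -> R) -> (Bnorm s f <= 1)%E ->
  (\int[L]_x ((f x - avg (dy z) f x) ^+ 2)%:E <= (dy z `^ (2 * s))%:E)%E.
Proof.
move=> mf B1.
have d0 := dy_gt0 z.
have e x : (((f x - avg (dy z) f x) ^+ 2)%:E = (dy z `^ (2 * s))%:E * (Ek s f z x)%:E)%E.
  rewrite -EFinM /Ek mulrA -powRD; last by rewrite (gt_eqF d0) implybT.
  by rewrite subrr powRr0 mul1r.
under eq_integral do rewrite e.
rewrite ge0_integralZl_EFin ?powR_ge0//.
- rewrite -[leRHS]mule1; apply: lee_wpmul2l; first by rewrite lee_fin powR_ge0.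
  apply: le_trans B1; apply: ge0_le_integral => //.
  + by move=> x _; rewrite lee_fin Ek_ge0.
  + by apply/measurable_EFinP; exact: measurable_Ek.
  + exact: measurable_Bfun.
  + by move=> x _; exact: Bfun_ge.
- by move=> x _; rewrite lee_fin Ek_ge0.
- by apply/measurable_EFinP; exact: measurable_Ek.
Qed.

Lemma avg_osc s f z h (e : R) x : measurable_fun setT (f : M3 R -> R) -> (Bnorm s f <= 1)%E ->
  0 < e -> 0 < h -> dy z `^ (2 * s) <= e ^+ 2 * (8 * h ^+ 3) ->
  `|avg h (fun y => f y - avg (dy z) f y) x| <= 2 * e.
Proof.
move=> mf B1 e0 h0 le; have mg : measurable_fun setT ((fun y => f y - avg (dy z) f y) : M3 R -> R).
  by apply: measurable_funB => //; exact: measurable_avg.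
apply: avg_L2 => //; apply: (@le_trans _ _ (dy z `^ (2 * s))%:E); last by rewrite lee_fin.
apply: le_trans (osc_L2 z mf B1); apply: ge0_subset_integral => //.
- exact: measurable_cube.
- by apply/measurable_EFinP; exact: measurable_funX.
- by move=> y _; rewrite lee_fin sqr_ge0.
Qed.

Lemma Lq_avg_integrable q f h k x : 1 <= q -> 0 < h -> 0 < k -> Lq q f ->
  L.-integrable setT (fun y => (kern h x y * avg k f y)%:E).
Proof.
move=> q1 h0 k0 fq; have [M fM] := Lq_avg_bound q1 k0 fq.
by apply: (bounded_kern_integrable x h0 _ fM); exact: measurable_avg fq.1.
Qed.

(** The averages at scales h and 2h are both compared with the double average over the two scales.
    As averages commute, each difference is the average of an oscillation of [f], which [osc_L2]
    controls. *)
Lemma avg_step q s f z x : 0 <= s -> 1 <= q -> Lq q f -> (Bnorm s f <= 1)%E ->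
  `|avg (dy z) f x| <= 4 * 2 `^ s * dy z `^ (s - 3 / 2) + `|avg (dy (z + 1)) f x|.
Proof.
move=> s0 q1 fq B1; have d0 := dy_gt0 z; have d1 := dy_gt0 (z + 1).
pose e := 2 `^ s * dy z `^ (s - 3 / 2).
have e0 : 0 < e by rewrite mulr_gt0 ?powR_gt0.
have e2 : e ^+ 2 * (8 * dy z ^+ 3) = 8 * (2 `^ (2 * s) * dy z `^ (2 * s)).
  have -> : (dy z : R) ^+ 3 = dy z `^ 3 by rewrite powR_mulrn// ltW.
  have E1 : e ^+ 2 = 2 `^ (2 * s) * dy z `^ (2 * s - 3).
    rewrite /e exprMn (powRXp 2) (powRXp (dy z)); congr (_ `^ _ * _ `^ _); clear; lra.
  have E2 : (dy z : R) `^ (2 * s) = dy z `^ (2 * s - 3) * dy z `^ 3.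
    by rewrite -powRDp// subrK.
  by rewrite E1 E2; ring.
have H1 : `|avg (dy z) (fun y => f y - avg (dy (z + 1)) f y) x| <= 2 * e.
  apply: (avg_osc (s := s)) => //; first exact: fq.1.
  rewrite e2 dyS (powRM _ (ler0n _ 2) (ltW d0)) ler_peMl ?mulr_ge0 ?powR_ge0//; lra.
have H2 : `|avg (dy (z + 1)) (fun y => f y - avg (dy z) f y) x| <= 2 * e.
  apply: (avg_osc (s := s)) => //; first exact: fq.1.
  rewrite dyS (_ : e ^+ 2 * _ = 8 * (e ^+ 2 * (8 * dy z ^+ 3))); last by rewrite exprMn; ring.
  rewrite e2 !mulrA ler_peMl ?powR_ge0//.
  have : 1 <= 2 `^ (2 * s) by rewrite -{1}(@powRr0 _ 2) ler_powR ?ler1n// mulr_ge0.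
  lra.
rewrite avgB in H1; [|exact: Lq_kern_integrable fq|exact: Lq_avg_integrable fq].
rewrite avgB in H2; [|exact: Lq_kern_integrable fq|exact: Lq_avg_integrable fq].
rewrite (avg_comm _ q1 d1 d0 fq) in H2.
rewrite -[4 * 2 `^ s * _]mulrA -/e.
move: H1 H2; set A := avg _ f x; set B := avg (dy (z+1)) f x; set D := avg _ (avg _ f) x => H1 H2.
have -> : A = (A - D) - (B - D) + B by ring.
rewrite (le_trans (ler_normD _ _))// lerD2r (le_trans (ler_normB _ _))//; lra.
Qed.

(** A purely qualitative fact, which closes the telescoping sum over scales; for this reason the
    exponent [q] leaves no trace in the constants below. *)
Lemma avg_vanish q f x (eps : R) z : 1 <= q -> Lq q f -> 0 < eps ->
  exists n : nat, `|avg (dy (z + n%:Z)) f x| <= eps.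
Proof.
move=> q1 fq e0; have [M [M0 fM]] := Lq_bound fq.
pose T := (eps / 2) `^ (1 - q) * M / (8 * dy z ^+ 3).
have d0 := dy_gt0 z.
have T0 : 0 <= T by rewrite divr_ge0 ?mulr_ge0 ?powR_ge0 ?exprn_ge0// ltW.
have [n nT] : exists n : nat, T / (eps / 2) <= n%:R.
  by exists (Num.truncn (T / (eps / 2))).+1; rewrite ltW// truncnS_gt.
exists n; have dn := dy_gt0 (z + n%:Z).
have e2 : 0 < eps / 2 by rewrite divr_gt0.
have := avg_young q1 e2 dn fq.1 (le_integral_cube x _ fq.1 fM).
move=> /le_trans; apply.
rewrite {3}(splitr eps) lerD2l mulrA dyD exprMn.
have -> : (eps / 2) `^ (1 - q) * M / (8 * (dy z ^+ 3 * dy n ^+ 3)) = T / dy n ^+ 3.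
  by rewrite /T; field; rewrite !gt_eqF// dy_gt0.
rewrite ler_pdivrMr ?exprn_gt0 ?dy_gt0// mulrC -ler_pdivrMr ?divr_gt0//.
apply: (le_trans nT); have -> : dy n = 2 ^+ n :> R by rewrite dyE powR_mulrn.
rewrite -exprM -natrX ler_nat (leq_trans (ltnW (ltn_expl n (ltnSn 1))))//.
by rewrite leq_exp2l// leq_pmulr.
Qed.

(** The increments of [avg_step] form a geometric series over the scales above [z], with ratio 2^(s
    - 3/2) < 1, and the far end of the sum vanishes. *)
Lemma low_freq_bound s : 0 <= s < 3 / 2 -> exists K : R, 0 < K /\
  forall q f z x, 1 <= q -> Lq q f -> (Bnorm s f <= 1)%E ->
  `|avg (dy z) f x| <= K * dy z `^ (s - 3 / 2).
Proof.
move=> /andP[s0 s3]; pose r := 2 `^ (s - 3 / 2) : R.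
have r0 : 0 < r by rewrite powR_gt0.
have r1 : r < 1.
  have -> : r = (2 `^ (3 / 2 - s))^-1 by rewrite -powRN opprB.
  rewrite invf_lt1 ?powR_gt0//.
  have g0 : 0 < 3 / 2 - s by rewrite subr_gt0.
  have := gt0_ltr_powR g0 (ler01 : (1 : R) \in Num.nneg) (ler0n _ 2 : (2 : R) \in Num.nneg) (ltr1n _ 2).
  by rewrite powR1.
pose c := 4 * 2 `^ s : R; have c0 : 0 < c by rewrite mulr_gt0 ?powR_gt0.
exists (c / (1 - r)); split; first by rewrite divr_gt0// subr_gt0.
move=> q f z x q1 fq B1; set K := c / (1 - r).
have Kr : K * (1 - r) = c by rewrite divfK// subr_eq0 gt_eqF.
pose u w : R := dy w `^ (s - 3 / 2).
have uS w : u (w + 1) = r * u w by rewrite /u dyS (powRM _ (ler0n _ 2) (ltW (dy_gt0 w))).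
have u0 w : 0 < u w by rewrite powR_gt0 ?dy_gt0.
(* As c = K (1 - r), the partial sums of the geometric series are these differences. *)
have ind n : `|avg (dy z) f x| <= K * (u z - u (z + n%:Z)) + `|avg (dy (z + n%:Z)) f x|.
  elim: n => [|n IH]; first by rewrite addr0 subrr mulr0 add0r.
  apply: (le_trans IH); have := avg_step (z + n%:Z) x s0 q1 fq B1.
  have -> : z + n.+1%:Z = z + n%:Z + 1 by rewrite -addrA -addn1.
  rewrite uS -/c -Kr -/(u (z + n%:Z)).
  move: (u z) (u (z + n%:Z)) `|_| `|_| => a b v w vw.
  have -> : K * (a - r * b) = K * (a - b) + K * (1 - r) * b by ring.
  by rewrite -addrA lerD2l.
apply/ler_addgt0Pr => eps e0.
have [n nv] := avg_vanish x z q1 fq e0.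
apply: (le_trans (ind n)); apply: lerD => //.
have K0 : 0 < K by rewrite divr_gt0// subr_gt0.
by rewrite ler_pM2l// lerBlDr lerDl ltW.
Qed.

(* Telescoping over the scales above h gives [|avg h f| <= c h^(s - 3/2)]; one
   then takes the dyadic h for which this is a fraction of [|f x|]. *)
Lemma sobolev_pointwise s : 0 <= s < 3 / 2 -> exists C : R, 0 < C /\
  forall q f x, 1 <= q -> Lq q f -> (Bnorm s f <= 1)%E ->
  ((`|f x| `^ (6 / (3 - 2 * s)))%:E <= C%:E * Bfun s f x)%E.
Proof.
move=> s03; have /andP[s0 s3] := s03; have [K [K0 HK]] := low_freq_bound s03.
pose p := 6 / (3 - 2 * s).
have p2 : 2 <= p by rewrite /p ler_pdivlMr; lra.
pose g := 3 / 2 - s; have g0 : 0 < g by rewrite /g; lra.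
pose D := (2 * K * 2 `^ g) `^ (p - 2).
exists (4 * D + 1); split; first by rewrite ltr_wpDl// mulr_ge0 ?powR_ge0.
move=> q f x q1 fq B1.
have [->|fx0] := eqVneq (f x) 0.
  rewrite normr0 powR0; last by rewrite gt_eqF// (lt_le_trans _ p2).
  by rewrite mule_ge0 ?Bfun_ge0// lee_fin addr_ge0 ?mulr_ge0 ?powR_ge0.
set t := `|f x|; have t0 : 0 < t by rewrite normr_gt0.
pose tau := t / (2 * K); have tau0 : 0 < tau by rewrite divr_gt0 ?mulr_gt0.
(* [y] solves K y^(- g) = t / 2, so the average at any scale above it is at most t / 2; rounding to
   a dyadic scale costs the factor 2^g. *)
pose y := tau `^ (- g^-1); have y0 : 0 < y by rewrite powR_gt0.
have yg : y `^ (- g) = tau by rewrite /y -powRrM mulrNN mulVf ?gt_eqF// powRr1// ltW.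
have [z /andP[yz zy]] := dyadic_above y0; have d0 := dy_gt0 z.
have antig a b : 0 < a -> a <= b -> b `^ (- g) <= a `^ (- g).
  move=> a0 ab; have b0 := lt_le_trans a0 ab.
  rewrite !powRN lef_pV2 ?posrE ?powR_gt0// ge0_ler_powR ?nnegrE ?(ltW g0) ?(ltW a0) ?(ltW b0)//.
have u1 : dy z `^ (- g) <= tau by rewrite -yg antig.
have u2 : tau <= 2 `^ g * dy z `^ (- g).
  have := antig _ _ d0 zy; rewrite (powRM _ (ler0n _ 2) (ltW y0)) yg.
  rewrite -(ler_pM2l (powR_gt0 g (ltr0n R 2))) mulrA -powRDp//.
  by rewrite subrr powRr0 mul1r.
have a1 : `|avg (dy z) f x| <= t / 2.
  apply: (le_trans (HK q f z x q1 fq B1)).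
  have -> : s - 3 / 2 = - g by rewrite opprB.
  apply: (le_trans (ler_wpM2l (ltW K0) u1)); rewrite /tau.
  by rewrite le_eqVlt; apply/orP; left; apply/eqP; field; rewrite gt_eqF.
have a2 : t ^+ 2 <= 4 * (f x - avg (dy z) f x) ^+ 2.
  have h1 : t / 2 <= `|f x - avg (dy z) f x|.
    have := lerB_dist (f x) (avg (dy z) f x); rewrite -/t.
    by move: a1; clear; set a := `|_|; set b := `|_|; move=> h1 h2; lra.
  rewrite -(real_normK (num_real (_ - _))) (_ : 4 = 2 ^+ 2); last by ring.
  by rewrite -exprMn lerXn2r ?nnegrE ?mulr_ge0 ?(ltW t0)//; move: h1; clear; lra.
(* The endpoint exponent enters here: (p - 2) g = 2 s turns the size of [t] into the weight of
   [Ek]. *)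
have a3 : t `^ (p - 2) <= D * dy z `^ (- (2 * s)).
  have -> : dy z `^ (- (2 * s)) = (dy z `^ (- g)) `^ (p - 2).
    by rewrite -powRrM; congr (_ `^ _); rewrite /g /p; clear - s3; field; lra.
  rewrite /D -powRM ?mulr_ge0 ?powR_ge0 ?(ltW K0)//.
  rewrite ge0_ler_powR ?nnegrE ?mulr_ge0 ?powR_ge0 ?(ltW K0) ?subr_ge0// ?(ltW t0)//.
  rewrite -mulrA -ler_pdivrMl ?mulr_gt0//.
  by rewrite mulrC -/tau.
apply: (@le_trans _ _ ((4 * D + 1)%:E * (Ek s f z x)%:E)%E); last first.
  by apply: lee_wpmul2l; [rewrite lee_fin addr_ge0 ?mulr_ge0 ?powR_ge0|exact: Bfun_ge].
rewrite -EFinM lee_fin -/p -[p](subrK 2) powRDp// powR_mulrn ?(ltW t0)//.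
apply: (@le_trans _ _ (4 * D * Ek s f z x)); last first.
  by rewrite ler_wpM2r ?Ek_ge0// lerDl.
rewrite /Ek; apply: (le_trans (ler_pM _ _ a3 a2)); rewrite ?powR_ge0 ?sqr_ge0//.
by rewrite le_eqVlt; apply/orP; left; apply/eqP; ring.
Qed.

Lemma sobolev_embedding s : 0 <= s < 3 / 2 -> exists C : R, 0 < C /\
  forall q f, 1 <= q -> Lq q f -> (Bnorm s f <= 1)%E ->
  (\int[L]_x (`|f x| `^ (6 / (3 - 2 * s)))%:E <= C%:E)%E.
Proof.
move=> s03; have [C [C0 HC]] := sobolev_pointwise s03; exists C; split => //.
move=> q f q1 fq B1.
apply: (@le_trans _ _ (\int[L]_x (C%:E * Bfun s f x))%E).
  apply: ge0_le_integral => //.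
  - by apply/measurable_EFinP; exact: measurable_powR_norm fq.1.
  - by apply: measurable_funeM; exact: measurable_Bfun fq.1.
  - by move=> x _; exact: (HC q).
rewrite ge0_integralZl_EFin// ?(ltW C0)//.
- rewrite -[leRHS]mule1; apply: lee_wpmul2l => //; by rewrite lee_fin ltW.
- by move=> x _; exact: Bfun_ge0.
- exact: measurable_Bfun fq.1.
Qed.

End Besov.

(** * Rotations and the Coulomb energy *)

Section Radial.
Variable R : realType.
Local Notation mu := (@lebesgue_measure R).
Local Notation L := (@leb3 R).
Implicit Types (f g : R3 R -> R) (x y : R3 R) (h k s : R).

Lemma mpres_measure (T : R3 R -> R3 R) (A : set (M3 R)) : mpres T ->
  measurable A -> L (T @^-1` A) = L A.
Proof.
move=> [mT iT] mA.
have e B : measurable B -> (L B = \int[L]_x (\1_B x)%:E)%E.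
  by move=> mB; rewrite integral_indic// setIT.
rewrite e; last by rewrite -[X in measurable X]setTI; exact: mT.
rewrite (e A mA) -(iT (fun x => (\1_A x)%:E))//.
by apply/measurable_EFinP; exact: measurable_indic.
Qed.

Lemma ae_imply (P Q : M3 R -> Prop) : (forall x, P x -> Q x) ->
  {ae L, forall x, P x} -> {ae L, forall x, Q x}.
Proof.
by move=> PQ [A [mA A0 sA]]; exists A; split => // x /= nQ; apply: sA => /PQ.
Qed.

Lemma ae_imply2 (P Q S : M3 R -> Prop) : (forall x, P x -> Q x -> S x) ->
  {ae L, forall x, P x} -> {ae L, forall x, Q x} -> {ae L, forall x, S x}.
Proof.
move=> PQ [A [mA A0 sA]] [B [mB B0 sB]]; exists (A `|` B); split.
- exact: measurableU.
- by apply: null_set_setU.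
- move=> x /= nS; have [Px|nP] := pselect (P x); last by left; exact: sA.
  by right; apply: sB => Qx; apply: nS; exact: PQ.
Qed.

Lemma sqr_ltE (u v : R) : 0 <= v -> (u ^+ 2 < v ^+ 2) = (`|u| < v).
Proof.
by move=> v0; rewrite -(real_normK (num_real u)) ltr_pXn2r// nnegrE.
Qed.

Lemma sqr_leE (u v : R) : 0 <= v -> (u ^+ 2 <= v ^+ 2) = (`|u| <= v).
Proof.
by move=> v0; rewrite -(real_normK (num_real u)) ler_pXn2r// nnegrE.
Qed.

Lemma mpres_ae (T : R3 R -> R3 R) (P : R3 R -> Prop) : mpres T ->
  {ae L, forall x, P x} -> {ae L, forall x, P (T x)}.
Proof.
move=> hT [A [mA A0 sA]]; exists (T @^-1` A); split.
- by rewrite -[X in measurable X]setTI; exact: hT.1.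
- by rewrite (mpres_measure hT mA).
- by move=> x /= Px; exact: sA.
Qed.

(** Almost everywhere and for each rotation separately, since [radial] only constrains a function
    outside a null set. Rotations about two axes already carry every point to the positive first
    axis. *)
Definition rot_inv f := forall c s : R, c ^+ 2 + s ^+ 2 = 1 ->
  {ae L, forall x, f (rot12 c s x) = f x} /\ {ae L, forall x, f (rot23 c s x) = f x}.

Lemma dot3_rot12 (c s : R) x y : c ^+ 2 + s ^+ 2 = 1 ->
  dot3 (rot12 c s x) (rot12 c s y) = dot3 x y.
Proof.
move=> e; rewrite /dot3 /rot12/=.
transitivity ((c ^+ 2 + s ^+ 2) * (x.1.1 * y.1.1 + x.1.2 * y.1.2) + x.2 * y.2); first by ring.
by rewrite e mul1r.
Qed.

Lemma dot3_rot23 (c s : R) x y : c ^+ 2 + s ^+ 2 = 1 ->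
  dot3 (rot23 c s x) (rot23 c s y) = dot3 x y.
Proof.
move=> e; rewrite /dot3 /rot23/=.
transitivity (x.1.1 * y.1.1 + (c ^+ 2 + s ^+ 2) * (x.1.2 * y.1.2 + x.2 * y.2)); first by ring.
by rewrite e mul1r addrA.
Qed.

Lemma radial_rot_inv (phi : R3 R -> R[i]) (P : R[i] -> R) : radial phi ->
  rot_inv (fun x => P (phi x)).
Proof.
move=> [g [gE ag]] c s e.
have key (T : R3 R -> R3 R) : mpres T -> (forall x, dot3 (T x) (T x) = dot3 x x) ->
    {ae L, forall x, P (phi (T x)) = P (phi x)}.
  move=> hT dT; have ag' := mpres_ae hT ag.
  apply: ae_imply2 ag ag' => x -> ->; congr P; apply: gE.
  by rewrite /eucl dT.
split; apply: key.
- exact: mpres_rot12.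
- by move=> x; exact: dot3_rot12.
- exact: mpres_rot23.
- by move=> x; exact: dot3_rot23.
Qed.

Definition dist2 x y : R := dot3 (x - y) (x - y).

Lemma measurable_dot3 (d : measure_display) (T : measurableType d) (a b : T -> R3 R) :
  measurable_fun setT (a : T -> M3 R) -> measurable_fun setT (b : T -> M3 R) ->
  measurable_fun setT (fun t => dot3 (a t) (b t)).
Proof.
move=> ma mb; apply: measurable_funD; [apply: measurable_funD|]; apply: measurable_funM.
- exact: measurableT_comp (@measurable_c1 R) ma.
- exact: measurableT_comp (@measurable_c1 R) mb.
- exact: measurableT_comp (@measurable_c2 R) ma.
- exact: measurableT_comp (@measurable_c2 R) mb.
- exact: measurableT_comp (@measurable_c3 R) ma.
- exact: measurableT_comp (@measurable_c3 R) mb.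
Qed.

Lemma measurable_eucl (d : measure_display) (T : measurableType d) (a : T -> R3 R) :
  measurable_fun setT (a : T -> M3 R) -> measurable_fun setT (fun t => eucl (a t)).
Proof.
move=> ma; rewrite (_ : (fun t => _) = (fun t => `|dot3 (a t) (a t)| `^ 2^-1)).
  by apply: measurable_powR_norm; exact: measurable_dot3.
have d0 t : 0 <= dot3 (a t) (a t) by rewrite /dot3 -!expr2 !addr_ge0 ?sqr_ge0.
by apply/funext => t; rewrite ger0_norm// powR12_sqrt.
Qed.

(** Rotations preserve balls but not cubes, so the mass of a cube is bounded by that of a ball
    before it is moved. *)
Definition ballmass f x r : \bar R :=
  (\int[L]_y (if dist2 y x < r ^+ 2 then f y ^+ 2 else 0)%:E)%E.

Lemma measurable_ballmass f x r : measurable_fun setT (f : M3 R -> R) ->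
  measurable_fun setT ((fun y => (if dist2 y x < r ^+ 2 then f y ^+ 2 else 0)%:E) : M3 R -> \bar R).
Proof.
move=> mf; apply/measurable_EFinP; apply: measurable_fun_ifT => //.
- apply: measurable_fun_ltr => //.
  have ms : measurable_fun setT ((fun y => y - x) : M3 R -> M3 R).
    by apply: measurable_sub3 => //; exact: measurable_id.
  exact: measurable_dot3.
- exact: measurable_funX.
Qed.

Lemma ballmass_rot f x r (T : R3 R -> R3 R) : measurable_fun setT (f : M3 R -> R) ->
  mpres T -> (forall x y, dist2 (T x) (T y) = dist2 x y) ->
  {ae L, forall x, f (T x) = f x} -> ballmass f (T x) r = ballmass f x r.
Proof.
move=> mf hT dT aT; have mb := measurable_ballmass (T x) r mf.
rewrite /ballmass -(hT.2 _ mb); last first.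
  by move=> y; case: ifPn => // _; rewrite lee_fin sqr_ge0.
apply: ge0_ae_eq_integral => //.
- exact: (measurableT_comp mb hT.1).
- exact: measurable_ballmass.
- by move=> y _; case: ifPn => // _; rewrite lee_fin sqr_ge0.
- by move=> y _; case: ifPn => // _; rewrite lee_fin sqr_ge0.
- by apply: ae_imply aT => y -> _; rewrite dT.
Qed.

Lemma rotation_exists (a b : R) : exists c s, [/\ c ^+ 2 + s ^+ 2 = 1,
  c * a - s * b = Num.sqrt (a ^+ 2 + b ^+ 2) & s * a + c * b = 0].
Proof.
set t := Num.sqrt _; have t0 : 0 <= t by exact: sqrtr_ge0.
have tt : t ^+ 2 = a ^+ 2 + b ^+ 2 by rewrite sqr_sqrtr// addr_ge0 ?sqr_ge0.
have [e|tn] := eqVneq t 0.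
  have : a ^+ 2 + b ^+ 2 == 0 by rewrite -tt e expr0n.
  rewrite paddr_eq0 ?sqr_ge0// !sqrf_eq0 => /andP[/eqP -> /eqP ->].
  by exists 1, 0; split; rewrite ?e; ring.
exists (a / t), (- (b / t)); split.
- rewrite sqrrN !exprMn -mulrDl -tt exprVn mulfV// expf_neq0//.
- have -> : a / t * a - - (b / t) * b = (a ^+ 2 + b ^+ 2) / t by field.
  by rewrite -tt expr2 mulfK.
- by field.
Qed.

(** A rotation of the last two coordinates kills the third, then one of the first two kills the
    second. Integrals over balls do not see the null sets in [rot_inv]. *)
Lemma ballmass_radial f x r : measurable_fun setT (f : M3 R -> R) -> rot_inv f ->
  ballmass f x r = ballmass f (eucl x, 0, 0) r.
Proof.
move=> mf rf.
have [c [s [cs e1 e2]]] := rotation_exists x.1.2 x.2.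
set t := Num.sqrt _ in e1; have t2 : t ^+ 2 = x.1.2 ^+ 2 + x.2 ^+ 2.
  by rewrite sqr_sqrtr// addr_ge0 ?sqr_ge0.
have [c' [s' [cs' e1' e2']]] := rotation_exists x.1.1 t.
have lin12 (a b : R) u v : rot12 a b u - rot12 a b v = rot12 a b (u - v).
  by rewrite /rot12; congr (_, _, _); rewrite /=; ring.
have lin23 (a b : R) u v : rot23 a b u - rot23 a b v = rot23 a b (u - v).
  by rewrite /rot23; congr (_, _, _); rewrite /=; ring.
rewrite -(@ballmass_rot f x r (rot23 c s) mf (mpres_rot23 cs)); last 2 first.
- by move=> u v; rewrite /dist2 lin23 dot3_rot23.
- exact: (rf c s cs).2.
rewrite -(@ballmass_rot f (rot23 c s x) r (rot12 c' s') mf (mpres_rot12 cs')); last 2 first.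
- by move=> u v; rewrite /dist2 lin12 dot3_rot12.
- exact: (rf c' s' cs').1.
congr ballmass; rewrite /rot23 /rot12/= e1 e2 e1' e2' t2; congr (_, _, _).
by rewrite /eucl /dot3 -!expr2 addrA.
Qed.

(* The points of this grid lie on the sphere of radius rho, and the balls of
   radius 2h around them are disjoint. *)
Definition gridpt (rho h : R) (i j : nat) : R3 R :=
  (Num.sqrt (rho ^+ 2 - (i%:R * (4 * h)) ^+ 2 - (j%:R * (4 * h)) ^+ 2),
   i%:R * (4 * h), j%:R * (4 * h)).

Lemma grid_sep (h : R) (i j : nat) (t : R) : 0 < h ->
  (t - i%:R * (4 * h)) ^+ 2 < (2 * h) ^+ 2 -> (t - j%:R * (4 * h)) ^+ 2 < (2 * h) ^+ 2 ->
  i = j.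
Proof.
move=> h0.
have key (a b : nat) : (a < b)%N -> (t - a%:R * (4 * h)) ^+ 2 < (2 * h) ^+ 2 ->
    (t - b%:R * (4 * h)) ^+ 2 < (2 * h) ^+ 2 -> False.
  move=> ab; have ab' : a%:R + 1 <= b%:R :> R by rewrite natr1 ler_nat.
  have h2 : 0 <= 2 * h by lra.
  rewrite !sqr_ltE// !ltr_distl.
  move=> /andP[_ u1] /andP[u2 _].
  have : (a%:R + 1) * (4 * h) <= b%:R * (4 * h) by rewrite ler_pM2r//; lra.
  lra.
by move=> hi hj; case: (ltngtP i j) => // ij; [case: (key _ _ ij)|case: (key _ _ ij)].
Qed.

(** Both grid coordinates are at most rho / 2, so the number under the square root in [gridpt] is
    nonnegative and the root is a genuine one. *)
Lemma gridpt_eucl (rho h : R) (i j n : nat) : 0 < rho -> 0 < h ->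
  n%:R * (8 * h) <= rho -> (i <= n)%N -> (j <= n)%N -> eucl (gridpt rho h i j) = rho.
Proof.
move=> r0 h0 nr.
have key (k : nat) : (k <= n)%N -> 0 <= k%:R * (4 * h) <= rho / 2.
  move=> kn; rewrite mulr_ge0//=; last lra.
  have : k%:R * (4 * h) <= n%:R * (4 * h) by rewrite ler_pM2r ?ler_nat//; lra.
  lra.
move=> /key; set a := _%:R * _ => /andP[a0 a1] /key; set b := _%:R * _ => /andP[b0 b1].
rewrite /eucl /dot3 /gridpt/= -/a -/b -expr2 sqr_sqrtr.
  have -> : rho ^+ 2 - a ^+ 2 - b ^+ 2 + a * a + b * b = rho ^+ 2 by ring.
  by rewrite sqrtr_sqr ger0_norm// ltW.
nra.
Qed.

(** The balls around the grid points all carry the mass of the ball around [x], they are disjoint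
    and contained in the cube, and they number at least (rho / (8 h))^2. *)
Lemma ballmass_grid f (rho h : R) x : 0 < h -> h <= rho -> eucl x = rho ->
  measurable_fun setT (f : M3 R -> R) -> rot_inv f ->
  (((rho / (8 * h)) ^+ 2)%:E * ballmass f x (2 * h) <=
   \int[L]_(y in cube 0%R (3 * rho)) (f y ^+ 2)%:E)%E.
Proof.
move=> h0 hr xr mf rf; have r0 : 0 < rho by rewrite (lt_le_trans h0).
(* The indices run from 0 to [m], which gives m + 1 >= rho / (8 h) of them, and at least one even if
   [h] is comparable to [rho]. *)
pose m := Num.truncn (rho / (8 * h)); pose n := m.+1.
have q0 : 0 <= rho / (8 * h) by rewrite divr_ge0//; lra.
have mr : m%:R * (8 * h) <= rho by rewrite -ler_pdivlMr ?mulr_gt0//; rewrite truncn_le.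
have nr : rho / (8 * h) <= n%:R by rewrite ltW// truncnS_gt.
pose P (ij : 'I_n * 'I_n) := gridpt rho h ij.1 ij.2.
have Pe ij : eucl (P ij) = rho by apply: (gridpt_eucl r0 h0 mr); rewrite -ltnS.
have bP ij : ballmass f (P ij) (2 * h) = ballmass f x (2 * h).
  apply: (etrans (ballmass_radial (P ij) (2 * h) mf rf)); rewrite Pe -xr.
  exact/esym/ballmass_radial.
have b0 : (0 <= ballmass f x (2 * h))%E.
  by apply: integral_ge0 => y _; case: ifPn => // _; rewrite lee_fin sqr_ge0.
apply: (@le_trans _ _ (\sum_(ij : 'I_n * 'I_n) ballmass f (P ij) (2 * h))%E).
  rewrite (eq_bigr (fun=> ballmass f x (2 * h))) => [|ij _]; last exact: bP.
  rewrite (eq_bigr (fun=> 1%:E * ballmass f x (2 * h)))%E => [|ij _]; last by rewrite mul1e.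
  rewrite -ge0_sume_distrl// sumEFin sumr_const card_prod card_ord; apply: lee_wpmul2r => //.
  by rewrite lee_fin natrM -expr2 lerXn2r// nnegrE.
rewrite /ballmass -ge0_integral_sum//; last 2 first.
- by move=> ij; exact: measurable_ballmass.
- by move=> ij y _; case: ifPn => // _; rewrite lee_fin sqr_ge0.
rewrite [leRHS]integral_mkcond; apply: ge0_le_integral => //.
- by move=> y _; apply: sume_ge0 => ij _; case: ifPn => // _; rewrite lee_fin sqr_ge0.
- by apply: emeasurable_sum => ij; exact: measurable_ballmass.
- apply/(measurable_restrictT _ (measurable_cube _ _)); apply: measurable_funTS.
  by apply/measurable_EFinP; exact: measurable_funX.
move=> y _.
have [[ij yP]|nP] := pselect (exists ij, dist2 y (P ij) < (2 * h) ^+ 2).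
  have h2 : 0 <= 2 * h by rewrite mulr_ge0// ltW.
  have bnd (u v w : R) : u * u + v * v + w * w < (2 * h) ^+ 2 ->
     [/\ u ^+ 2 < (2 * h) ^+ 2, v ^+ 2 < (2 * h) ^+ 2 & w ^+ 2 < (2 * h) ^+ 2].
    by clear => uvw; split; nra.
  (* By disjointness only the ball [ij] contributes at [y]. *)
  rewrite (bigD1 ij)//= yP big1 => [|kl klij].
    rewrite adde0 patchE ifT// inE.
    have [] := bnd _ _ _ yP => u1 u2 u3.
    have pe : dot3 (P ij) (P ij) = rho ^+ 2.
      by rewrite -(Pe ij) sqr_sqrtr// /dot3 -!expr2 !addr_ge0 ?sqr_ge0.
    have c1 (u v : R) : (u - v) ^+ 2 < (2 * h) ^+ 2 -> v ^+ 2 <= rho ^+ 2 -> `|u - 0| < 3 * rho.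
      rewrite sqr_ltE// ltr_distl => /andP[w1 w2].
      rewrite sqr_leE ?(ltW r0)// ler_norml => /andP[w3 w4].
      by rewrite subr0 ltr_norml; clear - hr w1 w2 w3 w4; apply/andP; split; lra.
    move: pe; rewrite /dot3 -!expr2 => pe.
    have := sqr_ge0 (P ij).1.1; have := sqr_ge0 (P ij).1.2; have := sqr_ge0 (P ij).2 => v1 v2 v3.
    by apply/cubeP; split; [apply: c1 u1 _|apply: c1 u2 _|apply: c1 u3 _]; clear - pe v1 v2 v3; lra.
  case: ifPn => // klP; exfalso; move/eqP: klij; apply.
  have [_ u2 u3] := bnd _ _ _ yP; have [_ v2 v3] := bnd _ _ _ klP.
  by case: ij kl u2 u3 v2 v3 {yP klP} => i j [k l] /= u2 u3 v2 v3; congr pair; apply: val_inj => /=;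
    [exact: (grid_sep h0 v2 u2)|exact: (grid_sep h0 v3 u3)].
rewrite big1 => [|ij _]; first by rewrite patchE; case: ifPn => // _; rewrite lee_fin sqr_ge0.
by case: ifPn => // yP; exfalso; apply: nP; exists ij.
Qed.

Definition coul f : \bar R :=
  (\int[(L \x L)%E]_z (f z.1 ^+ 2 * f z.2 ^+ 2 / eucl ((z.1 : R3 R) - z.2)%R)%:E)%E.

Lemma measurable_set1_3 x : measurable ([set x] : set (M3 R)).
Proof.
rewrite (_ : [set x] = ([set x.1.1] `*` [set x.1.2]) `*` [set x.2]); last first.
  apply/seteqP; split => [y -> //|[[a b] c] /= [[-> ->] ->]]; first by case: x => -[].
by apply: measurableX; [apply: measurableX|]; exact: measurable_set1.
Qed.

Lemma leb3_set1 x : L [set x] = 0%E.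
Proof.
apply/eqP; rewrite eq_le measure_ge0 andbT; apply/lee_addgt0Pr => e e0; rewrite add0e.
pose h := Num.min 1 (e / 8); have h0 : 0 < h by rewrite lt_min ltr01/= divr_gt0.
apply: (@le_trans _ _ (L (cube x h))).
  apply: le_measure; rewrite ?inE; [exact: measurable_set1_3|exact: measurable_cube|].
  by move=> y ->; apply/cubeP; rewrite !subrr normr0.
rewrite leb3_cube// lee_fin.
have h1 : h <= 1 by rewrite ge_min lexx.
have h2 : h <= e / 8 by rewrite ge_min lexx orbT.
apply: (@le_trans _ _ (8 * h)); last lra.
by rewrite ler_pM2l// exprS ler_piMr ?(ltW h0)// exprn_ile1// ltW.
Qed.

Lemma eucl_le_cube x y (r : R) : 0 < r -> cube 0 r x -> cube 0 r y -> eucl (x - y) <= 4 * r.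
Proof.
move=> r0 /cubeP/= []; rewrite !subr0 !ltr_norml => /andP[a1 a2] /andP[a3 a4] /andP[a5 a6].
move=> /cubeP/= []; rewrite !subr0 !ltr_norml => /andP[b1 b2] /andP[b3 b4] /andP[b5 b6].
rewrite /eucl -[leRHS]ger0_norm; last lra.
rewrite -sqrtr_sqr ler_sqrt ?sqr_ge0// /dot3/= -!expr2.
have k (u v : R) : - r < u -> u < r -> - r < v -> v < r -> (u - v) ^+ 2 <= (2 * r) ^+ 2.
  by move=> *; rewrite sqr_leE ?ler_norml; [apply/andP; split|]; lra.
have := k _ _ a1 a2 b1 b2; have := k _ _ a3 a4 b3 b4; have := k _ _ a5 a6 b5 b6.
rewrite (_ : (4 * r) ^+ 2 = 4 * (2 * r) ^+ 2); last by ring.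
have := sqr_ge0 (2 * r); lra.
Qed.

Lemma eucl_ge0 x : 0 <= eucl x. Proof. exact: sqrtr_ge0. Qed.

Lemma eucl_gt0 x : x != 0 -> 0 < eucl x.
Proof.
move=> x0; rewrite sqrtr_gt0 lt_neqAle; have d0 : 0 <= dot3 x x by rewrite /dot3 -!expr2 !addr_ge0 ?sqr_ge0.
rewrite d0 andbT eq_sym; apply: contraNN x0; rewrite /dot3 -!expr2.
rewrite paddr_eq0 ?addr_ge0 ?sqr_ge0// paddr_eq0 ?sqr_ge0// !sqrf_eq0.
by case: x {d0} => -[a b] c /= /andP[/andP[/eqP -> /eqP ->] /eqP ->].
Qed.

Lemma measurable_invR : measurable_fun [set: R] (fun t : R => t^-1).
Proof.
rewrite (_ : (fun t => _) = (fun t => if 0 <= t then t `^ (-1) else - ((- t) `^ (-1)))).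
  apply: measurable_fun_ifT.
  - by apply: measurable_fun_ler => //; exact: measurable_id.
  - exact: measurable_powR.
  - apply: measurable_funN; apply: (measurableT_comp (measurable_powR (-1))).
    exact: oppr_measurable.
apply/funext => t; case: ifPn => [t0|]; first by rewrite powR_inv1.
by rewrite -ltNge => t0; rewrite powR_inv1 ?oppr_ge0 ?(ltW t0)// invrN opprK.
Qed.

Lemma measurable_coul f : measurable_fun setT (f : M3 R -> R) ->
  measurable_fun [set: M3 R * M3 R]
    (fun z : M3 R * M3 R => f z.1 ^+ 2 * f z.2 ^+ 2 / eucl ((z.1 : R3 R) - z.2)%R).
Proof.
move=> mf; apply: measurable_funM.
  by apply: measurable_funM; apply: measurable_funX;
    [exact: measurableT_comp mf measurable_fst|exact: measurableT_comp mf measurable_snd].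
apply: (measurableT_comp measurable_invR).
by apply: measurable_eucl; apply: measurable_sub3.
Qed.

Lemma coul_le f g : measurable_fun setT (f : M3 R -> R) ->
  measurable_fun setT (g : M3 R -> R) -> (forall x, `|f x| <= `|g x|) ->
  (coul f <= coul g)%E.
Proof.
move=> mf mg fg; have sq x : f x ^+ 2 <= g x ^+ 2.
  by rewrite -(real_normK (num_real (f x))) -(real_normK (num_real (g x))) ler_pXn2r ?nnegrE.
apply: ge0_le_integral => //.
- by move=> z _; rewrite lee_fin divr_ge0 ?eucl_ge0// mulr_ge0 ?sqr_ge0.
- by apply/measurable_EFinP; exact: measurable_coul.
- by apply/measurable_EFinP; exact: measurable_coul.
- move=> z _; rewrite lee_fin ler_wpM2r ?invr_ge0 ?eucl_ge0//.
  by apply: ler_pM; rewrite ?sqr_ge0.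
Qed.

Lemma coulZ (c : R) f : measurable_fun setT (f : M3 R -> R) ->
  (coul (fun x => c * f x)%R = (c ^+ 4)%:E * coul f)%E.
Proof.
move=> mf; rewrite -ge0_integralZl_EFin//.
- by apply: eq_integral => z _; rewrite -EFinM; congr EFin; ring.
- by move=> z _; rewrite lee_fin divr_ge0 ?eucl_ge0// mulr_ge0 ?sqr_ge0.
- by apply/measurable_EFinP; exact: measurable_coul.
- by rewrite (_ : c ^+ 4 = (c ^+ 2) ^+ 2) ?sqr_ge0//; ring.
Qed.

(* On the cube of side 2r the Coulomb kernel is at least 1/(4r). *)
Lemma coulomb_mass f (r : R) : 0 < r -> measurable_fun setT (f : M3 R -> R) ->
  (coul f <= 1)%E ->
  (\int[L]_(y in cube 0%R r) (f y ^+ 2)%:E <= (2 * Num.sqrt r)%:E)%E.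
Proof.
move=> r0 mf c1; set A := (X in (X <= _)%E).
have A0 : (0 <= A)%E by apply: integral_ge0 => y _; rewrite lee_fin sqr_ge0.
pose w y := f y ^+ 2 * \1_(cube 0 r) y.
have w0 y : 0 <= w y by rewrite mulr_ge0 ?sqr_ge0.
have mw : measurable_fun [set: M3 R] (fun y => (w y)%:E).
  apply/measurable_EFinP; apply: measurable_funM; first exact: measurable_funX.
  by apply: measurable_indic; exact: measurable_cube.
have Aw : (A = \int[L]_y (w y)%:E)%E.
  rewrite /A integral_mkcond; apply: eq_integral => y _; rewrite patchE /w indicE.
  by case: (y \in _); rewrite ?mulr1 ?mulr0.
pose G (z : M3 R * M3 R) := (f z.1 ^+ 2 * f z.2 ^+ 2 / eucl ((z.1 : R3 R) - z.2)%R)%:E.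
have mG : measurable_fun setT G by apply/measurable_EFinP; exact: measurable_coul.
have G0 z : (0 <= G z)%E.
  by rewrite lee_fin; apply: divr_ge0; [rewrite mulr_ge0 ?sqr_ge0|exact: eucl_ge0].
(* The square of the mass is a double integral over the cube, where 1 <= 4 r / |x - y|. *)
have key : (A * A <= (4 * r)%:E)%E.
  have -> : (A * A = \int[L]_x \int[L]_y ((w x)%:E * (w y)%:E))%E.
    under eq_integral => x _.
      rewrite ge0_integralZl_EFin//; last by move=> y _; rewrite lee_fin.
      rewrite -Aw; over.
    by rewrite /= ge0_integralZr// -?Aw// => y _; rewrite lee_fin.
  have c4 : ((4 * r)%:E * coul f <= (4 * r)%:E)%E.
    by rewrite -[leRHS]mule1; apply: lee_wpmul2l => //; rewrite lee_fin mulr_ge0// ltW.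
  apply: le_trans c4; rewrite /coul (fubini_tonelli1 G)// /fubini_F.
  have m1 : measurable_fun [set: M3 R] (fun x => \int[L]_y G (x, y))%E.
    exact: (measurable_fun_fubini_tonelli_F G).
  rewrite -ge0_integralZl_EFin//; last 2 first.
  - by move=> x _; apply: integral_ge0.
  - by rewrite mulr_ge0// ltW.
  apply: ge0_le_integral => //.
  - by move=> x _; apply: integral_ge0 => y _; rewrite -EFinM lee_fin mulr_ge0.
  - under eq_fun => x.
      rewrite ge0_integralZl_EFin//; last by move=> y _; rewrite lee_fin.
      over.
    exact: emeasurable_funM.
  - exact: measurable_funeM.
  move=> x _.
  have mGx : measurable_fun [set: M3 R] (fun y => G (x, y)).
    exact: (measurableT_comp mG (measurable_pair1 _)).
  rewrite -ge0_integralZl_EFin//; last by rewrite mulr_ge0// ltW.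
  apply: ae_ge0_le_integral => //.
  - by move=> y _; rewrite -EFinM lee_fin mulr_ge0.
  - exact: measurable_funeM.
  - by move=> y _; rewrite mule_ge0// lee_fin mulr_ge0// ltW.
  - exact: measurable_funeM.
  (* At y = x the quotient is 0 by convention and the pointwise comparison may fail, so this null
     set is left out. *)
  exists [set x]; split; [exact: measurable_set1_3|exact: leb3_set1|].
  move=> y /= hn; apply: contrapT => yx; apply: hn => _.
  rewrite /G /= -!EFinM lee_fin /w.
  have rhs0 : 0 <= 4 * r * (f x ^+ 2 * f y ^+ 2 / eucl (x - y)).
    apply: mulr_ge0; first by rewrite mulr_ge0// ltW.
    by apply: divr_ge0; [rewrite mulr_ge0 ?sqr_ge0|exact: eucl_ge0].
  have [xQ|xQ] := boolP (x \in (cube 0 r)); last first.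
    by rewrite indicE (negbTE xQ) mulr0 mul0r.
  have [yQ|yQ] := boolP (y \in (cube 0 r)); last first.
    by rewrite [X in _ * (_ * X)]indicE (negbTE yQ) !mulr0.
  rewrite !indicE xQ yQ !mulr1.
  have e0 : 0 < eucl (x - y) by apply: eucl_gt0; rewrite subr_eq0; apply/eqP => xy; apply: yx.
  have t1 : 1 <= 4 * r / eucl (x - y).
    rewrite ler_pdivlMr// mul1r.
    by move: xQ yQ; rewrite !inE; exact: eucl_le_cube.
  rewrite (_ : 4 * r * _ = (f x ^+ 2 * f y ^+ 2) * (4 * r / eucl (x - y))); last by ring.
  by apply: ler_peMr => //; rewrite mulr_ge0 ?sqr_ge0.
move: A0 key; case: (A) => [a||]//.
rewrite lee_fin => a0; rewrite -EFinM !lee_fin => aa.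
rewrite -[a]ger0_norm// -sqrtr_sqr (_ : 2 * _ = Num.sqrt (4 * r)).
  by rewrite ler_sqrt ?expr2// mulr_ge0// ltW.
by rewrite sqrtrM// (_ : 4 = 2 ^+ 2) ?sqrtr_sqr ?ger0_norm//; ring.
Qed.

(* By rotation invariance the mass of [f ^+ 2] in a cube of size h at distance
   rho from the origin is at most of order (h/rho)^2 times its mass in the ball
   of radius of order rho, hence of order h^2 rho^(-3/2). *)
Lemma avg_radial f h x : measurable_fun setT (f : M3 R -> R) -> rot_inv f ->
  (coul f <= 1)%E -> 0 < h -> h <= eucl x ->
  `|avg h f x| <= 12 * h `^ (- 2^-1) * eucl x `^ (- (3 / 4)).
Proof.
move=> mf rf c1 h0; set rho := eucl x => hr.
have r0 : 0 < rho by rewrite (lt_le_trans h0).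
(* The factor 6 makes e^2 (8 h^3) = 288 h^2 rho^(-3/2), just above the mass bound 256 h^2 rho^(-3/2)
   that the grid and the Coulomb energy give. *)
pose e := 6 * h `^ (- 2^-1) * rho `^ (- (3 / 4)).
have e0 : 0 < e by rewrite !mulr_gt0 ?powR_gt0.
have -> : 12 * h `^ (- 2^-1) * rho `^ (- (3 / 4)) = 2 * e by rewrite /e; ring.
apply: avg_L2 => //.
have sub : (\int[L]_(y in cube x h) (f y ^+ 2)%:E <= ballmass f x (2 * h))%E.
  rewrite integral_mkcond; apply: ge0_le_integral => //.
  - by move=> y _; rewrite patchE; case: ifPn => // _; rewrite lee_fin sqr_ge0.
  - apply/(measurable_restrictT _ (measurable_cube _ _)); apply: measurable_funTS.
    by apply/measurable_EFinP; exact: measurable_funX.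
  - exact: measurable_ballmass.
  move=> y _; rewrite patchE; case: ifPn => [|_]; last by case: ifPn => // _; rewrite lee_fin sqr_ge0.
  rewrite inE => /cubeP[y1 y2 y3]; rewrite ifT// /dist2 /dot3/= -!expr2.
  move: y1 y2 y3; rewrite -!sqr_ltE ?(ltW h0)// => y1 y2 y3.
  by rewrite exprMn; have := sqr_ge0 h; clear - y1 y2 y3; lra.
apply: (le_trans sub).
have r3 : 0 < 3 * rho by rewrite mulr_gt0.
have := le_trans (ballmass_grid h0 hr erefl mf rf) (coulomb_mass r3 mf c1).
have q0 : 0 < (rho / (8 * h)) ^+ 2 by rewrite exprn_gt0// divr_gt0// mulr_gt0.
have b0 : (0 <= ballmass f x (2 * h))%E.
  by apply: integral_ge0 => y _; case: ifPn => // _; rewrite lee_fin sqr_ge0.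
move: b0; case: (ballmass f x (2 * h)) => [b||]//; last first.
  by rewrite gt0_muley ?lte_fin// leye_eq.
move=> _; rewrite -EFinM !lee_fin => hb.
have s3 : Num.sqrt (3 * rho) <= 2 * Num.sqrt rho.
  rewrite -[X in _ <= X](_ : Num.sqrt (4 * rho) = _).
    by rewrite ler_sqrt ?mulr_ge0 ?(ltW r0)// ler_pM2r// ler_nat.
  by rewrite sqrtrM// (_ : 4 = 2 ^+ 2) ?sqrtr_sqr ?ger0_norm//; ring.
have hb2 : b <= 4 * Num.sqrt rho / (rho / (8 * h)) ^+ 2.
  by rewrite ler_pdivlMr// mulrC; clear - hb s3; lra.
apply: (le_trans hb2).
have E1 : e ^+ 2 = 36 * (h^-1 * rho `^ (- (3 / 2))).
  rewrite /e !exprMn !powRXp (_ : - 2^-1 * 2 = -1); last by clear; lra.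
  rewrite powR_inv1 ?(ltW h0)// -mulrA; congr (_ * (_ * _ `^ _)); [ring|clear; lra].
rewrite E1 (_ : _ ^+ 2 = rho ^+ 2 / (64 * h ^+ 2)); last by field; rewrite gt_eqF.
have E2 : Num.sqrt rho = rho ^+ 2 * rho `^ (- (3 / 2)).
  by rewrite -powR12_sqrt ?(ltW r0)// -powR_mulrn ?(ltW r0)// -powRDp//; congr (_ `^ _); clear; lra.
rewrite E2 [X in X <= _](_ : _ = 256 * h ^+ 2 * rho `^ (- (3 / 2))); last first.
  by field; rewrite !gt_eqF.
rewrite [X in _ <= X](_ : _ = 288 * h ^+ 2 * rho `^ (- (3 / 2))).
  by rewrite ler_pM2r ?powR_gt0// ler_pM2r ?exprn_gt0// ler_nat.
by field; rewrite gt_eqF.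
Qed.

End Radial.

(** * Decay of radial functions *)

Section Tail.
Variable R : realType.
Local Notation L := (@leb3 R).
Implicit Types (f g w : R3 R -> R) (x y : R3 R) (h k s : R).

Lemma eucl_sqr x : eucl x ^+ 2 = x.1.1 ^+ 2 + x.1.2 ^+ 2 + x.2 ^+ 2.
Proof. by rewrite sqr_sqrtr /dot3 -?expr2// !addr_ge0 ?sqr_ge0. Qed.

Lemma cube_far x h y : 0 < h -> h <= eucl x / 4 -> cube x h y -> eucl x / 2 <= eucl y.
Proof.
move=> h0 hx /cubeP[]; rewrite -!sqr_ltE ?(ltW h0)// => y1 y2 y3.
have hx2 : (4 * h) ^+ 2 <= eucl x ^+ 2.
  by rewrite sqr_leE ?eucl_ge0// ger0_norm ?mulr_ge0 ?(ltW h0)// mulrC -ler_pdivlMr.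
have k (u v : R) : u ^+ 2 <= 2 * v ^+ 2 + 2 * (v - u) ^+ 2.
  by have := sqr_ge0 (u - 2 * v); nra.
rewrite ler_pdivrMr// -[leLHS]ger0_norm ?eucl_ge0// -sqr_leE ?mulr_ge0 ?eucl_ge0//.
move: hx2; rewrite !exprMn !eucl_sqr.
rewrite (_ : 4 ^+ 2 = 16 :> R); last by ring.
rewrite (_ : 2 ^+ 2 = 4 :> R); last by ring.
have := sqr_ge0 h; have := k x.1.1 y.1.1; have := k x.1.2 y.1.2; have := k x.2 y.2; lra.
Qed.

Lemma avg_eq_on h f g x : (forall y, cube x h y -> f y = g y) -> avg h f x = avg h g x.
Proof.
move=> fg; rewrite !avgE; apply: eq_Rintegral => y _; rewrite kernE indicE.
have [yQ|yQ] := boolP (y \in cube x h); last by rewrite mulr0 !mul0r.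
by rewrite fg//; move: yQ; rewrite inE.
Qed.

Lemma powRVN (a u : R) : 0 <= a -> a^-1 `^ (- u) = a `^ u.
Proof. by move=> a0; rewrite -powR_inv1// -powRrM mulrNN mul1r. Qed.

Lemma powR_le_pos (a b u : R) : 0 <= u -> 0 <= a -> a <= b -> a `^ u <= b `^ u.
Proof. by move=> u0 a0 ab; rewrite ge0_ler_powR ?nnegrE// (le_trans a0). Qed.

(* Either f is below the decay rate [sg], or [|f x|] exceeds the average at the
   scale h given by [avg_radial], so that it is an oscillation at a scale
   [h <= rho^(1/(4s))], where [h^(2s) <= |f x|^(2 - p)] up to constants. *)
Lemma tail_pointwise s p : 1 / 2 < s -> (16 * s + 2) / (6 * s + 1) < p -> p <= 2 + 4 * s ->
  forall f w (r0 : R) x, measurable_fun setT (f : M3 R -> R) -> rot_inv f -> (coul f <= 1)%E ->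
  16 <= r0 -> (forall x, r0 / 2 <= eucl x -> w x = f x) -> r0 <= eucl x ->
  ((`|f x| `^ p)%:E <= (48 `^ (p - 2))%:E *
    ((eucl x `^ (- ((p - 2) * (3 / 4 + (8 * s)^-1))) * f x ^+ 2)%:E + 4%:E * Bfun s w x))%E.
Proof.
move=> s1 p1 p2 f w r0 x mf rf c1 r16 wf xr; set rho := eucl x.
have s0 : 0 < s by lra.
have p22 : 0 < p - 2.
  by move: p1; clear - s1 s0; rewrite ltr_pdivrMr; nra.
set sg := 3 / 4 + (8 * s)^-1.
have rho16 : 16 <= rho by rewrite (le_trans r16).
have rho0 : 0 < rho by rewrite (lt_le_trans _ rho16).
(* This is the lower bound on [p] in another form, because (16 s + 2) / (6 s + 1) = 2 + 4 s / (6 s +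
   1). *)
have sg1 : 1 / 2 < (p - 2) * sg.
  have : 4 * s < (p - 2) * (6 * s + 1) by move: p1; clear - s1 s0; rewrite ltr_pdivrMr; nra.
  have -> : (p - 2) * sg = (p - 2) * (6 * s + 1) / (8 * s).
    by rewrite /sg; field; rewrite gt_eqF.
  by clear - s0; rewrite ltr_pdivlMr; lra.
have q0 : 0 < (48 : R) `^ (p - 2) by rewrite powR_gt0.
set t := `|f x|; have t0 : 0 <= t by exact: normr_ge0.
have tE : t `^ p = t `^ (p - 2) * f x ^+ 2.
  have [->|tn] := eqVneq t 0.
    by rewrite !powR0 ?mul0r// gt_eqF//; clear - p22; lra.
  have t0' : 0 < t by rewrite lt_neqAle eq_sym tn.
  have -> : t `^ p = t `^ (p - 2) * t `^ 2 by rewrite -powRDp// subrK.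
  by rewrite powR_mulrn// /t real_normK// num_real.
have B0 := Bfun_ge0 s w x.
have rhs1 : (0 <= (rho `^ (- ((p - 2) * sg)) * f x ^+ 2)%:E)%E.
  by rewrite lee_fin mulr_ge0 ?powR_ge0 ?sqr_ge0.
(* Below this threshold |f x|^(p - 2) is itself at most the weight in the first summand. *)
have [tl|tl] := leP t (48 * rho `^ (- sg)).
  apply: (@le_trans _ _ ((48 `^ (p - 2))%:E * (rho `^ (- ((p - 2) * sg)) * f x ^+ 2)%:E)%E).
    rewrite -EFinM lee_fin tE [leRHS]mulrA ler_wpM2r ?sqr_ge0//.
    rewrite -mulNr mulrC (_ : _ * sg = - sg * (p - 2)) ?powRrM; last by ring.
    rewrite mulrC -powRM ?powR_ge0//.
    by apply: powR_le_pos => //; exact: ltW.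
  by apply: lee_wpmul2l; [rewrite lee_fin ltW|rewrite leeDl// mule_ge0].
have t0' : 0 < t by rewrite (le_lt_trans _ tl)// mulr_ge0 ?powR_ge0.
(* Normalized so that the bound 12 h^(-1/2) rho^(-3/4) of [avg_radial] is at most t / 2 precisely
   when h^(-1/2) <= T. *)
pose T := t * rho `^ (3 / 4) / 24.
have T0 : 0 < T by rewrite divr_gt0 ?mulr_gt0 ?powR_gt0.
have tT : t = 24 * T * rho `^ (- (3 / 4)).
  by rewrite /T powRN; field; rewrite gt_eqF// powR_gt0.
(* The 2 is 48 / 24. Squared, it gives yy <= h1 / 4, which leaves room for rounding [yy] up to a
   dyadic scale. *)
have Tl : 2 * rho `^ (- (8 * s)^-1) < T.
  rewrite /T ltr_pdivlMr// (_ : - (8 * s)^-1 = - sg + 3 / 4); last by rewrite /sg; ring.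
  by rewrite powRDp// mulrAC mulrA -natrM ltr_pM2r ?powR_gt0.
pose yy := T `^ (- 2); have yy0 : 0 < yy by rewrite powR_gt0.
have Ty : T = yy `^ (- 2^-1) by rewrite /yy -powRrM mulrNN mulfV// powRr1// ltW.
have [z /andP[yz zy]] := dyadic_above yy0; set h := dy z in yz zy.
have h0 : 0 < h by exact: dy_gt0.
have anti (a b u : R) : 0 <= u -> 0 < a -> a <= b -> b `^ (- u) <= a `^ (- u).
  move=> u0 a0 ab; rewrite !powRN lef_pV2 ?posrE ?powR_gt0 ?(lt_le_trans a0)//.
  by apply: powR_le_pos => //; exact: ltW.
pose h1 := rho `^ (4 * s)^-1.
have hh1 : h <= h1.
  have : T `^ (- 2) <= (2 * rho `^ (- (8 * s)^-1)) `^ (- 2).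
    by apply: anti => //; [rewrite mulr_gt0 ?powR_gt0|exact: ltW].
  rewrite powRM ?powR_ge0// -powRrM (_ : - (8 * s)^-1 * - 2 = (4 * s)^-1); last by field; rewrite gt_eqF.
  rewrite -/h1 -/yy powRN powR_mulrn// => yh.
  have : 0 <= h1 by exact: powR_ge0.
  by move: yh zy; rewrite (_ : 2 ^+ 2 = 4 :> R); [clear; lra|ring].
(* Here s > 1/2 gives 1 / (4 s) <= 1/2, and rho >= 16 gives rho^(1/2) <= rho / 4. *)
have h1r : h1 <= rho / 4.
  apply: (@le_trans _ _ (rho `^ 2^-1)).
    apply: ler_powR; first by clear - rho16; lra.
    by rewrite lef_pV2 ?posrE; clear - s1; lra.
  rewrite powR12_sqrt ?(ltW rho0)//.
  have sr : 4 <= Num.sqrt rho.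
    by rewrite -[4]ger0_norm// -sqrtr_sqr ler_sqrt; clear - rho16; lra.
  rewrite -[in leRHS](sqr_sqrtr (ltW rho0)); clear - sr; nra.
have hr : h <= rho / 4 by exact: le_trans h1r.
have avg_small : `|avg h w x| <= t / 2.
  (* The cube around [x] stays outside the ball of radius r0 / 2, so the Coulomb bound for [f]
     controls an average of [w]. *)
  rewrite (@avg_eq_on h w f); last first.
    by move=> y /(cube_far h0 hr) yr; apply: wf; apply: le_trans yr; clear - xr; lra.
  have hrho : h <= eucl x by apply: (le_trans hr); rewrite ler_pdivrMr// ler_peMr ?(ltW rho0)// ler1n.
  apply: (le_trans (avg_radial mf rf c1 h0 hrho)).
  rewrite -/rho tT.
  have : h `^ (- 2^-1) <= T by rewrite Ty; apply: anti.
  move=> hT; rewrite (_ : 24 * T * _ / 2 = 12 * T * rho `^ (- (3 / 4))); last by field.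
  by rewrite ler_pM2r ?powR_gt0// ler_pM2l.
have wfx : w x = f x by apply: wf; clear - xr r16; lra.
have t2 : t ^+ 2 <= 4 * (w x - avg h w x) ^+ 2.
  have h2 : t / 2 <= `|w x - avg h w x|.
    have := lerB_dist (w x) (avg h w x); rewrite wfx -/t.
    by move: avg_small; set a := `|_|; set b := `|_|; clear; lra.
  rewrite -(real_normK (num_real (_ - _))) (_ : 4 = 2 ^+ 2); last by ring.
  by rewrite -exprMn lerXn2r ?nnegrE ?mulr_ge0 ?(ltW t0')//; move: h2; clear; lra.
have tp : t `^ (p - 2) <= 48 `^ (p - 2) * h `^ (- (2 * s)).
  have T2 : T <= 2 * h `^ (- 2^-1).
    have : yy `^ (- 2^-1) <= (h / 2) `^ (- 2^-1).
      by apply: anti => //; [exact: divr_gt0|rewrite ler_pdivrMr// mulrC].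
    rewrite -Ty powRM ?invr_ge0 ?(ltW h0)// => /le_trans; apply.
    rewrite mulrC ler_wpM2r ?powR_ge0// powRVN//.
    by apply: ler1_powR; clear; lra.
  apply: (@le_trans _ _ ((48 * h `^ (- 2^-1) * rho `^ (- (3 / 4))) `^ (p - 2))).
    apply: powR_le_pos => //; first exact: ltW.
    rewrite tT ler_wpM2r ?powR_ge0//; move: T2; clear; lra.
  rewrite !powRM ?mulr_ge0 ?powR_ge0// -mulrA ler_wpM2l ?powR_ge0//.
  rewrite -!powRrM.
  have e1 : h `^ (- 2^-1 * (p - 2)) = h `^ (- (2 * s)) * h `^ (2 * s - (p - 2) / 2).
    by rewrite -powRDp//; congr (_ `^ _); ring.
  rewrite e1 -mulrA ler_piMr ?powR_ge0//.
  (* The exponent of [h] is nonnegative because p <= 2 + 4 s, so [h] may be replaced by [h1]. The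
     total exponent of [rho] is then 1/2 - (p - 2) sg < 0. *)
  apply: (@le_trans _ _ (h1 `^ (2 * s - (p - 2) / 2) * rho `^ (- (3 / 4) * (p - 2)))).
    by rewrite ler_wpM2r ?powR_ge0//; apply: powR_le_pos; [clear - p2; lra|exact: ltW|].
  rewrite /h1 -powRrM -powRDp//.
  apply: (@le_trans _ _ (rho `^ 0)); last by rewrite powRr0.
  apply: ler_powR; first by clear - rho16; lra.
  rewrite (_ : _ + _ = 1 / 2 - (p - 2) * sg); last by rewrite /sg; field; rewrite gt_eqF.
  by rewrite subr_le0 ltW.
apply: (@le_trans _ _ ((48 `^ (p - 2))%:E * (4%:E * (Ek s w z x)%:E))%E); last first.
  apply: lee_wpmul2l; first by rewrite lee_fin ltW.
  apply: (@le_trans _ _ (4%:E * Bfun s w x)%E); last by rewrite leeDr.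
  by apply: lee_wpmul2l; [rewrite lee_fin|exact: Bfun_ge].
rewrite -!EFinM lee_fin tE; have f2 : f x ^+ 2 = t ^+ 2 by rewrite /t real_normK// num_real.
rewrite f2 /Ek -/h; apply: (le_trans (ler_pM _ _ tp t2)); rewrite ?powR_ge0 ?sqr_ge0//.
by rewrite le_eqVlt; apply/orP; left; apply/eqP; ring.
Qed.

Lemma geometric_nneseries (c r : R) (u : nat -> \bar R) : 0 <= c -> 0 < r < 1 ->
  (forall n, 0 <= u n)%E -> (forall n, u n <= (c * r ^+ n)%:E)%E ->
  (\big[+%E/0%E]_(0 <= n <oo) u n <= (c / (1 - r))%:E)%E.
Proof.
move=> c0 /andP[r0 r1] u0 ur; apply: lime_le.
  by apply: is_cvg_nneseries => n _ _; exact: u0.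
apply: nearW => n.
apply: (@le_trans _ _ (\sum_(0 <= i < n) (c * r ^+ i)%:E)%E).
  by apply: lee_sum => i _; exact: ur.
rewrite sumEFin lee_fin ler_pdivlMr ?subr_gt0//.
suff -> : (\sum_(0 <= i < n) c * r ^+ i) * (1 - r) = c * (1 - r ^+ n).
  by rewrite ler_piMr// gerBl exprn_ge0// ltW.
elim: n => [|n IH]; first by rewrite big_geq// mul0r expr0 subrr mulr0.
by rewrite big_nat_recr//= mulrDl IH exprS; ring.
Qed.

(** Where |x| is about 2^n the weight is of order 2^(- n/2 - n d), while [coulomb_mass] allows a
    mass of order 2^(n/2): the products sum geometrically. Overlapping cubes stand in for dyadic
    shells. *)
Lemma weighted_mass f (d : R) : 0 < d -> measurable_fun setT (f : M3 R -> R) ->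
  (coul f <= 1)%E ->
  (\int[L]_(x in [set x | 1 <= eucl x]%R) (eucl x `^ (- (1 / 2 + d)) * f x ^+ 2)%:E <=
    (8 * 2 `^ (1 / 2 + d) / (1 - 2 `^ (- d)))%:E)%E.
Proof.
move=> d0 mf c1; set a := 1 / 2 + d.
have rr : 0 < (2 : R) `^ (- d) < 1.
  rewrite powR_gt0//= powRN invf_lt1 ?powR_gt0//.
  have := gt0_ltr_powR d0 (ler01 : (1 : R) \in Num.nneg) (ler0n _ 2 : (2 : R) \in Num.nneg) (ltr1n _ 2).
  by rewrite powR1.
have mE : measurable_fun setT (fun x : M3 R => eucl x).
  by apply: measurable_eucl; exact: measurable_id.
have mD : measurable [set x : M3 R | 1 <= eucl x].
  rewrite -[X in measurable X]setTI.
  exact: (measurable_fun_ler (measurable_cst _) mE measurableT (Y := [set true])).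
have mu2 n : measurable_fun [set: M3 R] (fun x => (2 `^ a * (2 `^ (- a)) ^+ n * (f x ^+ 2 * \1_(cube 0 (2 * 2 ^+ n)) x))%:E).
  apply/measurable_EFinP; apply: measurable_funM => //; apply: measurable_funM.
    exact: measurable_funX.
  by apply: measurable_indic; exact: measurable_cube.
pose u n x : \bar R := (2 `^ a * (2 `^ (- a)) ^+ n * (f x ^+ 2 * \1_(cube 0 (2 * 2 ^+ n)) x))%:E.
have u0 n x : (0 <= u n x)%E.
  rewrite lee_fin; apply: mulr_ge0; first by rewrite mulr_ge0 ?exprn_ge0 ?powR_ge0.
  by apply: mulr_ge0; first exact: sqr_ge0.
apply: (@le_trans _ _ (\int[L]_x (\big[+%E/0%E]_(0 <= n <oo) u n x))%E).
  rewrite integral_mkcond; apply: ge0_le_integral => //.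
  - move=> x _; rewrite patchE; case: ifPn => // _.
    by rewrite lee_fin mulr_ge0 ?powR_ge0 ?sqr_ge0.
  - apply/(measurable_restrictT _ mD); apply: measurable_funTS.
    apply/measurable_EFinP; apply: measurable_funM; last exact: measurable_funX.
    exact: (measurableT_comp (measurable_powR _) mE).
  - by apply: ge0_emeasurable_sum => [n x _ _|n _]; [exact: u0|exact: mu2].
  move=> x _; rewrite patchE; case: ifPn => [|_]; last by apply: nneseries_ge0 => n _ _; exact: u0.
  rewrite inE /= => x1; set rho := eucl x.
  have rho0 : 0 < rho by rewrite (lt_le_trans ltr01).
  have [z /andP[yz zy]] := dyadic_above rho0.
  have [n zn] : exists n : nat, z = n%:Z.
    case: z yz zy => n; first by exists n.
    rewrite NegzE dyE => yz _; exfalso.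
    have : (2 : R) `^ (- n.+1%:Z)%:~R < 1.
      by rewrite mulrNz powRN invf_lt1 ?powR_gt0// powR_mulrn// exprn_egt1// ltr1n.
    by move: yz; rewrite -/rho => /(le_trans x1); clear; lra.
  have dn : dy z = 2 ^+ n :> R by rewrite zn dyE powR_mulrn.
  rewrite dn in yz zy.
  apply: (@le_trans _ _ (u n x)); last first.
    have := @nneseries_lim_ge R (u ^~ x) xpredT 0 n.+1 (fun (k : nat) _ _ => u0 k x).
    by apply: le_trans; rewrite big_nat_recr//= leeDr// sume_ge0.
  rewrite /u lee_fin indicE mem_set ?mulr1; last first.
    apply/cubeP; rewrite !subr0 -!sqr_ltE ?mulr_ge0 ?exprn_ge0//.
    have : rho ^+ 2 < (2 * 2 ^+ n) ^+ 2 by rewrite ltrXn2r// ?(ltW rho0)//; have : 0 < (2 : R) ^+ n by []; lra.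
    rewrite eucl_sqr; have := sqr_ge0 x.1.1; have := sqr_ge0 x.1.2; have := sqr_ge0 x.2.
    by move: (2 * 2 ^+ n) => b; clear => *; split; lra.
  have an0 : 0 < (2 : R) ^+ n by [].
  have le : rho `^ (- a) <= 2 `^ a * (2 `^ (- a)) ^+ n.
    have -> : ((2 : R) `^ (- a)) ^+ n = (2 ^+ n) `^ (- a).
      by rewrite powRXp mulrC powRrM powR_mulrn.
    have -> : 2 `^ a * (2 ^+ n) `^ (- a) = (2 ^+ n / 2) `^ (- a).
      by rewrite powRM ?invr_ge0// mulrC powRVN.
    have a0 : 0 <= a by rewrite /a; clear - d0; lra.
    rewrite !powRN lef_pV2 ?posrE ?powR_gt0// ?divr_gt0//; apply: powR_le_pos => //.
    by move: zy; clear; lra.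
  by rewrite ler_wpM2r ?sqr_ge0.
rewrite integral_nneseries//.
pose c := 8 * 2 `^ a : R.
apply: (@geometric_nneseries c (2 `^ (- d))) => //.
- by rewrite mulr_ge0 ?powR_ge0.
- by move=> n; apply: integral_ge0.
move=> n; rewrite /u.
have n0 : 0 < 2 * (2 : R) ^+ n by rewrite mulr_gt0.
rewrite (eq_integral (fun x : M3 R => (2 `^ a * (2 `^ (- a)) ^+ n)%:E * ((f x ^+ 2)%:E * (\1_(cube 0 (2 * 2 ^+ n)) x)%:E))%E); last first.
  by move=> x _; rewrite -!EFinM.
rewrite ge0_integralZl_EFin//.
- rewrite (_ : (\int[L]_x _ = \int[L]_(y in cube 0%R (2 * 2 ^+ n)) (f y ^+ 2)%:E)%E); last first.
    rewrite [RHS]integral_mkcond; apply: eq_integral => x _.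
    by rewrite patchE indicE; case: ifPn => _; rewrite ?mule1 ?mule0.
  apply: (le_trans (lee_wpmul2l _ (coulomb_mass n0 mf c1))).
    by rewrite lee_fin mulr_ge0 ?exprn_ge0 ?powR_ge0.
  rewrite -EFinM lee_fin /c.
  have -> : Num.sqrt (2 * (2 : R) ^+ n) = 2 `^ 2^-1 * (2 `^ 2^-1) ^+ n.
    rewrite -powR12_sqrt ?(ltW n0)// powRM ?exprn_ge0//; congr (_ * _).
    by rewrite powRXp mulrC powRrM powR_mulrn.
  have -> : ((2 : R) `^ (- d)) ^+ n = (2 `^ (- a)) ^+ n * (2 `^ 2^-1) ^+ n.
    by rewrite -exprMn -powRDp//; congr (_ `^ _ ^+ _); rewrite /a; lra.
  have h2 : 2 `^ 2^-1 <= 2 :> R by apply: ler1_powR; clear; lra.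
  rewrite [leLHS](_ : _ = (2 * 2 `^ 2^-1) * (2 `^ a * ((2 `^ (- a)) ^+ n * (2 `^ 2^-1) ^+ n))); last by ring.
  by rewrite -[leRHS]mulrA ler_wpM2r ?mulr_ge0 ?exprn_ge0 ?powR_ge0//; move: h2; clear; lra.
- by move=> x _; rewrite -EFinM lee_fin mulr_ge0 ?sqr_ge0.
- apply: emeasurable_funM; first by apply/measurable_EFinP; exact: measurable_funX.
  by apply/measurable_EFinP; apply: measurable_indic; exact: measurable_cube.
Qed.

Lemma tail_estimate s p : 1 / 2 < s -> (16 * s + 2) / (6 * s + 1) < p -> p <= 2 + 4 * s ->
  exists C : R, 0 < C /\
  forall f w (r0 : R), measurable_fun setT (f : M3 R -> R) -> rot_inv f -> (coul f <= 1)%E ->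
  measurable_fun setT (w : M3 R -> R) -> (Bnorm s w <= 1)%E ->
  16 <= r0 -> (forall x, r0 / 2 <= eucl x -> w x = f x) ->
  (\int[L]_(x in [set x | r0 <= eucl x]%R) (`|f x| `^ p)%:E <= C%:E)%E.
Proof.
move=> s1 p1 p2; have s0 : 0 < s by clear - s1; lra.
pose a := (p - 2) * (3 / 4 + (8 * s)^-1).
have a1 : 1 / 2 < a.
  have : 4 * s < (p - 2) * (6 * s + 1) by move: p1; rewrite ltr_pdivrMr; nra.
  have -> : a = (p - 2) * (6 * s + 1) / (8 * s) by rewrite /a; field; rewrite gt_eqF.
  by rewrite ltr_pdivlMr; lra.
(* The margin of [p] above the critical exponent becomes the ratio 2^(- d) of the geometric series
   in [weighted_mass]. *)
pose d := a - 1 / 2; have d0 : 0 < d by rewrite subr_gt0.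
have ad : a = 1 / 2 + d by rewrite /d addrC subrK.
pose W := 8 * 2 `^ (1 / 2 + d) / (1 - 2 `^ (- d)).
pose K := 48 `^ (p - 2) : R; have K0 : 0 < K by rewrite powR_gt0.
(* The bound is K (W + 4); the other summands make positivity immediate, whatever the sign of
   [W]. *)
exists (K * (W + 4) + 1 + `|K * (W + 4)|); split.
  by rewrite addrAC ltr_wpDl// -lerBlDr sub0r lerNnormlW.
move=> f w r0 mf rf c1 mw B1 r16 wf.
have mE : measurable_fun setT (fun x : M3 R => eucl x).
  by apply: measurable_eucl; exact: measurable_id.
have mD (r : R) : measurable [set x : M3 R | r <= eucl x].
  rewrite -[X in measurable X]setTI.
  exact: (measurable_fun_ler (measurable_cst _) mE measurableT (Y := [set true])).
have mh : measurable_fun [set: M3 R] (fun x => (eucl x `^ (- a) * f x ^+ 2)%:E).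
  apply/measurable_EFinP; apply: measurable_funM; last exact: measurable_funX.
  exact: (measurableT_comp (measurable_powR _) mE).
have mB := measurable_Bfun s mw.
have h0 x : (0 <= (eucl x `^ (- a) * f x ^+ 2)%:E)%E.
  by rewrite lee_fin mulr_ge0 ?powR_ge0 ?sqr_ge0.
have B4 x : (0 <= 4%:E * Bfun s w x)%E by rewrite mule_ge0 ?Bfun_ge0.
apply: (@le_trans _ _ (\int[L]_(x in [set x | r0 <= eucl x]%R)
   (K%:E * ((eucl x `^ (- a) * f x ^+ 2)%:E + 4%:E * Bfun s w x)))%E).
  apply: ge0_le_integral => //.
  - by apply: measurable_funTS; apply/measurable_EFinP; exact: measurable_powR_norm.
  - apply: measurable_funTS; apply: measurable_funeM; apply: emeasurable_funD => //.
    exact: measurable_funeM.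
  - by move=> x /= xr; exact: (tail_pointwise s1 p1 p2 mf rf c1 r16 wf xr).
rewrite ge0_integralZl_EFin//; last 3 first.
- by move=> x _; rewrite adde_ge0.
- by apply: measurable_funTS; apply: emeasurable_funD => //; exact: measurable_funeM.
- exact: ltW.
apply: (@le_trans _ _ (K%:E * (W + 4)%:E)%E); last first.
  by rewrite -EFinM lee_fin -addrA lerDl addr_ge0.
apply: lee_wpmul2l; first by rewrite lee_fin ltW.
rewrite ge0_integralD//; last 2 first.
- exact: measurable_funTS.
- by apply: measurable_funTS; exact: measurable_funeM.
rewrite [leRHS]EFinD; apply: leeD.
  apply: le_trans (weighted_mass d0 mf c1); rewrite -ad.
  apply: ge0_subset_integral => //.
  - exact: measurable_funTS.
  - by move=> x /=; apply: le_trans; lra.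
apply: (@le_trans _ _ (\int[L]_x (4%:E * Bfun s w x))%E).
  by apply: ge0_subset_integral => //; exact: measurable_funeM.
rewrite ge0_integralZl_EFin//; last by move=> x _; exact: Bfun_ge0.
by rewrite -[leRHS]mule1; apply: lee_wpmul2l.
Qed.

(* The exponent is first lowered to [min p (2 + 4 s)]; the powers between it
   and the critical exponent are recovered from [|f| <= 1] or [|f| >= 1]. *)
Lemma radial_Lp_bound s p : 1 / 2 < s < 3 / 2 ->
  (16 * s + 2) / (6 * s + 1) < p <= 6 / (3 - 2 * s) ->
  exists C : R, 0 < C /\
  forall f w (r0 : R), measurable_fun setT (f : M3 R -> R) -> rot_inv f -> (coul f <= 1)%E ->
  measurable_fun setT (w : M3 R -> R) -> (Bnorm s w <= 1)%E ->
  16 <= r0 -> (forall x, r0 / 2 <= eucl x -> w x = f x) ->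
  (\int[L]_x (`|f x| `^ p)%:E <=
    (8 * (2 * r0) ^+ 3 + C)%:E + \int[L]_x (`|f x| `^ (6 / (3 - 2 * s)))%:E)%E.
Proof.
move=> /andP[s1 s2] /andP[p1 p2]; set q := 6 / (3 - 2 * s) in p2 *.
pose p' := Num.min p (2 + 4 * s).
have s0 : 0 < s by clear - s1; lra.
have p3 : (16 * s + 2) / (6 * s + 1) < p'.
  by rewrite lt_min p1/= ltr_pdivrMr; nra.
have p4 : p' <= 2 + 4 * s by rewrite ge_min lexx orbT.
have p5 : p' <= p by rewrite ge_min lexx.
have p0 : 0 < p'.
  by apply: lt_trans p3; rewrite divr_gt0; clear - s0; lra.
have [C [C0 HC]] := tail_estimate s1 p3 p4; exists C; split => //.
move=> f w r0 mf rf c1 mw B1 r16 wf.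
have mE : measurable_fun setT (fun x : M3 R => eucl x).
  by apply: measurable_eucl; exact: measurable_id.
have mD (r : R) : measurable [set x : M3 R | r <= eucl x].
  rewrite -[X in measurable X]setTI.
  exact: (measurable_fun_ler (measurable_cst _) mE measurableT (Y := [set true])).
have mpow u : measurable_fun [set: M3 R] (fun x => (`|f x| `^ u)%:E).
  by apply/measurable_EFinP; exact: measurable_powR_norm.
have mI : measurable_fun [set: M3 R] (fun x => (\1_(cube 0 (2 * r0)) x)%:E : \bar R).
  by apply/measurable_EFinP; apply: measurable_indic; exact: measurable_cube.
have mP : measurable_fun [set: M3 R] ((fun x => (`|f x| `^ p')%:E) \_ [set x | r0 <= eucl x]).
  by apply/(measurable_restrictT _ (mD r0)); exact: measurable_funTS.
have P0 x : (0 <= ((fun x => (`|f x| `^ p')%:E) \_ [set x | (r0 <= eucl x)%R]) x)%E.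
  by rewrite patchE; case: ifPn => // _; rewrite lee_fin powR_ge0.
have r00 : 0 < 2 * r0 by clear - r16; lra.
(* The cube covers the ball of radius [r0], inside which |f x|^p <= 1 suffices wherever |f x| <=
   1. *)
apply: (@le_trans _ _ (\int[L]_x ((\1_(cube 0 (2 * r0)) x)%:E +
   ((fun x => (`|f x| `^ p')%:E) \_ [set x | (r0 <= eucl x)%R]) x + (`|f x| `^ q)%:E))%E).
  apply: ge0_le_integral => //.
  - by apply: emeasurable_funD => //; apply: emeasurable_funD.
  move=> x _; have [f1|f1] := leP `|f x| 1; last first.
    apply: (@le_trans _ _ (`|f x| `^ q)%:E); last by rewrite leeDr// adde_ge0// lee_fin.
    by rewrite lee_fin ler_powR// ltW.
  have fq0 : (0 <= (`|f x| `^ q)%:E)%E by rewrite lee_fin powR_ge0.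
  have pp : `|f x| `^ p <= `|f x| `^ p'.
    have [->|fn] := eqVneq `|f x| 0.
      by rewrite !powR0// gt_eqF// (lt_le_trans p0).
    by apply: ger_powR => //; rewrite f1 lt_neqAle eq_sym fn normr_ge0.
  have [xr|xr] := leP r0 (eucl x).
    rewrite patchE ifT ?inE//; apply: (@le_trans _ _ (`|f x| `^ p')%:E); first by rewrite lee_fin.
    by rewrite -addeA addeCA leeDl// adde_ge0// lee_fin.
  rewrite indicE mem_set; last first.
    have : eucl x ^+ 2 < (2 * r0) ^+ 2.
      rewrite sqr_ltE ?(ltW r00)// ger0_norm ?eucl_ge0//; clear - xr r16; lra.
    rewrite eucl_sqr => e2; apply/cubeP; rewrite !subr0 -!sqr_ltE ?(ltW r00)//.
    have := sqr_ge0 x.1.1; have := sqr_ge0 x.1.2; have := sqr_ge0 x.2.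
    by move: e2; clear => *; split; lra.
  apply: (@le_trans _ _ 1%E); last by rewrite -addeA leeDl// adde_ge0.
  rewrite lee_fin (le_trans pp)// -(@powRr0 _ `|f x|).
  have [->|fn] := eqVneq `|f x| 0; first by rewrite powR0 ?gt_eqF// powR_ge0.
  by apply: ger_powR; rewrite ?(ltW p0)// f1 lt_neqAle eq_sym fn normr_ge0.
rewrite ge0_integralD//; last 2 first.
- by move=> x _; rewrite adde_ge0// lee_fin.
- exact: emeasurable_funD.
apply: leeD => //; rewrite ge0_integralD// EFinD; apply: leeD.
  rewrite integral_indic ?setIT//; last exact: measurable_cube.
  by rewrite -(leb3_cube 0%R r00).
apply: le_trans (HC f w r0 mf rf c1 mw B1 r16 wf).
by rewrite [leRHS]integral_mkcond.
Qed.

End Tail.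

(** * The Poisson kernel *)

Section PoissonKernel.
Variable R : realType.
Local Notation mu := (@lebesgue_measure R).
Local Notation L := (@leb3 R).

Lemma ge0_integral_halves (f : R -> \bar R) : measurable_fun [set: R] f ->
  (forall x, 0 <= f x)%E ->
  (\int[mu]_x f x = \int[mu]_(x in `[0%R, +oo[) f x + \int[mu]_(x in `[0%R, +oo[) f (- x)%R)%E.
Proof.
move=> mf f0.
have -> : [set: R] = `]-oo, 0%R]%classic `|` `]0%R, +oo[%classic.
  apply/seteqP; split => x //= _; rewrite !in_itv/= andbT.
  by case: (leP x 0) => ?; [left|right].
rewrite ge0_integral_setU//=; last 2 first.
- exact: measurable_funTS.
- apply/disj_set2P/seteqP; split => x //= []; rewrite !in_itv/= andbT; lra.
rewrite addeC integral_itv_obnd_cbnd; last exact: measurable_funTS.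
congr (_ + _)%E.
rewrite (ge0_integration_by_substitution0 (f := fun x => f (- x)%R))//; last first.
  by apply: (measurableT_comp mf); exact: oppr_measurable.
by apply: eq_integral => x _; rewrite opprK.
Qed.

(* The summand 1 keeps the integrand nonnegative, which the fundamental theorem
   of calculus on a half-line requires. *)
Lemma half_exp_cos (e a z : R) : 0 < e ->
  (\int[mu]_(t in `[0%R, +oo[) (expR (- (e * t)) * (1 + cos (a + z * t)))%:E =
   (e^-1 + (e * cos a - z * sin a) / (e ^+ 2 + z ^+ 2))%:E)%E.
Proof.
move=> e0; have D0 : 0 < e ^+ 2 + z ^+ 2 by rewrite ltr_pwDl ?exprn_gt0 ?sqr_ge0.
pose D := e ^+ 2 + z ^+ 2.
(* The antiderivative that tends to 0 at infinity, so that the integral is - F 0. *)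
pose F t := expR (- (e * t)) * ((z * sin (a + z * t) - e * cos (a + z * t)) / D - e^-1) : R.
pose f t := expR (- (e * t)) * (1 + cos (a + z * t)) : R.
have dF t : is_derive t (1 : R) F (f t).
  have d1 : is_derive t (1 : R) (fun t : R => expR (- (e * t))) (- e * expR (- (e * t))).
    apply: is_derive_eq.
    by rewrite /GRing.scale/= !mulr1 mulrC mulNr.
  have d2 : is_derive t (1 : R) (fun t : R => sin (a + z * t)) (z * cos (a + z * t)).
    apply: is_derive_eq.
    transitivity (cos (a + z * t) * ((0 + 1) * (z * 1))) => //; ring.
  have d3 : is_derive t (1 : R) (fun t : R => cos (a + z * t)) (- z * sin (a + z * t)).
    apply: is_derive_eq.
    transitivity (- sin (a + z * t) * ((0 + 1) * (z * 1))) => //; ring.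
  apply: is_derive_eq.
  by rewrite /GRing.scale/= /f /D; field; rewrite !gt_eqF.
have dvf t : derivable f t 1 by apply: ex_derive.
have cf : continuous f.
  by move=> t; apply: differentiable_continuous; exact/derivable1_diffP.
rewrite (@ge0_continuous_FTC2y R f F 0 0).
- rewrite /F mulr0 oppr0 expR0 mul1r mulr0 addr0 sub0e -EFinN; congr EFin.
  by rewrite /D; field; rewrite !gt_eqF.
- move=> t _; rewrite mulr_ge0 ?expR_ge0//; have := cos_geN1 (a + z * t); lra.
- exact: continuous_subspaceT.
- apply/cvgrPdist_le => eps eps0.
  have E0 : expR (- (e * t)) @[t --> +oo] --> (0 : R).
    apply: (cvg_comp (fun t => e * t) (fun u => expR (- u))); last exact: cvgr_expR.
    by apply: gt0_cvgMry => //; exact: cvg_id.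
  pose B := (`|z| + e) / D + e^-1.
  have B0 : 0 < B.
    rewrite /B ltr_wpDl// ?invr_gt0//; apply: divr_ge0; last exact: ltW.
    by apply: addr_ge0 => //; exact: ltW.
  have := E0 => /cvgrPdist_le /(_ (eps / B) (divr_gt0 eps0 B0)).
  apply: filterS => t; rewrite !sub0r !normrN => Et.
  rewrite /F normrM; apply: (@le_trans _ _ (eps / B * B)); last by rewrite divfK// gt_eqF.
  apply: ler_pM => //; apply: (le_trans (ler_normB _ _)); rewrite /B.
  rewrite (ger0_norm (_ : 0 <= e^-1)) ?invr_ge0 ?(ltW e0)// lerD2r normrM.
  rewrite [X in _ * X]ger0_norm ?invr_ge0 ?(ltW D0)// ler_wpM2r ?invr_ge0 ?(ltW D0)//.
  apply: (le_trans (ler_normB _ _)); rewrite !normrM (ger0_norm (ltW e0)); apply: lerD.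
    by rewrite ler_piMr// ler_norml sin_geN1 sin_le1.
  by rewrite ler_piMr ?(ltW e0)// ler_norml cos_geN1 cos_le1.
- by move=> t _; apply: ex_derive.
- apply: cvg_at_right_filter; apply: differentiable_continuous.
  by apply/derivable1_diffP; apply: ex_derive.
- by move=> t _; rewrite derive1E; apply: derive_val.
Qed.

(* [pk e] is the Fourier transform of [pw e]. *)
Definition pw (e t : R) : R := expR (- (e * `|t|)).
Definition pk (e z : R) : R := 2 * e / (e ^+ 2 + z ^+ 2).

Lemma pw_ge0 e t : 0 <= pw e t. Proof. exact: expR_ge0. Qed.

Lemma pw_le1 e t : 0 <= e -> pw e t <= 1.
Proof. by move=> e0; rewrite -expR0 ler_expR oppr_le0 mulr_ge0. Qed.

Lemma pk_ge0 e z : 0 < e -> 0 <= pk e z.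
Proof. by move=> e0; rewrite divr_ge0 ?addr_ge0 ?sqr_ge0// mulr_ge0// ltW. Qed.

Lemma pk_le e z : 0 < e -> pk e z <= 2 / e.
Proof.
move=> e0; rewrite /pk ler_pdivrMr; last by rewrite ltr_pwDl ?exprn_gt0 ?sqr_ge0.
rewrite mulrDr (_ : 2 / e * e ^+ 2 = 2 * e); last by field; rewrite gt_eqF.
by rewrite lerDl mulr_ge0 ?sqr_ge0// divr_ge0// ltW.
Qed.

Lemma measurable_pw (e : R) : measurable_fun [set: R] (pw e).
Proof.
apply: measurableT_comp => //; apply: measurable_funN; apply: measurable_funM => //.
Qed.

Lemma measurable_cosR : measurable_fun [set: R] (@cos R).
Proof. by apply: continuous_measurable_fun; exact: continuous_cos. Qed.

Lemma measurable_sinR : measurable_fun [set: R] (@sin R).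
Proof. by apply: continuous_measurable_fun; exact: continuous_sin. Qed.

(** On the negative half-line [z] becomes [- z], so the sine terms of the two halves cancel. *)
Lemma line_exp_cos (e a z : R) : 0 < e ->
  (\int[mu]_t (pw e t * (1 + cos (a + z * t)))%:E = (2 / e + pk e z * cos a)%:E)%E.
Proof.
move=> e0; rewrite ge0_integral_halves; last 2 first.
- apply/measurable_EFinP; apply: measurable_funM; first exact: measurable_pw.
  apply: measurable_funD => //; apply: (measurableT_comp measurable_cosR).
  by apply: measurable_funD => //; apply: measurable_funM => //; exact: measurable_id.
- move=> t; rewrite lee_fin mulr_ge0 ?pw_ge0//; have := cos_geN1 (a + z * t); lra.
have -> : (\int[mu]_(t in `[0%R, +oo[) (pw e t * (1 + cos (a + z * t)))%:E =
    \int[mu]_(t in `[0%R, +oo[) (expR (- (e * t)) * (1 + cos (a + z * t)))%:E)%E.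
  apply: eq_integral => t; rewrite inE/= in_itv/= andbT => t0.
  by rewrite /pw ger0_norm.
have -> : (\int[mu]_(t in `[0%R, +oo[) (pw e (- t) * (1 + cos (a + z * - t)))%:E =
    \int[mu]_(t in `[0%R, +oo[) (expR (- (e * t)) * (1 + cos (a + (- z) * t)))%:E)%E.
  apply: eq_integral => t; rewrite inE/= in_itv/= andbT => t0.
  by rewrite /pw normrN ger0_norm// mulrN mulNr.
rewrite !half_exp_cos// -EFinD /pk; congr EFin; field.
by rewrite !gt_eqF// ltr_pwDl ?exprn_gt0 ?sqr_ge0.
Qed.

Lemma line_exp (e : R) : 0 < e -> (\int[mu]_t (pw e t)%:E = (2 / e)%:E)%E.
Proof.
(* The phase pi / 2 at frequency 0 removes the cosine. *)
move=> e0; have := line_exp_cos (pi / 2) 0 e0; rewrite cos_pihalf mulr0 addr0 => <-.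
apply: eq_integral => t _; by rewrite mul0r addr0 cos_pihalf addr0 mulr1.
Qed.

Lemma measurable_pk (e : R) : 0 < e -> measurable_fun [set: R] (pk e).
Proof.
move=> e0; apply: continuous_measurable_fun => z; apply: cvgM; first exact: cvg_cst.
apply: cvgV; first by rewrite gt_eqF// ltr_pwDl ?exprn_gt0 ?sqr_ge0.
by apply: cvgD; [exact: cvg_cst|exact: exprn_continuous].
Qed.

Lemma line_pk (e : R) : 0 < e -> (\int[mu]_z (pk e z)%:E = (2 * pi)%:E)%E.
Proof.
move=> e0; have mpk := measurable_pk e0.
rewrite ge0_integral_halves; last 2 first.
- exact/measurable_EFinP.
- by move=> z; rewrite lee_fin pk_ge0.
have half : (\int[mu]_(z in `[0%R, +oo[) (pk e z)%:E = pi%:E)%E.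
  pose F (z : R) := 2 * atan (z / e).
  have dF z : is_derive z (1 : R) F (pk e z).
    apply: is_derive_eq; rewrite /GRing.scale/= !mulr1 /pk; field.
    by rewrite !gt_eqF// ltr_pwDl ?exprn_gt0 ?sqr_ge0.
  rewrite (@ge0_continuous_FTC2y R (pk e) F 0 pi).
  - by rewrite /F mul0r atan0 mulr0 sube0.
  - by move=> z _; exact: pk_ge0.
  - apply: continuous_subspaceT => z; apply: cvgM; first exact: cvg_cst.
    apply: cvgV; first by rewrite gt_eqF// ltr_pwDl ?exprn_gt0 ?sqr_ge0.
    by apply: cvgD; [exact: cvg_cst|exact: exprn_continuous].
  - rewrite (_ : pi = 2 * (pi / 2)); last by field.
    apply: cvgM; first exact: cvg_cst.
    apply: (cvg_comp (fun z => z / e) atan); last exact: cvgy_atan.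
    by apply: gt0_cvgMly; [rewrite invr_gt0|exact: cvg_id].
  - by move=> z _; apply: ex_derive.
  - apply: cvg_at_right_filter; apply: differentiable_continuous.
    by apply/derivable1_diffP; apply: ex_derive.
  - by move=> z _; rewrite derive1E; apply: derive_val.
rewrite half (_ : (\int[mu]_(z in `[0%R, +oo[) (pk e (- z))%:E = pi%:E)%E).
  by rewrite -EFinD; congr EFin; ring.
by rewrite -half; apply: eq_integral => z _; rewrite /pk sqrrN.
Qed.

End PoissonKernel.

(** * A Plancherel inequality *)

Section Plancherel.
Variable R : realType.
Local Notation mu := (@lebesgue_measure R).
Local Notation L := (@leb3 R).
Implicit Types (v : R3 R -> R) (x y z xi : R3 R) (e : R).

Definition W3 e xi : R := pw e xi.1.1 * pw e xi.1.2 * pw e xi.2.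
Definition K3 e z : R := pk e z.1.1 * pk e z.1.2 * pk e z.2.

Lemma W3_ge0 e xi : 0 <= W3 e xi.
Proof. by rewrite !mulr_ge0 ?pw_ge0. Qed.

Lemma W3_le1 e xi : 0 <= e -> W3 e xi <= 1.
Proof.
move=> e0; rewrite /W3 -[leRHS]mulr1; apply: ler_pM; rewrite ?mulr_ge0 ?pw_ge0 ?pw_le1//.
by rewrite -[leRHS]mulr1; apply: ler_pM; rewrite ?pw_ge0 ?pw_le1.
Qed.

Lemma K3_ge0 e z : 0 < e -> 0 <= K3 e z.
Proof. by move=> e0; apply: mulr_ge0; [apply: mulr_ge0|]; exact: pk_ge0. Qed.

Lemma measurable_prod3 (f g h : R -> R) : measurable_fun setT f ->
  measurable_fun setT g -> measurable_fun setT h ->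
  measurable_fun [set: M3 R] (fun x : M3 R => f x.1.1 * g x.1.2 * h x.2).
Proof.
move=> mf mg mh; apply: measurable_funM; first apply: measurable_funM.
- exact: measurableT_comp mf (@measurable_c1 R).
- exact: measurableT_comp mg (@measurable_c2 R).
- exact: measurableT_comp mh (@measurable_c3 R).
Qed.

Lemma ge0_integral_scale (k : R) (u : R -> R) (d : R) : 0 <= k ->
  measurable_fun setT u -> (forall t, 0 <= u t) ->
  (\int[mu]_t (u t)%:E = d%:E)%E -> (\int[mu]_t (k * u t)%:E = (k * d)%:E)%E.
Proof.
move=> k0 mu_ u0 ud; under eq_integral do rewrite EFinM.
rewrite ge0_integralZl_EFin ?ud//; first by move=> t _; rewrite lee_fin.
exact/measurable_EFinP.
Qed.

Lemma integral_prod3 (f g h : R -> R) (a b c : R) : measurable_fun setT f ->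
  measurable_fun setT g -> measurable_fun setT h ->
  (forall t, 0 <= f t) -> (forall t, 0 <= g t) -> (forall t, 0 <= h t) ->
  (\int[mu]_t (f t)%:E = a%:E)%E -> (\int[mu]_t (g t)%:E = b%:E)%E ->
  (\int[mu]_t (h t)%:E = c%:E)%E ->
  (\int[L]_x (f x.1.1 * g x.1.2 * h x.2)%:E = (a * b * c)%:E)%E.
Proof.
move=> mf mg mh f0 g0 h0 fa gb hc.
rewrite integral_leb3_z; last 2 first.
- by apply/measurable_EFinP; exact: measurable_prod3.
- by move=> x; rewrite lee_fin !mulr_ge0.
transitivity (\int[mu]_x (\int[mu]_y (f x * g y * c)%:E))%E.
  apply: eq_integral => x _; apply: eq_integral => y _.
  by rewrite (ge0_integral_scale (k := f x * g y) (d := c))// mulr_ge0.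
have c0 : 0 <= c by rewrite -lee_fin -hc; apply: integral_ge0 => t _; rewrite lee_fin.
have b0 : 0 <= b by rewrite -lee_fin -gb; apply: integral_ge0 => t _; rewrite lee_fin.
transitivity (\int[mu]_x (b * c * f x)%:E)%E.
  apply: eq_integral => x _; rewrite (_ : b * c * f x = (f x * c) * b); last by ring.
  rewrite -(ge0_integral_scale (k := f x * c) _ mg) ?mulr_ge0//.
  by apply: eq_integral => y _; congr EFin; ring.
by rewrite (ge0_integral_scale (k := b * c) (d := a)) ?mulr_ge0//; congr EFin; ring.
Qed.

Lemma integral_W3 e : 0 < e -> (\int[L]_x (W3 e x)%:E = ((2 / e) ^+ 3)%:E)%E.
Proof.
move=> e0; rewrite (integral_prod3 (a := 2 / e) (b := 2 / e) (c := 2 / e)) ?line_exp//;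
  try exact: measurable_pw; try by move=> t; exact: pw_ge0.
by congr EFin; ring.
Qed.

Lemma integral_K3 e : 0 < e -> (\int[L]_x (K3 e x)%:E = ((2 * pi) ^+ 3)%:E)%E.
Proof.
move=> e0; rewrite /K3 (integral_prod3 (a := 2 * pi) (b := 2 * pi) (c := 2 * pi)) ?line_pk//;
  try exact: measurable_pk; try by move=> t; exact: pk_ge0.
by congr EFin; ring.
Qed.

Lemma measurable_W3 e : measurable_fun setT (W3 e : M3 R -> R).
Proof. by apply: measurable_prod3; exact: measurable_pw. Qed.

Lemma measurable_K3 e : 0 < e -> measurable_fun setT (K3 e : M3 R -> R).
Proof. by move=> e0; apply: measurable_prod3; exact: measurable_pk. Qed.

(** The shape A + B (1 + cos) with nonnegative A and B is the induction invariant for three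
    successive integrations: it returns after each one and keeps the integrand nonnegative, as
    Tonelli requires. *)
Lemma line_affine e (A B a z : R) : 0 < e -> 0 <= A -> 0 <= B ->
  (\int[mu]_t (pw e t * (A + B * (1 + cos (a + z * t))))%:E =
   ((A + B) * (2 / e) + B * pk e z * cos a)%:E)%E.
Proof.
move=> e0 A0 B0.
have c0 t : 0 <= 1 + cos (a + z * t) :> R by have := cos_geN1 (a + z * t); lra.
have mc : measurable_fun setT (fun t : R => 1 + cos (a + z * t)).
  apply: measurable_funD => //; apply: (measurableT_comp (@measurable_cosR R)).
  by apply: measurable_funD => //; apply: measurable_funM => //; exact: measurable_id.
have mpw := @measurable_pw R e.
transitivity (\int[mu]_t (A%:E * (pw e t)%:E + B%:E * (pw e t * (1 + cos (a + z * t)))%:E))%E.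
  by apply: eq_integral => t _; rewrite -!EFinM -EFinD; congr EFin; ring.
rewrite ge0_integralD//.
- rewrite !ge0_integralZl_EFin//.
  + rewrite line_exp// line_exp_cos// -!EFinM -EFinD; congr EFin; ring.
  + by move=> t _; rewrite lee_fin mulr_ge0 ?pw_ge0.
  + by apply/measurable_EFinP; exact: measurable_funM.
  + by move=> t _; rewrite lee_fin pw_ge0.
  + exact/measurable_EFinP.
- by move=> t _; rewrite mule_ge0// lee_fin// pw_ge0.
- by apply: measurable_funeM; exact/measurable_EFinP.
- by move=> t _; rewrite mule_ge0// lee_fin// mulr_ge0 ?pw_ge0.
- by apply: measurable_funeM; apply/measurable_EFinP; exact: measurable_funM.
Qed.

Lemma measurable_W3_cos e z : measurable_fun setT
  (fun xi : M3 R => W3 e xi * cos (dot3 z xi)).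
Proof.
apply: measurable_funM; first exact: measurable_W3.
apply: (measurableT_comp (@measurable_cosR R)).
by apply: measurable_dot3; [exact: measurable_cst|exact: measurable_id].
Qed.

(** Each integration turns 1 + cos into (2/e - k) + k (1 + cos) with one variable fewer, where [k]
    is a value of [pk e]; nonnegativity persists because pk <= 2/e. *)
Lemma integral_W3_cos e z : 0 < e ->
  (\int[L]_xi (W3 e xi * (1 + cos (dot3 z xi)))%:E = ((2 / e) ^+ 3 + K3 e z)%:E)%E.
Proof.
move=> e0; have e20 : 0 <= 2 / e by rewrite divr_ge0// ltW.
have W0 xi : 0 <= W3 e xi * (1 + cos (dot3 z xi)).
  by rewrite mulr_ge0 ?W3_ge0//; have := cos_geN1 (dot3 z xi); lra.
rewrite integral_leb3_z; last 2 first.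
- apply/measurable_EFinP; under eq_fun do rewrite mulrDr mulr1.
  by apply: measurable_funD; [exact: measurable_W3|exact: measurable_W3_cos].
- by move=> xi; rewrite lee_fin.
set k1 := pk e z.1.1; set k2 := pk e z.1.2; set k3 := pk e z.2.
have k10 : 0 <= k1 by exact: pk_ge0.
have k20 : 0 <= k2 by exact: pk_ge0.
have k30 : 0 <= k3 by exact: pk_ge0.
have k2e : k2 <= 2 / e by exact: pk_le.
have k3e : k3 <= 2 / e by exact: pk_le.
have c0 a b t : 0 <= 1 + cos (a + b * t) :> R by have := cos_geN1 (a + b * t); lra.
have mc (A B a b : R) : measurable_fun setT (fun t : R => pw e t * (A + B * (1 + cos (a + b * t)))).
  apply: measurable_funM; first exact: measurable_pw.
  apply: measurable_funD => //; apply: measurable_funM => //.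
  apply: measurable_funD => //; apply: (measurableT_comp (@measurable_cosR R)).
  by apply: measurable_funD => //; apply: measurable_funM => //; exact: measurable_id.
have level3 (x y : R) : (\int[mu]_t (W3 e (x, y, t) * (1 + cos (dot3 z (x, y, t))))%:E =
   (pw e x * (pw e y * ((2 / e - k3) + k3 * (1 + cos (z.1.1 * x + z.1.2 * y)))))%:E)%E.
  rewrite /W3 /dot3 /=.
  transitivity (\int[mu]_t (pw e x * pw e y * (pw e t * (0 + 1 * (1 + cos ((z.1.1 * x + z.1.2 * y) + z.2 * t)))))%:E)%E.
    by apply: eq_integral => t _; congr EFin; ring.
  rewrite (ge0_integral_scale _ (mc _ _ _ _) _ (line_affine _ _ e0 (lexx 0) ler01)) ?mulr_ge0 ?pw_ge0//.
    by rewrite -/k3; congr EFin; ring.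
  by move=> t; rewrite mulr_ge0 ?pw_ge0// add0r mul1r.
have level2 (x : R) : (\int[mu]_y (pw e x * (pw e y * ((2 / e - k3) + k3 * (1 + cos (z.1.1 * x + z.1.2 * y)))))%:E =
   (pw e x * (((2 / e) ^+ 2 - k2 * k3) + k2 * k3 * (1 + cos (0 + z.1.1 * x))))%:E)%E.
  rewrite (ge0_integral_scale _ (mc _ _ _ _) _ (line_affine _ _ e0 _ k30)) ?pw_ge0 ?subr_ge0//.
    by rewrite -/k2 add0r; congr EFin; ring.
  by move=> t; rewrite mulr_ge0 ?pw_ge0// addr_ge0 ?subr_ge0// mulr_ge0.
transitivity (\int[mu]_x (pw e x * (((2 / e) ^+ 2 - k2 * k3) + k2 * k3 * (1 + cos (0 + z.1.1 * x))))%:E)%E.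
  apply: eq_integral => x _; rewrite -level2.
  by apply: eq_integral => y _; exact: level3.
have k23 : 0 <= k2 * k3 by exact: mulr_ge0.
have d0 : 0 <= (2 / e) ^+ 2 - k2 * k3 by rewrite subr_ge0 expr2 ler_pM.
rewrite line_affine//.
by congr EFin; rewrite cos0 /K3 -/k1 -/k2 -/k3; ring.
Qed.

Lemma integrable_W3 e : 0 < e -> L.-integrable setT (EFin \o W3 e).
Proof.
move=> e0; apply/integrableP; split; first by apply/measurable_EFinP; exact: measurable_W3.
under eq_integral do rewrite /= ger0_norm ?W3_ge0//.
by rewrite integral_W3// ltry.
Qed.

Lemma integrable_K3 e : 0 < e -> L.-integrable setT (EFin \o K3 e).
Proof.
move=> e0; apply/integrableP; split; first by apply/measurable_EFinP; exact: measurable_K3.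
under eq_integral do rewrite /= ger0_norm ?K3_ge0//.
by rewrite integral_K3// ltry.
Qed.

Lemma Rintegral_W3_cos e z : 0 < e ->
  \int[L]_xi (W3 e xi * cos (dot3 z xi)) = K3 e z.
Proof.
move=> e0; have iW := integrable_W3 e0.
have iC : L.-integrable setT (EFin \o (fun xi => W3 e xi * cos (dot3 z xi))).
  apply: le_integrable iW => //; first by apply/measurable_EFinP; exact: measurable_W3_cos.
  move=> xi _; rewrite /= lee_fin normrM ler_piMr// ler_norml cos_geN1 cos_le1//.
have e1 : \int[L]_xi (W3 e xi * (1 + cos (dot3 z xi))) = (2 / e) ^+ 3 + K3 e z.
  by rewrite /Rintegral integral_W3_cos.
have e2 : \int[L]_xi W3 e xi = (2 / e) ^+ 3 by rewrite /Rintegral integral_W3.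
apply: (@addrI _ ((2 / e) ^+ 3)); rewrite -e1 -{1}e2 -RintegralD//.
by apply: eq_Rintegral => xi _; rewrite mulrDr mulr1.
Qed.

Definition rint (f : R3 R -> R) := L.-integrable [set: M3 R] (EFin \o f).

Lemma rint_meas f : rint f -> measurable_fun setT (f : M3 R -> R).
Proof. by move=> /integrableP[/measurable_EFinP]. Qed.

Lemma rint_dom (f g : R3 R -> R) : measurable_fun setT (f : M3 R -> R) -> rint g ->
  (forall x, `|f x| <= g x) -> rint f.
Proof.
move=> mf ig fg; apply: le_integrable ig => //; first exact/measurable_EFinP.
by move=> x _; rewrite /= lee_fin (le_trans (fg x))// ler_norm.
Qed.

Lemma rint_abs f : rint f -> rint (fun x => `|f x|).
Proof.
move=> fi; have := integrable_abse fi; apply: eq_integrable => // x _ /=.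
Qed.

Lemma rintZ (k : R) f : rint f -> rint (fun x => k * f x).
Proof.
move=> fi; have := integrableZl measurableT k fi; apply: eq_integrable => // x _ /=.
Qed.

Lemma rintD f g : rint f -> rint g -> rint (fun x => f x + g x).
Proof.
move=> fi gi; have := integrableD measurableT fi gi; apply: eq_integrable => // x _ /=.
Qed.

Lemma EFin_Rint f : rint f -> (\int[L]_x (f x)%:E = (\int[L]_x f x)%:E)%E.
Proof. by move=> fi; rewrite /Rintegral fineK//; exact: integrable_fin_num fi. Qed.

Lemma norm_Rint_le (f g : R3 R -> R) : measurable_fun setT (f : M3 R -> R) -> rint g ->
  (forall x, `|f x| <= g x) -> `|\int[L]_x f x| <= \int[L]_x g x.
Proof.
move=> mf ig fg; have fi := rint_dom mf ig fg.
apply: (le_trans (le_normr_Rintegral measurableT fi)); apply: le_Rintegral => //.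
exact: rint_abs.
Qed.

Lemma Rfubini (g : M3 R * M3 R -> R) (a b : R3 R -> R) : measurable_fun setT g ->
  rint a -> rint b -> (forall x, 0 <= a x) -> (forall x, 0 <= b x) ->
  (forall x y, `|g (x, y)| <= a x * b y) ->
  \int[L]_x \int[L]_y g (x, y) = \int[L]_y \int[L]_x g (x, y).
Proof.
move=> mg ia ib a0 b0 gab.
have mG : measurable_fun setT (EFin \o g) by exact/measurable_EFinP.
have mg1 x : measurable_fun setT (fun y : M3 R => g (x, y)).
  by apply: (measurableT_comp mg); exact: measurable_fun_pair.
have mg2 y : measurable_fun setT (fun x : M3 R => g (x, y)).
  by apply: (measurableT_comp mg); exact: measurable_fun_pair.
have i1 x : rint (fun y => g (x, y)) by apply: (rint_dom (mg1 x) (rintZ (a x) ib)) => y.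
have i2 y : rint (fun x => g (x, y)).
  by apply: (rint_dom (mg2 y) (rintZ (b y) ia)) => x; rewrite mulrC.
have iG : (L \x L)%E.-integrable setT (EFin \o g).
  apply: (iffRL (@integrable12ltyP _ _ _ _ R L L _ mG)).
  apply: (@le_lt_trans _ _ (\int[L]_x (a x * \int[L]_y b y)%:E)%E).
    apply: ge0_le_integral => //.
    - by move=> x _; apply: integral_ge0.
    - apply: (measurable_fun_fubini_tonelli_F (fun p => `|(g p)%:E|%E)) => //.
      exact: measurableT_comp.
    - by apply/measurable_EFinP; apply: measurable_funM => //; exact: rint_meas.
    - move=> x _; rewrite EFinM -EFin_Rint// -integralZl//.
      apply: ge0_le_integral => //.
      + by do 2 apply: measurableT_comp => //; exact: mg1.
      + apply: measurable_funeM; apply/measurable_EFinP; exact: rint_meas.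
      + by move=> y _; rewrite /= lee_fin.
  have := rintZ (\int[L]_y b y) ia => /EFin_Rint => e.
  by under eq_integral do rewrite mulrC; rewrite e ltry.
have j1 : rint (fun x => \int[L]_y g (x, y)).
  apply: (@rint_dom _ (fun x => (\int[L]_y b y) * a x)).
  - exact: measurable_Rintegral2.
  - exact: rintZ.
  - move=> x; rewrite mulrC -RintegralZl//; apply: norm_Rint_le => //.
    exact: rintZ.
have j2 : rint (fun y => \int[L]_x g (x, y)).
  apply: (@rint_dom _ (fun x => (\int[L]_y a y) * b x)).
  - have mg' : measurable_fun setT (fun p : M3 R * M3 R => g (p.2, p.1)).
      by apply: (measurableT_comp mg); exact: measurable_fun_pair.
    exact: (@measurable_Rintegral2 _ _ _ _ _ L _ mg').
  - exact: rintZ.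
  - move=> y; rewrite mulrC -RintegralZl//; apply: norm_Rint_le => //.
    + exact: rintZ.
    + by move=> x; rewrite mulrC.
suff e : ((\int[L]_x \int[L]_y g (x, y))%:E = (\int[L]_y \int[L]_x g (x, y))%:E)%E.
  exact: (congr1 fine e).
rewrite -(EFin_Rint j1) -(EFin_Rint j2).
transitivity (\int[L]_x \int[L]_y (g (x, y))%:E)%E.
  by apply: eq_integral => x _; rewrite -EFin_Rint.
rewrite (Fubini iG); apply: eq_integral => y _; exact: EFin_Rint.
Qed.

(** For a real [v] the unnormalized Fourier transform is Ct - i St; working with the two parts keeps
    all integrals real. *)
Definition Ct v xi : R := \int[L]_x (cos (dot3 x xi) * v x).
Definition St v xi : R := \int[L]_x (sin (dot3 x xi) * v x).

Lemma measurable_cos_dot (d : measure_display) (T : measurableType d) (a b : T -> R3 R) :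
  measurable_fun setT (a : T -> M3 R) -> measurable_fun setT (b : T -> M3 R) ->
  measurable_fun setT (fun t => cos (dot3 (a t) (b t))).
Proof.
by move=> ma mb; apply: (measurableT_comp (@measurable_cosR R)); exact: measurable_dot3.
Qed.

Lemma measurable_sin_dot (d : measure_display) (T : measurableType d) (a b : T -> R3 R) :
  measurable_fun setT (a : T -> M3 R) -> measurable_fun setT (b : T -> M3 R) ->
  measurable_fun setT (fun t => sin (dot3 (a t) (b t))).
Proof.
by move=> ma mb; apply: (measurableT_comp (@measurable_sinR R)); exact: measurable_dot3.
Qed.

Lemma measurable_Ct v : measurable_fun setT (v : M3 R -> R) ->
  measurable_fun setT (Ct v : M3 R -> R).
Proof.
move=> mv; have mg : measurable_fun setT
    (fun p : M3 R * M3 R => cos (dot3 p.2 p.1) * v p.2).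
  apply: measurable_funM; last exact: measurableT_comp mv measurable_snd.
  by apply: measurable_cos_dot; [exact: measurable_snd|exact: measurable_fst].
exact: (@measurable_Rintegral2 _ _ _ _ _ L _ mg).
Qed.

Lemma measurable_St v : measurable_fun setT (v : M3 R -> R) ->
  measurable_fun setT (St v : M3 R -> R).
Proof.
move=> mv; have mg : measurable_fun setT
    (fun p : M3 R * M3 R => sin (dot3 p.2 p.1) * v p.2).
  apply: measurable_funM; last exact: measurableT_comp mv measurable_snd.
  by apply: measurable_sin_dot; [exact: measurable_snd|exact: measurable_fst].
exact: (@measurable_Rintegral2 _ _ _ _ _ L _ mg).
Qed.

Lemma norm_cosM (t u : R) : `|cos t * u| <= `|u|.
Proof. by rewrite normrM ler_piMl// ler_norml cos_geN1 cos_le1. Qed.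

Lemma norm_sinM (t u : R) : `|sin t * u| <= `|u|.
Proof. by rewrite normrM ler_piMl// ler_norml sin_geN1 sin_le1. Qed.

Lemma rint_cos v xi : rint v -> rint (fun x => cos (dot3 x xi) * v x).
Proof.
move=> vi; apply: rint_dom (rint_abs vi) _; last by move=> x; exact: norm_cosM.
apply: measurable_funM; last exact: rint_meas.
by apply: measurable_cos_dot; [exact: measurable_id|exact: measurable_cst].
Qed.

Lemma rint_sin v xi : rint v -> rint (fun x => sin (dot3 x xi) * v x).
Proof.
move=> vi; apply: rint_dom (rint_abs vi) _; last by move=> x; exact: norm_sinM.
apply: measurable_funM; last exact: rint_meas.
by apply: measurable_sin_dot; [exact: measurable_id|exact: measurable_cst].
Qed.

Lemma Ct_le v xi : rint v -> `|Ct v xi| <= \int[L]_x `|v x|.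
Proof.
move=> vi; apply: norm_Rint_le; last by move=> x; exact: norm_cosM.
- exact: rint_meas (rint_cos xi vi).
- exact: rint_abs.
Qed.

Lemma St_le v xi : rint v -> `|St v xi| <= \int[L]_x `|v x|.
Proof.
move=> vi; apply: norm_Rint_le; last by move=> x; exact: norm_sinM.
- exact: rint_meas (rint_sin xi vi).
- exact: rint_abs.
Qed.

Lemma dot3Bl x y xi : dot3 (x - y) xi = dot3 x xi - dot3 y xi.
Proof. by rewrite /dot3/=; ring. Qed.

(* The weight W3 is integrable and its Fourier transform K3 is an approximate
   identity. *)
Lemma regularized_energy e v : 0 < e -> rint v ->
  \int[L]_xi (W3 e xi * (Ct v xi ^+ 2 + St v xi ^+ 2)) =
  \int[L]_x (v x * \int[L]_y (v y * K3 e (x - y))).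
Proof.
move=> e0 vi; have mv := rint_meas vi; set V := \int[L]_x `|v x|.
have V0 : 0 <= V by apply: Rintegral_ge0.
have iW : rint (W3 e) by exact: integrable_W3.
have mW := measurable_W3 e.
(* Ct^2 + St^2 is the integral of [v x * D x xi], and [D x xi] that of v y cos((x - y) . xi): the
   energy becomes a double integral against cosines of differences. *)
pose D x xi := Ct v xi * cos (dot3 x xi) + St v xi * sin (dot3 x xi).
have DE x xi : D x xi = \int[L]_y (v y * cos (dot3 (x - y) xi)).
  rewrite /D /Ct /St ![_ * cos (dot3 x xi)]mulrC ![_ * sin (dot3 x xi)]mulrC.
  rewrite -RintegralZl//; last exact: rint_cos.
  rewrite -RintegralZl//; last exact: rint_sin.
  rewrite -RintegralD//; last 2 first.
  - exact: (rintZ (cos (dot3 x xi)) (rint_cos xi vi)).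
  - exact: (rintZ (sin (dot3 x xi)) (rint_sin xi vi)).
  apply: eq_Rintegral => y _; rewrite dot3Bl cosB; ring.
have DV x xi : `|D x xi| <= V.
  rewrite DE; apply: norm_Rint_le; last by move=> y; rewrite mulrC norm_cosM.
  - apply: measurable_funM => //; apply: measurable_cos_dot; last exact: measurable_cst.
    by apply: measurable_sub3; [exact: measurable_cst|exact: measurable_id].
  - exact: rint_abs.
transitivity (\int[L]_xi \int[L]_x (W3 e xi * v x * D x xi)).
  apply: eq_Rintegral => xi _.
  have i1 := rintZ (W3 e xi * Ct v xi) (rint_cos xi vi).
  have i2 := rintZ (W3 e xi * St v xi) (rint_sin xi vi).
  rewrite (_ : W3 e xi * _ = W3 e xi * Ct v xi * Ct v xi + W3 e xi * St v xi * St v xi); last by ring.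
  rewrite {2}/Ct {2}/St -RintegralZl//; last exact: rint_cos.
  rewrite -RintegralZl//; last exact: rint_sin.
  rewrite -RintegralD//; apply: eq_Rintegral => x _; rewrite /D; ring.
have mD (d : measure_display) (T : measurableType d) (a b : T -> R3 R) :
    measurable_fun setT (a : T -> M3 R) -> measurable_fun setT (b : T -> M3 R) ->
    measurable_fun setT (fun t => D (a t) (b t)).
  move=> ma mb; apply: measurable_funD; apply: measurable_funM.
  - exact: measurableT_comp (measurable_Ct mv) mb.
  - exact: measurable_cos_dot.
  - exact: measurableT_comp (measurable_St mv) mb.
  - exact: measurable_sin_dot.
have mg : measurable_fun setT (fun p : M3 R * M3 R => W3 e p.1 * v p.2 * D p.2 p.1).
  apply: measurable_funM.
    apply: measurable_funM; first exact: measurableT_comp mW measurable_fst.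
    exact: measurableT_comp mv measurable_snd.
  by apply: mD; [exact: measurable_snd|exact: measurable_fst].
rewrite (Rfubini (g := fun p => W3 e p.1 * v p.2 * D p.2 p.1) (a := fun xi => V * W3 e xi)
  (b := fun x => `|v x|))//=; last 4 first.
- exact: rintZ.
- exact: rint_abs.
- by move=> xi; rewrite mulr_ge0// W3_ge0.
- move=> xi x; rewrite (normrM (W3 e xi * v x)) (normrM (W3 e xi)) (ger0_norm (W3_ge0 e xi)) mulrC !mulrA ler_wpM2r//.
  by do 3 (apply: ler_wpM2r; first exact: pw_ge0).
apply: eq_Rintegral => x _.
have iWD : rint (fun xi => W3 e xi * D x xi).
  apply: (rint_dom _ (rintZ V iW)).
    apply: measurable_funM => //.
    by apply: mD; [exact: measurable_cst|exact: measurable_id].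
  by move=> xi; rewrite normrM (ger0_norm (W3_ge0 e xi)) mulrC ler_wpM2r// W3_ge0.
transitivity (v x * \int[L]_xi (W3 e xi * D x xi)).
  by rewrite -RintegralZl//; apply: eq_Rintegral => xi _; ring.
congr (_ * _).
transitivity (\int[L]_xi \int[L]_y (W3 e xi * (v y * cos (dot3 (x - y) xi)))).
  apply: eq_Rintegral => xi _; rewrite DE RintegralZl//.
  apply: rint_dom (rint_abs vi) _; last by move=> y; rewrite mulrC norm_cosM.
  apply: measurable_funM => //; apply: measurable_cos_dot; last exact: measurable_cst.
  by apply: measurable_sub3; [exact: measurable_cst|exact: measurable_id].
rewrite (Rfubini (g := fun p => W3 e p.1 * (v p.2 * cos (dot3 (x - p.2) p.1))) (a := W3 e)
  (b := fun x => `|v x|))//=; last 4 first.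
- apply: measurable_funM; first exact: measurableT_comp mW measurable_fst.
  apply: measurable_funM; first exact: measurableT_comp mv measurable_snd.
  apply: measurable_cos_dot; last exact: measurable_fst.
  by apply: measurable_sub3; [exact: measurable_cst|exact: measurable_snd].
- exact: rint_abs.
- by move=> xi; rewrite W3_ge0.
- move=> xi y; rewrite normrM (ger0_norm (W3_ge0 e xi)) ler_wpM2l ?W3_ge0//.
  by rewrite mulrC norm_cosM.
apply: eq_Rintegral => y _; rewrite -Rintegral_W3_cos// -RintegralZl//.
  by apply: eq_Rintegral => xi _; ring.
apply: rint_dom iW _; first exact: measurable_W3_cos.
by move=> xi; rewrite mulrC (le_trans (norm_cosM _ _))// ger0_norm ?W3_ge0.
Qed.

Lemma K3N e z : K3 e (- z) = K3 e z.
Proof. by rewrite /K3 /pk /= !sqrrN. Qed.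

(** pk e t <= 2 e / t^2 = e (1 + t^(-2)) pk 1 t. Away from 0 the kernel is thus [e] times a fixed
    integrable one. *)
Lemma pk_tail e (d t : R) : 0 < e -> 0 < d -> d <= `|t| ->
  pk e t <= e * (1 + d ^- 2) * pk 1 t.
Proof.
move=> e0 d0 dt; have d20 : 0 < d ^+ 2 by rewrite exprn_gt0.
have t2 : d ^+ 2 <= t ^+ 2 by rewrite -(real_normK (num_real t)) ler_pXn2r ?nnegrE// ltW.
have t20 : 0 < t ^+ 2 by exact: lt_le_trans t2.
have pos : 0 < 1 + t ^+ 2 by exact: addr_gt0.
apply: (@le_trans _ _ (2 * e / t ^+ 2)).
  rewrite /pk ler_wpM2l ?mulr_ge0 ?(ltW e0)// lef_pV2 ?posrE//.
    by rewrite lerDr sqr_ge0.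
  by rewrite ltr_pwDl ?exprn_gt0// ltW.
have dt2 : t ^- 2 <= d ^- 2 by rewrite lef_pV2.
rewrite /pk mulr1 expr1n.
apply: (@le_trans _ _ (e * (1 + t ^- 2) * (2 / (1 + t ^+ 2)))).
  rewrite le_eqVlt; apply/orP; left; apply/eqP; field.
  by apply/andP; split; [rewrite gt_eqF|rewrite -(sqrf_eq0 t) gt_eqF].
rewrite ler_wpM2r ?divr_ge0 ?(ltW pos)// ler_wpM2l ?(ltW e0)// lerD2l//.
Qed.

(** One summand for each coordinate in which [z] may leave a cube: there [pk e] is traded for [e]
    times [pk 1], and the total mass of the sum does not depend on [e]. *)
Definition K3tail e z : R := pk 1 z.1.1 * pk e z.1.2 * pk e z.2 +
  pk e z.1.1 * pk 1 z.1.2 * pk e z.2 + pk e z.1.1 * pk e z.1.2 * pk 1 z.2.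

Lemma K3tail_ge0 e z : 0 < e -> 0 <= K3tail e z.
Proof.
move=> e0; have a t := pk_ge0 t e0; have b t := pk_ge0 t (@ltr01 R).
by apply: addr_ge0; [apply: addr_ge0|]; (apply: mulr_ge0; first apply: mulr_ge0).
Qed.

Lemma integral_pk3 (a b c : R) : 0 < a -> 0 < b -> 0 < c ->
  rint (fun z => pk a z.1.1 * pk b z.1.2 * pk c z.2) /\
  \int[L]_z (pk a z.1.1 * pk b z.1.2 * pk c z.2) = (2 * pi) ^+ 3.
Proof.
move=> a0 b0 c0.
have e : (\int[L]_z (pk a z.1.1 * pk b z.1.2 * pk c z.2)%:E = ((2 * pi) ^+ 3)%:E)%E.
  rewrite (integral_prod3 (a := 2 * pi) (b := 2 * pi) (c := 2 * pi)) ?line_pk//;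
    try exact: measurable_pk; try by move=> t; exact: pk_ge0.
  by congr EFin; ring.
split; last by rewrite /Rintegral e.
apply/integrableP; split.
  by apply/measurable_EFinP; apply: measurable_prod3; exact: measurable_pk.
apply: (@le_lt_trans _ _ (((2 * pi) ^+ 3)%:E)); last exact: ltry.
rewrite -e le_eqVlt; apply/orP; left; apply/eqP; apply: eq_integral => z _.
rewrite /= ger0_norm//.
by apply: mulr_ge0; [apply: mulr_ge0|]; exact: pk_ge0.
Qed.

Lemma integral_K3tail e : 0 < e -> rint (K3tail e) /\
  \int[L]_z K3tail e z = 3 * (2 * pi) ^+ 3.
Proof.
move=> e0; have [i1 j1] := integral_pk3 ltr01 e0 e0.
have [i2 j2] := integral_pk3 e0 ltr01 e0; have [i3 j3] := integral_pk3 e0 e0 ltr01.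
split; first by apply: rintD => //; exact: rintD.
rewrite /K3tail RintegralD//; last exact: rintD.
by rewrite RintegralD// j1 j2 j3; ring.
Qed.

Lemma K3_far e (d : R) z : 0 < e -> 0 < d -> ~ cube 0 d z ->
  K3 e z <= e * (1 + d ^- 2) * K3tail e z.
Proof.
move=> e0 d0 nz; have a t := pk_ge0 t e0; have b t := pk_ge0 t (@ltr01 R).
have c0 : 0 <= e * (1 + d ^- 2) by rewrite mulr_ge0 ?(ltW e0)// addr_ge0// invr_ge0 sqr_ge0.
have t1 := pk_tail e0 d0.
have m3 (u v w : R) : 0 <= u -> 0 <= v -> 0 <= w -> 0 <= e * (1 + d ^- 2) * (u * v * w).
  by move=> *; rewrite mulr_ge0// mulr_ge0// mulr_ge0.
have p1 := m3 _ _ _ (b z.1.1) (a z.1.2) (a z.2).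
have p2 := m3 _ _ _ (a z.1.1) (b z.1.2) (a z.2).
have p3 := m3 _ _ _ (a z.1.1) (a z.1.2) (b z.2).
rewrite /K3tail /K3.
have [z1|z1] := leP d `|z.1.1|.
  have := ler_wpM2r (mulr_ge0 (a z.1.2) (a z.2)) (t1 _ z1).
  move: p1 p2 p3; clear; lra.
have [z2|z2] := leP d `|z.1.2|.
  have := ler_wpM2r (mulr_ge0 (a z.1.1) (a z.2)) (t1 _ z2).
  move: p1 p2 p3; clear; lra.
have [z3|z3] := leP d `|z.2|.
  have := ler_wpM2r (mulr_ge0 (a z.1.1) (a z.1.2)) (t1 _ z3).
  move: p1 p2 p3; clear; lra.
by exfalso; apply: nz; apply/cubeP; rewrite !subr0.
Qed.

(** Inside the cube the modulus of continuity applies, outside it [K3_far]. The 6 M is the crude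
    oscillation bound 2 M times the three summands of [K3tail]. *)
Lemma approx_identity e (M d eta : R) v x : 0 < e -> 0 < d -> 0 <= M -> 0 <= eta ->
  measurable_fun setT (v : M3 R -> R) -> (forall y, `|v y| <= M) ->
  (forall z, cube 0 d z -> `|v (x + z) - v x| <= eta) ->
  `|(2 * pi) ^+ 3 * v x - \int[L]_y (v y * K3 e (x - y))| <=
  (eta + 6 * M * (e * (1 + d ^- 2))) * (2 * pi) ^+ 3.
Proof.
move=> e0 d0 M0 eta0 mv vM vd; have iK : rint (K3 e) by exact: integrable_K3.
have [iT jT] := integral_K3tail e0; have mK := measurable_K3 e0.
have mvx : measurable_fun setT (fun z : M3 R => v (x + z)).
  exact: measurableT_comp mv (mpres_shift x).1.
have -> : \int[L]_y (v y * K3 e (x - y)) = \int[L]_z (v (x + z) * K3 e z).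
  rewrite -(mpres_Rintegral (mpres_shift x)); last first.
    apply: measurable_funM => //; apply: (measurableT_comp mK).
    by apply: measurable_sub3; [exact: measurable_cst|exact: measurable_id].
  by apply: eq_Rintegral => z _; rewrite opprD addNKr K3N.
have iv : rint (fun z => v (x + z) * K3 e z).
  apply: (rint_dom _ (rintZ M iK)); first exact: measurable_funM.
  by move=> z; rewrite normrM (ger0_norm (K3_ge0 z e0)) ler_wpM2r ?K3_ge0.
have ivx := rintZ (v x) iK.
have -> : (2 * pi) ^+ 3 = \int[L]_z K3 e z by rewrite /Rintegral integral_K3.
have -> : (\int[L]_z K3 e z) * v x = \int[L]_z (v x * K3 e z) by rewrite RintegralZl// mulrC.
rewrite -RintegralB//.
set c := e * (1 + d ^- 2).
apply: (@le_trans _ _ (\int[L]_z (eta * K3 e z + 2 * M * c * K3tail e z))).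
  apply: norm_Rint_le.
  - apply: measurable_funB; apply: measurable_funM => //.
  - by apply: rintD; exact: rintZ.
  - move=> z; rewrite -mulrBl normrM (ger0_norm (K3_ge0 z e0)).
    have K0 := K3_ge0 z e0; have T0 := K3tail_ge0 z e0.
    have c0 : 0 <= c by rewrite mulr_ge0 ?(ltW e0)// addr_ge0// invr_ge0 sqr_ge0.
    have [cz|cz] := pselect (cube 0 d z).
      rewrite distrC -[leLHS]addr0; apply: lerD; first by rewrite ler_wpM2r// vd.
      by rewrite mulr_ge0// mulr_ge0// mulr_ge0.
    rewrite -[leLHS]add0r; apply: lerD; first by rewrite mulr_ge0.
    rewrite -mulrA; apply: ler_pM => //; last exact: K3_far.
    rewrite (le_trans (ler_normB _ _))//; have := vM x; have := vM (x + z); clear; lra.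
rewrite RintegralD//; [|exact: rintZ|exact: rintZ].
rewrite RintegralZl// RintegralZl// jT.
by rewrite /Rintegral integral_K3//= le_eqVlt; apply/orP; left; apply/eqP; rewrite -/c; ring.
Qed.

Definition unif_mod v := forall eta : R, 0 < eta ->
  exists2 d : R, 0 < d & forall x z, cube 0 d z -> `|v (x + z) - v x| <= eta.

(** As W3 <= 1, the right-hand side bounds the regularized energy for every [e], and by
    [approx_identity] this energy tends to the left-hand side. Bounding the Besov norm from above
    takes only this direction, so no Fourier inversion enters. *)
Lemma plancherel (M : R) v : rint v -> (forall y, `|v y| <= M) -> unif_mod v ->
  (((2 * pi) ^+ 3)%:E * \int[L]_x (v x ^+ 2)%:E <=
   \int[L]_xi (Ct v xi ^+ 2 + St v xi ^+ 2)%:E)%E.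
Proof.
move=> iv vM vU; have mv := rint_meas iv; set V := \int[L]_x `|v x|.
have V0 : 0 <= V by apply: Rintegral_ge0.
have M0 : 0 <= M by rewrite (le_trans _ (vM 0)).
have pi30 : 0 <= (2 * pi) ^+ 3 :> R by rewrite exprn_ge0// mulr_ge0// pi_ge0.
have iv2 : rint (fun x => v x ^+ 2).
  apply: (rint_dom _ (rintZ M (rint_abs iv))); first exact: measurable_funX.
  by move=> x; rewrite normrX expr2 ler_wpM2r.
have mCS : measurable_fun setT (fun xi : M3 R => Ct v xi ^+ 2 + St v xi ^+ 2).
  by apply: measurable_funD; apply: measurable_funX; [exact: measurable_Ct|exact: measurable_St].
have step e E : 0 < e -> (forall x, `|(2 * pi) ^+ 3 * v x - \int[L]_y (v y * K3 e (x - y))| <= E) ->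
    (((2 * pi) ^+ 3 * \int[L]_x (v x ^+ 2))%:E <=
     \int[L]_xi (Ct v xi ^+ 2 + St v xi ^+ 2)%:E + (V * E)%:E)%E.
  move=> e0 hE; have E0 : 0 <= E by rewrite (le_trans _ (hE 0)).
  have iW : rint (W3 e) by exact: integrable_W3.
  have iWCS : rint (fun xi => W3 e xi * (Ct v xi ^+ 2 + St v xi ^+ 2)).
    apply: (rint_dom _ (rintZ (2 * V ^+ 2) iW)).
      by apply: measurable_funM => //; exact: measurable_W3.
    move=> xi; rewrite normrM (ger0_norm (W3_ge0 e xi)) mulrC ler_wpM2r ?W3_ge0//.
    rewrite ger0_norm ?addr_ge0 ?sqr_ge0//.
    have c1 : Ct v xi ^+ 2 <= V ^+ 2.
      by rewrite -(real_normK (num_real (Ct v xi))) ler_pXn2r ?nnegrE//; exact: Ct_le.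
    have s1 : St v xi ^+ 2 <= V ^+ 2.
      by rewrite -(real_normK (num_real (St v xi))) ler_pXn2r ?nnegrE//; exact: St_le.
    by move: c1 s1; clear; lra.
  apply: (@le_trans _ _ ((\int[L]_xi (W3 e xi * (Ct v xi ^+ 2 + St v xi ^+ 2)))%:E + (V * E)%:E)%E).
    rewrite -EFinD lee_fin -lerBlDl regularized_energy//.
    have mK := measurable_K3 e0.
    have mg : measurable_fun setT (fun p : M3 R * M3 R => v p.2 * K3 e (p.1 - p.2)).
      apply: measurable_funM; first exact: measurableT_comp mv measurable_snd.
      by apply: (measurableT_comp mK); apply: measurable_sub3; [exact: measurable_fst|exact: measurable_snd].
    have mI := @measurable_Rintegral2 _ _ _ _ _ L _ mg; rewrite /= in mI.
    have iP : rint (fun x => v x * \int[L]_y (v y * K3 e (x - y))).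
      apply: (rint_dom _ (rintZ (E + (2 * pi) ^+ 3 * M) (rint_abs iv))).
        exact: measurable_funM.
      move=> x; rewrite normrM mulrC ler_wpM2r//.
      have := ler_normB ((2 * pi) ^+ 3 * v x) ((2 * pi) ^+ 3 * v x - \int[L]_y (v y * K3 e (x - y))).
      rewrite opprB addrC subrK => /le_trans; apply; rewrite addrC lerD ?hE//.
      by rewrite normrM (ger0_norm pi30) ler_wpM2l.
    rewrite -RintegralZl// -RintegralB//; last exact: rintZ.
    rewrite -RintegralZr//; last exact: rint_abs.
    apply: le_Rintegral => //.
    - have := integrableB measurableT (rintZ ((2 * pi) ^+ 3) iv2) iP.
      by apply: eq_integrable => // x _ /=.
    - have := rintZ E (rint_abs iv); apply: eq_integrable => // x _ /=; by rewrite mulrC.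
    - move=> x _; apply: (le_trans (ler_norm _)).
      rewrite (_ : _ - _ = v x * ((2 * pi) ^+ 3 * v x - \int[L]_y (v y * K3 e (x - y)))); last by ring.
      by rewrite normrM ler_wpM2l.
  rewrite leeD2r// -EFin_Rint//; apply: ge0_le_integral => //.
  - by move=> xi _; rewrite lee_fin mulr_ge0 ?W3_ge0// addr_ge0 ?sqr_ge0.
  - exact: (measurable_int _ iWCS).
  - exact/measurable_EFinP.
  - by move=> xi _; rewrite lee_fin ler_piMl ?addr_ge0 ?sqr_ge0 ?W3_le1// ltW.
rewrite (EFin_Rint iv2) -EFinM; apply/lee_addgt0Pr => eps eps0.
set P := (2 * pi) ^+ 3 in pi30 step *.
(* Both error terms are made at most [eta], for a total of 2 eta V P <= eps. The 1 here and in [e]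
   keeps the denominators positive when [V] or [M] vanishes. *)
pose eta := eps / (2 * (V * P + 1)).
have VP0 : 0 < V * P + 1 by rewrite ltr_wpDl// mulr_ge0.
have eta0 : 0 < eta by rewrite divr_gt0// mulr_gt0.
have [d d0 vd] := vU _ eta0.
pose c := 6 * M * (1 + d ^- 2).
have c0 : 0 <= c by rewrite mulr_ge0 ?mulr_ge0// addr_ge0// invr_ge0 sqr_ge0.
pose e := eta / (c + 1).
have e0 : 0 < e by rewrite divr_gt0// ltr_wpDl.
apply: (le_trans (step e _ e0 (fun x => approx_identity e0 d0 M0 (ltW eta0) mv vM (vd x)))).
rewrite leeD2l// lee_fin -/P.
have h1 : 6 * M * (e * (1 + d ^- 2)) <= eta.
  rewrite (_ : 6 * M * (e * (1 + d ^- 2)) = e * c); last by rewrite /c; ring.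
  by rewrite /e mulrAC ler_pdivrMr ?ltr_wpDl// ler_wpM2l ?(ltW eta0)// lerDl.
apply: (@le_trans _ _ (V * ((2 * eta) * P))).
  by rewrite ler_wpM2l// ler_wpM2r//; clear - h1; lra.
rewrite (_ : V * (2 * eta * P) = eps * ((V * P) / (V * P + 1))); last first.
  by rewrite /eta; field; rewrite gt_eqF.
by rewrite ler_piMr ?(ltW eps0)// ler_pdivrMr// mul1r lerDl.
Qed.

End Plancherel.

(** * Averages as Fourier multipliers *)

Section Multiplier.
Variable R : realType.
Local Notation mu := (@lebesgue_measure R).
Local Notation L := (@leb3 R).
Implicit Types (v : R3 R -> R) (x y z xi : R3 R) (h : R).

(** A class that contains the components of test functions, is stable under averages and
    differences, and carries what [plancherel] asks for, so that derivatives never appear. *)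
Definition tame v := [/\ measurable_fun setT (v : M3 R -> R),
  exists M : R, forall x, `|v x| <= M,
  exists2 r : R, 0 < r & forall x, ~ cube 0 r x -> v x = 0 &
  unif_mod v].

Lemma rint_cube x h (k : R) : 0 < h -> rint (fun y : R3 R => k * \1_(cube x h) y).
Proof.
move=> h0; apply: rintZ; apply/integrableP; split.
  by apply/measurable_EFinP; apply: measurable_indic; exact: measurable_cube.
apply: (@le_lt_trans _ _ (L (cube x h))); last by rewrite -[X in (X < _)%E]/(L (cube x h)) leb3_cube// ltry.
have := integral_indic L measurableT (measurable_cube x h); rewrite setIT => e.
rewrite -[X in (_ <= X)%E]e le_eqVlt; apply/orP; left; apply/eqP.
by apply: eq_integral => y _; rewrite /= ger0_norm// indicE.
Qed.

Lemma supported_le v (M r : R) x : (forall x, `|v x| <= M) ->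
  (forall x, ~ cube 0 r x -> v x = 0) -> `|v x| <= M * \1_(cube 0 r) x.
Proof.
move=> vM vr; rewrite indicE; case: (boolP (x \in _)) => [_|/negP xr].
  by rewrite mulr1.
by rewrite vr ?normr0 ?mulr0// => ?; apply: xr; rewrite inE.
Qed.

Lemma tame_rint v : tame v -> rint v.
Proof.
move=> [mv [M vM] [r r0 vr] _].
apply: (rint_dom mv (rint_cube 0 M r0)) => x; exact: supported_le.
Qed.

Lemma rint_kern x h : 0 < h -> rint (kern h x).
Proof.
move=> h0; have := rint_cube x ((8 * h ^+ 3)^-1) h0.
by apply: eq_integrable => // y _ /=; rewrite kernE.
Qed.

Lemma avg_le v (M : R) h x : 0 < h -> measurable_fun setT (v : M3 R -> R) ->
  (forall y, `|v y| <= M) -> `|avg h v x| <= M.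
Proof.
move=> h0 mv vM; rewrite avgE.
have ik := rint_kern x h0.
apply: (@le_trans _ _ (\int[L]_y (M * kern h x y))).
  apply: norm_Rint_le; last by move=> y; rewrite normrM (ger0_norm (kern_ge0 x y h0)) mulrC ler_wpM2r// kern_ge0.
  - by apply: measurable_funM => //; exact: measurable_kern.
  - exact: rintZ.
by rewrite RintegralZl// /Rintegral integral_kern1//= mulr1.
Qed.

Lemma tame_avg h v : 0 < h -> tame v -> tame (avg h v).
Proof.
move=> h0 tv; have iv := tame_rint tv; case: tv => mv [M vM] [r r0 vr] vU; split.
- exact: measurable_avg.
- by exists M => x; exact: avg_le.
- exists (r + h); first exact: addr_gt0.
  move=> x nx; rewrite avgE (_ : (fun y => _) = cst 0); first by rewrite Rintegral_cst// mul0r.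
  apply/funext => y /=; rewrite kernE indicE.
  case: (boolP (y \in _)) => [|_]; last by rewrite mulr0 mul0r.
  rewrite inE => /cubeP[y1 y2 y3]; rewrite vr ?mulr0// => /cubeP/=; rewrite !subr0 => -[z1 z2 z3].
  apply: nx; apply/cubeP => /=; rewrite !subr0.
  have tri (a b : R) : `|b - a| < h -> `|b| < r -> `|a| < r + h.
    move=> ab br; rewrite (_ : a = b - (b - a)); last by ring.
    by rewrite (le_lt_trans (ler_normB _ _))// ltrD.
  by split; [exact: tri z1|exact: tri z2|exact: tri z3].
- move=> eta eta0; have [d d0 vd] := vU _ eta0; exists d => // x z dz.
  rewrite !avg_shift//.
  have mvs a : measurable_fun setT (fun y : M3 R => v (a + y)).
    exact: measurableT_comp mv (mpres_shift a).1.
  have ib a : rint (fun y => kern h 0 y * v (a + y)).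
    by apply: (bounded_kern_integrable 0 h0 (mvs a) (M := M)) => y.
  rewrite -RintegralB//; [|exact: ib|exact: ib].
  have -> : \int[L]_y (kern h 0 y * v (x + z + y) - kern h 0 y * v (x + y)) =
      avg h (fun y => v (x + z + y) - v (x + y)) 0.
    by rewrite avgE; apply: eq_Rintegral => y _; rewrite mulrBr.
  apply: avg_le => //; first by apply: measurable_funB.
  by move=> y; rewrite (addrAC x z y); exact: vd.
Qed.

Lemma tameB u v : tame u -> tame v -> tame (fun x => u x - v x).
Proof.
move=> [mu_ [M uM] [r r0 ur] uU] [mv [N vN] [t t0 vt] vU]; split.
- exact: measurable_funB.
- by exists (M + N) => x; rewrite (le_trans (ler_normB _ _))// lerD.
- exists (r + t); first exact: addr_gt0.
  have sub (a b : R) x : 0 < a -> 0 < b -> cube 0 a x -> cube 0 (a + b) x.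
    by move=> a0 b0 /cubeP/= [x1 x2 x3]; apply/cubeP => /=; split; rewrite ltr_wpDr// ltW.
  move=> x nx; rewrite ur; last by move=> ?; apply: nx; exact: sub.
  by rewrite vt ?subr0// => ?; apply: nx; rewrite addrC; exact: sub.
- move=> eta eta0; have e2 : 0 < eta / 2 by rewrite divr_gt0.
  have [d d0 ud] := uU _ e2; have [e e0 ve] := vU _ e2.
  exists (Num.min d e); first by rewrite lt_min d0.
  move=> x z /cubeP/=; rewrite !subr0 !lt_min => -[/andP[a1 b1] /andP[a2 b2] /andP[a3 b3]].
  have := ud x z; have := ve x z.
  move=> /(_ ltac:(apply/cubeP => /=; rewrite !subr0//)) h1 /(_ ltac:(apply/cubeP => /=; rewrite !subr0//)) h2.
  rewrite (_ : _ - _ = (u (x + z) - u x) - (v (x + z) - v x)); last by ring.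
  by rewrite (le_trans (ler_normB _ _))// (splitr eta) lerD.
Qed.

(** The symbol of [avg h], real because the cube is symmetric. It is a product of three factors
    sin(h t) / (h t), but only its bounds matter. *)
Definition mult h xi : R := \int[L]_z (kern h 0 z * cos (dot3 z xi)).

Lemma dot3Dl x y xi : dot3 (x + y) xi = dot3 x xi + dot3 y xi.
Proof. by rewrite /dot3/=; ring. Qed.

Lemma dot3Nl x xi : dot3 (- x) xi = - dot3 x xi.
Proof. by rewrite /dot3/=; ring. Qed.

Lemma dot3Nr x xi : dot3 x (- xi) = - dot3 x xi.
Proof. by rewrite /dot3/=; ring. Qed.

Lemma measurable_dot3l xi : measurable_fun setT (fun z : M3 R => dot3 z xi).
Proof. by apply: measurable_dot3; [exact: measurable_id|exact: measurable_cst]. Qed.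

Lemma kern_sin0 h xi : 0 < h -> \int[L]_z (kern h 0 z * sin (dot3 z xi)) = 0 :> R.
Proof.
move=> h0; have mk : measurable_fun setT (fun z : M3 R => kern h 0 z * sin (dot3 z xi)).
  apply: measurable_funM; first exact: measurable_kern.
  exact: (measurableT_comp (@measurable_sinR R) (measurable_dot3l xi)).
have i : rint (fun z => kern h 0 z * sin (dot3 z xi)).
  by apply: (rint_dom mk (rint_kern 0 h0)) => z; rewrite mulrC (le_trans (norm_sinM _ _))// ger0_norm// kern_ge0.
set I := \int[L]_z _; suff : I = - I by move=> e; have := e; lra.
rewrite {1}/I -(mpres_Rintegral (@mpres_opp R) mk) -mulN1r -RintegralZl//.
apply: eq_Rintegral => z _; rewrite dot3Nl sinN mulN1r mulrN; congr (- (_ * _)).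
by apply: kern_eq; rewrite !cubeP/= !subr0 !normrN.
Qed.

Lemma rint_kern_cos h xi : 0 < h -> rint (fun z => kern h 0 z * cos (dot3 z xi)).
Proof.
move=> h0; apply: (rint_dom _ (rint_kern 0 h0)).
  apply: measurable_funM; first exact: measurable_kern.
  exact: (measurableT_comp (@measurable_cosR R) (measurable_dot3l xi)).
by move=> z; rewrite mulrC (le_trans (norm_cosM _ _))// ger0_norm// kern_ge0.
Qed.

Lemma rint_kern_sin h xi : 0 < h -> rint (fun z => kern h 0 z * sin (dot3 z xi)).
Proof.
move=> h0; apply: (rint_dom _ (rint_kern 0 h0)).
  apply: measurable_funM; first exact: measurable_kern.
  exact: (measurableT_comp (@measurable_sinR R) (measurable_dot3l xi)).
by move=> z; rewrite mulrC (le_trans (norm_sinM _ _))// ger0_norm// kern_ge0.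
Qed.

Lemma avg_cos h xi y : 0 < h ->
  avg h (fun x => cos (dot3 x xi)) y = mult h xi * cos (dot3 y xi).
Proof.
move=> h0; rewrite avg_shift; last first.
  exact: (measurableT_comp (@measurable_cosR R) (measurable_dot3l xi)).
have ic := rint_kern_cos xi h0; have is_ := rint_kern_sin xi h0.
transitivity (\int[L]_z (cos (dot3 y xi) * (kern h 0 z * cos (dot3 z xi)) +
    - sin (dot3 y xi) * (kern h 0 z * sin (dot3 z xi)))).
  by apply: eq_Rintegral => z _; rewrite dot3Dl cosD; ring.
rewrite RintegralD//; [|exact: rintZ|exact: rintZ].
by rewrite !RintegralZl// kern_sin0// mulr0 addr0 mulrC.
Qed.

Lemma avg_sin h xi y : 0 < h ->
  avg h (fun x => sin (dot3 x xi)) y = mult h xi * sin (dot3 y xi).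
Proof.
move=> h0; rewrite avg_shift; last first.
  exact: (measurableT_comp (@measurable_sinR R) (measurable_dot3l xi)).
have ic := rint_kern_cos xi h0; have is_ := rint_kern_sin xi h0.
transitivity (\int[L]_z (sin (dot3 y xi) * (kern h 0 z * cos (dot3 z xi)) +
    cos (dot3 y xi) * (kern h 0 z * sin (dot3 z xi)))).
  by apply: eq_Rintegral => z _; rewrite dot3Dl sinD; ring.
rewrite RintegralD//; [|exact: rintZ|exact: rintZ].
by rewrite !RintegralZl// kern_sin0// mulr0 addr0 mulrC.
Qed.

(** Averaging is self-adjoint since [kern] is symmetric. As [g] will be a cosine or a sine, the
    majorant for Fubini comes from the bounded support of [v]. *)
Lemma Rint_avg h v (g : R3 R -> R) : 0 < h -> tame v ->
  measurable_fun setT (g : M3 R -> R) -> (forall x, `|g x| <= 1) ->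
  \int[L]_x (g x * avg h v x) = \int[L]_y (avg h g y * v y).
Proof.
move=> h0 tv mg g1; have iv := tame_rint tv; case: tv => mv [M vM] [r r0 vr] _.
have rh0 : 0 < r + h by exact: addr_gt0.
transitivity (\int[L]_x \int[L]_y (g x * kern h x y * v y)).
  apply: eq_Rintegral => x _; rewrite avgE -RintegralZl//.
    by apply: eq_Rintegral => y _; rewrite mulrA.
  exact: (bounded_kern_integrable x h0 mv vM).
rewrite (Rfubini (g := fun p => g p.1 * kern h p.1 p.2 * v p.2)
   (a := fun x => (8 * h ^+ 3)^-1 * \1_(cube 0 (r + h)) x) (b := fun y => `|v y|)).
- apply: eq_Rintegral => y _ /=; rewrite avgE mulrC -RintegralZl//.
    by apply: eq_Rintegral => x _; rewrite (kern_sym h x y); ring.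
  exact: (bounded_kern_integrable y h0 mg g1).
- apply: measurable_funM; last exact: measurableT_comp mv measurable_snd.
  apply: measurable_funM; first exact: measurableT_comp mg measurable_fst.
  exact: measurable_kern2.
- exact: rint_cube.
- exact: rint_abs.
- by move=> x; rewrite mulr_ge0// invr_ge0 mulr_ge0// exprn_ge0// ltW.
- by move=> y.
- move=> x y /=; rewrite 2!normrM (ger0_norm (kern_ge0 x y h0)).
  have [y0|y0] := eqVneq (v y) 0; first by rewrite y0 normr0 !mulr0.
  rewrite ler_wpM2r//; apply: (@le_trans _ _ (kern h x y)).
    by rewrite ler_piMl ?kern_ge0.
  rewrite kernE ler_wpM2l ?invr_ge0 ?mulr_ge0 ?exprn_ge0 ?(ltW h0)// !indicE.
  case: (boolP (y \in cube x h)) => // yx; rewrite mem_set//.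
  have /cubeP[/=] : cube 0 r y by apply: contrapT => /vr /eqP; apply/negP.
  rewrite !subr0 => z1 z2 z3; move: yx; rewrite inE => /cubeP[y1 y2 y3].
  have tri (a b : R) : `|b - a| < h -> `|b| < r -> `|a| < r + h.
    move=> ab br; rewrite (_ : a = b - (b - a)); last by ring.
    by rewrite (le_lt_trans (ler_normB _ _))// ltrD.
  by apply/cubeP => /=; rewrite !subr0; split; [exact: tri z1|exact: tri z2|exact: tri z3].
Qed.

Lemma Ct_avg h v xi : 0 < h -> tame v -> Ct (avg h v) xi = mult h xi * Ct v xi.
Proof.
move=> h0 tv; rewrite /Ct (Rint_avg h0 tv); last 2 first.
- exact: (measurableT_comp (@measurable_cosR R) (measurable_dot3l xi)).
- by move=> x; rewrite ler_norml cos_geN1 cos_le1.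
rewrite -RintegralZl//; last exact: (rint_cos xi (tame_rint tv)).
by apply: eq_Rintegral => y _; rewrite avg_cos// mulrA.
Qed.

Lemma St_avg h v xi : 0 < h -> tame v -> St (avg h v) xi = mult h xi * St v xi.
Proof.
move=> h0 tv; rewrite /St (Rint_avg h0 tv); last 2 first.
- exact: (measurableT_comp (@measurable_sinR R) (measurable_dot3l xi)).
- by move=> x; rewrite ler_norml sin_geN1 sin_le1.
rewrite -RintegralZl//; last exact: (rint_sin xi (tame_rint tv)).
by apply: eq_Rintegral => y _; rewrite avg_sin// mulrA.
Qed.

Lemma CtB u v xi : rint u -> rint v -> Ct (fun x => u x - v x) xi = Ct u xi - Ct v xi.
Proof.
move=> iu iv; rewrite /Ct -RintegralB//; [|exact: rint_cos|exact: rint_cos].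
by apply: eq_Rintegral => x _; rewrite mulrBr.
Qed.

Lemma StB u v xi : rint u -> rint v -> St (fun x => u x - v x) xi = St u xi - St v xi.
Proof.
move=> iu iv; rewrite /St -RintegralB//; [|exact: rint_sin|exact: rint_sin].
by apply: eq_Rintegral => x _; rewrite mulrBr.
Qed.

Lemma osc_plancherel h v : 0 < h -> tame v ->
  (((2 * pi) ^+ 3)%:E * \int[L]_x ((v x - avg h v x) ^+ 2)%:E <=
   \int[L]_xi ((1 - mult h xi) ^+ 2 * (Ct v xi ^+ 2 + St v xi ^+ 2))%:E)%E.
Proof.
move=> h0 tv; have ta := tame_avg h0 tv; have td := tameB tv ta.
have iv := tame_rint tv; have ia := tame_rint ta; have [_ [M vM] _ vU] := td.
apply: (le_trans (plancherel (tame_rint td) vM vU)).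
rewrite le_eqVlt; apply/orP; left; apply/eqP; apply: eq_integral => xi _.
by rewrite CtB// StB// Ct_avg// St_avg//; congr EFin; ring.
Qed.

Lemma norm_sin_le (t : R) : `|sin t| <= `|t|.
Proof.
have pos (u : R) : 0 <= u -> `|sin u| <= u.
  move=> u0; have [|c _] := @MVT_segment R sin cos 0 u u0 (fun (x : R) _ => is_derive_sin x).
    by apply: continuous_subspaceT; exact: continuous_sin.
  rewrite sin0 !subr0 => ->; rewrite normrM (ger0_norm u0) ler_piMl//.
  by rewrite ler_norml cos_geN1 cos_le1.
have [t0|t0] := leP 0 t; first by rewrite (ger0_norm t0) pos.
by rewrite -normrN -sinN (ltr0_norm t0) pos// oppr_ge0 ltW.
Qed.

Lemma one_minus_cos (t : R) : 1 - cos t <= t ^+ 2 / 2.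
Proof.
have e : cos t = 1 - 2 * sin (t / 2) ^+ 2.
  by rewrite {1}(splitr t) cosD -!expr2 cos2sin2; ring.
have : sin (t / 2) ^+ 2 <= (t / 2) ^+ 2.
  rewrite -(real_normK (num_real (sin _))) -(real_normK (num_real (t / 2))).
  by rewrite ler_pXn2r ?nnegrE//; exact: norm_sin_le.
rewrite e; lra.
Qed.

Lemma dot3_sqr_le x y : dot3 x y ^+ 2 <= eucl x ^+ 2 * eucl y ^+ 2.
Proof.
rewrite !eucl_sqr /dot3.
have := sqr_ge0 (x.1.1 * y.1.2 - x.1.2 * y.1.1).
have := sqr_ge0 (x.1.1 * y.2 - x.2 * y.1.1).
have := sqr_ge0 (x.1.2 * y.2 - x.2 * y.1.2).
lra.
Qed.

(** 1 - mult is the average of 1 - cos(z . xi) over the cube. There 1 - cos t <= t^2 / 2,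
    Cauchy-Schwarz and |z|^2 <= 3 h^2 give the factor 3/2, rounded up to 2. *)
Lemma mult_bounds h xi : 0 < h ->
  [/\ 0 <= 1 - mult h xi, 1 - mult h xi <= 2 & 1 - mult h xi <= 2 * (h * eucl xi) ^+ 2].
Proof.
move=> h0; have ik := rint_kern 0 h0; have ic := rint_kern_cos xi h0.
have k1 : \int[L]_z kern h 0 z = 1 by rewrite /Rintegral integral_kern1.
have e : 1 - mult h xi = \int[L]_z (kern h 0 z * (1 - cos (dot3 z xi))).
  rewrite -[X in X - _]k1 /mult -RintegralB//.
  by apply: eq_Rintegral => z _; rewrite mulrBr mulr1.
have i1 : rint (fun z => kern h 0 z * (1 - cos (dot3 z xi))).
  have := integrableB measurableT ik ic; apply: eq_integrable => // z _ /=.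
  by rewrite -EFinB mulrBr mulr1.
have up (B : R) : (forall z, cube 0 h z -> 1 - cos (dot3 z xi) <= B) -> 1 - mult h xi <= B.
  move=> hB; rewrite e; apply: (@le_trans _ _ (\int[L]_z (B * kern h 0 z))).
    apply: le_Rintegral => //; first exact: rintZ.
    move=> z _; rewrite mulrC kernE indicE.
    case: (boolP (z \in _)) => [|_]; last by rewrite !mulr0.
    by rewrite inE => hz; rewrite mulr1 ler_wpM2r ?hB// invr_ge0 mulr_ge0// exprn_ge0// (ltW h0).
  by rewrite RintegralZl// k1 mulr1.
split.
- rewrite e; apply: Rintegral_ge0 => z _; rewrite mulr_ge0 ?kern_ge0// subr_ge0 cos_le1.
- by apply: up => z _; have := cos_geN1 (dot3 z xi); lra.
- apply: up => z /cubeP/=; rewrite !subr0 => -[z1 z2 z3].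
  apply: (le_trans (one_minus_cos _)).
  have sq (a : R) : `|a| < h -> a ^+ 2 <= h ^+ 2.
    by move=> ah; rewrite -(real_normK (num_real a)) ler_pXn2r ?nnegrE// ltW.
  have ez : eucl z ^+ 2 <= 3 * h ^+ 2.
    by rewrite eucl_sqr; move: (sq _ z1) (sq _ z2) (sq _ z3); clear; lra.
  have := dot3_sqr_le z xi; have := ler_wpM2r (sqr_ge0 (eucl xi)) ez.
  rewrite exprMn; have := sqr_ge0 (eucl xi); have := sqr_ge0 h; clear; nra.
Qed.

Section DyadicSum.
Variable s : R.
Hypothesis hs : 1 / 2 <= s <= 3 / 2.

(* [Psi (2 t) - Psi t >= min t t^-1 / 6], so the dyadic sum telescopes. *)
Definition Psi (t : R) := t / (1 + t).

Lemma Psi_bounds t : 0 <= t -> 0 <= Psi t <= 1.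
Proof.
move=> t0; have p : 0 < 1 + t by rewrite ltr_pwDl.
by rewrite /Psi divr_ge0 ?(ltW p)//= ler_pdivrMr// mul1r lerDr.
Qed.

(** Put t = h X. For t <= 1, 2 s <= 3 and m <= 2 t^2 bound the scaled term by 4 t; for t > 1, 2 s >=
    1 and m <= 2 bound it by 4 / t. The increment of [Psi] is at least a sixth of t or of 1 / t,
    whence 24. *)
Lemma dyadic_term (h X m : R) : 0 < h -> 0 < X -> 0 <= m -> m <= 2 -> m <= 2 * (h * X) ^+ 2 ->
  h `^ (- (2 * s)) * m ^+ 2 <= 24 * X `^ (2 * s) * (Psi (2 * h * X) - Psi (h * X)).
Proof.
move=> h0 X0 m0 m2 mt; have t0 : 0 < h * X by rewrite mulr_gt0.
have /andP[s1 s2] := hs.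
have key : (h * X) `^ (- (2 * s)) * m ^+ 2 <= 24 * (Psi (2 * h * X) - Psi (h * X)).
  rewrite -(mulrA 2 h X); set t := h * X in t0 mt *.
  have [t1|t1] := leP t 1.
  - apply: (@le_trans _ _ (4 * t)).
      apply: (@le_trans _ _ (t `^ (- 3) * (2 * t ^+ 2) ^+ 2)).
        apply: ler_pM; rewrite ?powR_ge0 ?sqr_ge0//.
          by apply: ger_powR; [rewrite t0|lra].
        by rewrite ler_pXn2r ?nnegrE// mulr_ge0// sqr_ge0.
      rewrite (_ : t `^ (- 3) = t ^- 3); last by rewrite powRN powR_mulrn// ltW.
      rewrite le_eqVlt; apply/orP; left; apply/eqP; field; by rewrite gt_eqF.
    rewrite /Psi (_ : _ - _ = t / ((1 + 2 * t) * (1 + t))); last first.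
      by field; apply/andP; split; rewrite gt_eqF//; lra.
    rewrite mulrA ler_pdivlMr; last by apply: mulr_gt0; lra.
    have t6 : (1 + 2 * t) * (1 + t) <= 6 by clear - t0 t1; nra.
    have t4 : 0 <= 4 * t by clear - t0; lra.
    by have := ler_wpM2l t4 t6; clear; lra.
  - apply: (@le_trans _ _ (4 / t)).
      rewrite mulrC; apply: ler_pM; rewrite ?powR_ge0 ?sqr_ge0//; first nra.
      rewrite -powR_inv1 ?(ltW t0)// ler_powR ?(ltW t1)//; lra.
    rewrite /Psi (_ : _ - _ = t / ((1 + 2 * t) * (1 + t))); last first.
      by field; apply/andP; split; rewrite gt_eqF//; lra.
    rewrite mulrA ler_pdivlMr; last by apply: mulr_gt0; lra.
    rewrite mulrAC ler_pdivrMr//; nra.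
rewrite (_ : h `^ (- (2 * s)) = X `^ (2 * s) * (h * X) `^ (- (2 * s))); last first.
  rewrite powRM ?(ltW h0) ?(ltW X0)// mulrCA -powRDp// subrr powRr0 mulr1//.
by rewrite -(mulrA (X `^ (2 * s))) (mulrC 24) -(mulrA (X `^ (2 * s)) 24) ler_wpM2l ?powR_ge0.
Qed.

Lemma dyadic_sum (X : R) (m : R -> R) n : 0 <= X ->
  (forall h, 0 < h -> [/\ 0 <= m h, m h <= 2 & m h <= 2 * (h * X) ^+ 2]) ->
  \sum_(0 <= k < n) (dy k%:Z `^ (- (2 * s)) * m (dy k%:Z) ^+ 2 +
    dy (- k%:Z) `^ (- (2 * s)) * m (dy (- k%:Z)) ^+ 2) <= 48 * X `^ (2 * s).
Proof.
move=> X0 hm; have [X1|] := ltP 0 X; last first.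
  move=> X1; have X10 : X = 0 by apply/eqP; rewrite eq_le X1.
  rewrite big1 => [|k _]; first by rewrite mulr_ge0 ?powR_ge0.
  have z (z' : int) : m (dy z') = 0.
    have [a _] := hm _ (dy_gt0 R z'); rewrite X10 mulr0 expr0n/= mulr0 => b.
    by apply/eqP; rewrite eq_le b.
  by rewrite !z// expr0n/= !mulr0 addr0.
pose P (z : int) := Psi (dy z * X).
have term (z : int) : dy z `^ (- (2 * s)) * m (dy z) ^+ 2 <= 24 * X `^ (2 * s) * (P (z + 1) - P z).
  have [a b c] := hm _ (dy_gt0 R z); rewrite /P dyS; exact: dyadic_term (dy_gt0 R z) X1 a b c.
have c0 : 0 <= 24 * X `^ (2 * s) by rewrite mulr_ge0 ?powR_ge0.
(* The scales k and - k telescope separately, scale 0 being present in both sums. Each difference is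
   at most 1, which doubles 24 to 48. *)
apply: (@le_trans _ _ (24 * X `^ (2 * s) * (P n%:Z - P 0 + (P 1 - P (1 - n%:Z))))).
  elim: n => [|n IH].
    by rewrite big_nil subr0 !subrr addr0 mulr0.
  rewrite big_nat_recr//=; apply: (le_trans (lerD IH (lerD (term _) (term _)))).
  rewrite -!mulrDr ler_wpM2l//.
  have -> : (n.+1%:Z = n%:Z + 1)%R by rewrite -addn1 PoszD.
  have -> : (1 - (n%:Z + 1) = - n%:Z)%R by ring.
  rewrite (addrC (- n%:Z) 1); lra.
have B (z : int) : 0 <= P z <= 1 by apply: Psi_bounds; rewrite mulr_ge0 ?(ltW (dy_gt0 _ _)).
rewrite (_ : 48 * _ = 24 * X `^ (2 * s) * 2); last by ring.
rewrite ler_wpM2l//; have := B n%:Z; have := B 0; have := B 1; have := B (1 - n%:Z); lra.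
Qed.

(** Each scale becomes a multiplier by [osc_plancherel]; sum and integral are exchanged, and
    [dyadic_sum] is applied at every [xi] with X = |xi|. *)
Lemma Bnorm_plancherel v : tame v ->
  (((2 * pi) ^+ 3)%:E * Bnorm s v <=
   48%:E * \int[L]_xi (eucl xi `^ (2 * s) * (Ct v xi ^+ 2 + St v xi ^+ 2))%:E)%E.
Proof.
move=> tv; have iv := tame_rint tv; have mv := rint_meas iv.
have pi3 : 0 <= (2 * pi) ^+ 3 :> R by rewrite exprn_ge0// mulr_ge0// pi_ge0.
pose G xi := Ct v xi ^+ 2 + St v xi ^+ 2.
have G0 xi : 0 <= G xi by rewrite addr_ge0 ?sqr_ge0.
have mG : measurable_fun setT (G : M3 R -> R).
  by apply: measurable_funD; apply: measurable_funX; [exact: measurable_Ct|exact: measurable_St].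
have mm h : measurable_fun setT (mult h : M3 R -> R).
  have mg : measurable_fun setT (fun p : M3 R * M3 R => kern h 0 p.2 * cos (dot3 p.2 p.1)).
    apply: measurable_funM; first exact: measurableT_comp (measurable_kern h 0) measurable_snd.
    by apply: measurable_cos_dot; [exact: measurable_snd|exact: measurable_fst].
  exact: (@measurable_Rintegral2 _ _ _ _ _ L _ mg).
pose F (z : int) xi := dy z `^ (- (2 * s)) * (1 - mult (dy z) xi) ^+ 2 : R.
have F0 (z : int) xi : 0 <= F z xi by rewrite mulr_ge0 ?powR_ge0 ?sqr_ge0.
have mF (z : int) : measurable_fun setT (F z : M3 R -> R).
  by apply: measurable_funM => //; apply: measurable_funX; apply: measurable_funB.
have EF (z : int) : (((2 * pi) ^+ 3)%:E * \int[L]_x (Ek s v z x)%:E <= \int[L]_xi (F z xi * G xi)%:E)%E.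
  have := osc_plancherel (dy_gt0 R z) tv => h.
  have ma : measurable_fun setT (fun x : M3 R => (v x - avg (dy z) v x) ^+ 2).
    by apply: measurable_funX; apply: measurable_funB => //; exact: measurable_avg.
  have -> : (\int[L]_x (Ek s v z x)%:E = (dy z `^ (- (2 * s)))%:E *
      \int[L]_x ((v x - avg (dy z) v x) ^+ 2)%:E)%E.
    rewrite -ge0_integralZl_EFin ?powR_ge0//.
    - by move=> x _; rewrite lee_fin sqr_ge0.
    - exact/measurable_EFinP.
  have -> : (\int[L]_xi (F z xi * G xi)%:E = (dy z `^ (- (2 * s)))%:E *
      \int[L]_xi ((1 - mult (dy z) xi) ^+ 2 * G xi)%:E)%E.
    rewrite -ge0_integralZl_EFin ?powR_ge0//.
    - by apply: eq_integral => xi _; rewrite -EFinM mulrA.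
    - by move=> xi _; rewrite lee_fin mulr_ge0 ?sqr_ge0.
    - apply/measurable_EFinP; apply: measurable_funM => //.
      by apply: measurable_funX; apply: measurable_funB.
  by rewrite muleCA; apply: lee_wpmul2l => //; rewrite lee_fin powR_ge0.
have mE (z : int) : measurable_fun setT (Ek s v z : M3 R -> R) by exact: measurable_Ek.
have mFG (z : int) : measurable_fun setT (fun xi : M3 R => F z xi * G xi) by exact: measurable_funM.
rewrite /Bnorm /Bfun integral_nneseries//; last 2 first.
- by move=> k; apply/measurable_EFinP; apply: measurable_funD.
- by move=> k x _; rewrite lee_fin addr_ge0 ?Ek_ge0.
rewrite -nneseriesZl//; last first.
  by move=> k _; apply: integral_ge0 => x _; rewrite lee_fin addr_ge0 ?Ek_ge0.
apply: (@le_trans _ _ (\big[+%E/0%E]_(0 <= k <oo) \int[L]_xi ((F k%:Z xi + F (- k%:Z) xi) * G xi)%:E)%E).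
  apply: lee_nneseries.
    move=> k _; rewrite mule_ge0 ?lee_fin//.
    by apply: integral_ge0 => x _; rewrite lee_fin addr_ge0 ?Ek_ge0.
  move=> k _; under eq_integral do rewrite EFinD.
  rewrite ge0_integralD//; last 4 first.
  - by move=> x _; rewrite lee_fin Ek_ge0.
  - exact/measurable_EFinP.
  - by move=> x _; rewrite lee_fin Ek_ge0.
  - exact/measurable_EFinP.
  under [leRHS]eq_integral do rewrite mulrDl EFinD.
  rewrite ge0_integralD//; last 4 first.
  - by move=> x _; rewrite lee_fin mulr_ge0.
  - exact/measurable_EFinP.
  - by move=> x _; rewrite lee_fin mulr_ge0.
  - exact/measurable_EFinP.
  rewrite ge0_muleDr; last 2 first.
  - by apply: integral_ge0 => x _; rewrite lee_fin Ek_ge0.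
  - by apply: integral_ge0 => x _; rewrite lee_fin Ek_ge0.
  by apply: leeD.
rewrite -integral_nneseries//; last 2 first.
- by move=> k; apply/measurable_EFinP; apply: measurable_funM => //; apply: measurable_funD.
- by move=> k x _; rewrite lee_fin mulr_ge0// addr_ge0.
have mX : measurable_fun setT (fun xi : M3 R => eucl xi `^ (2 * s)).
  by apply: (measurableT_comp (measurable_powR _)); apply: measurable_eucl; exact: measurable_id.
rewrite -ge0_integralZl_EFin//; last 2 first.
- by move=> x _; rewrite lee_fin mulr_ge0 ?powR_ge0//; exact: G0.
- by apply/measurable_EFinP; exact: (measurable_funM mX mG).
apply: ge0_le_integral => //.
- by move=> x _; apply: nneseries_ge0 => k _ _; rewrite lee_fin mulr_ge0// addr_ge0.
- apply: ge0_emeasurable_sum.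
    by move=> k x _ _; rewrite lee_fin mulr_ge0// addr_ge0.
  by move=> k _; apply/measurable_EFinP; apply: measurable_funM => //; apply: measurable_funD.
- by apply: measurable_funeM; apply/measurable_EFinP; exact: (measurable_funM mX mG).
move=> xi _; apply: lime_le.
  by apply: is_cvg_nneseries => k _ _; rewrite lee_fin mulr_ge0// addr_ge0.
apply: nearW => n; rewrite sumEFin -EFinM lee_fin -mulr_suml mulrA ler_wpM2r//.
exact: (dyadic_sum n (eucl_ge0 xi) (fun h => @mult_bounds h xi)).
Qed.

End DyadicSum.
End Multiplier.

(** * Test functions *)

Section TestFunctionBound.
Variable R : realType.
Local Notation mu := (@lebesgue_measure R).
Local Notation L := (@leb3 R).
Implicit Types (x y z xi : R3 R).

Lemma ball_cube x (e : R) y : ball x e y <-> cube x e y.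
Proof.
rewrite cubeP; split.
  by move=> [[b1 b2] b3]; split; rewrite distrC.
by move=> [b1 b2 b3]; split; [split|]; rewrite /ball/= distrC.
Qed.

(** [M3] carries the product sigma-algebra, so an open set is exhibited as a countable union of
    cubes with rational centres and half-sides 1 / (n + 1). *)
Lemma open_measurable3 (U : set (R3 R)) : open U -> measurable (U : set (M3 R)).
Proof.
move=> oU.
pose B (a b c : rat) (n : nat) : set (M3 R) := cube (ratr a, ratr b, ratr c) n.+1%:R^-1.
pose F a b c n : set (M3 R) := if `[< B a b c n `<=` U >] then B a b c n else set0.
rewrite (_ : U = \bigcup_a \bigcup_b \bigcup_c \bigcup_n F a b c n).
  do 3 apply: bigcupT_measurable_rat => ?; apply: bigcupT_measurable => n.
  by rewrite /F; case: asboolP => // _; exact: measurable_cube.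
apply/seteqP; split => x; last first.
  by move=> [a _ [b _ [c _ [n _]]]]; rewrite /F; case: asboolP => // h; exact: h.
move=> Ux; have /nbhs_ballP[e /= e0 xe] : nbhs x U by exact: open_nbhs_nbhs.
have [n ne] : exists n : nat, n.+1%:R^-1 < e / 2.
  have e2 : 0 < e / 2 by rewrite divr_gt0.
  exists (Num.truncn (e / 2)^-1); rewrite invf_plt ?posrE//; first exact: truncnS_gt.
have n0 : (0 : R) < n.+1%:R^-1 by rewrite invr_gt0.
have rat_near (t : R) : exists q : rat, `|ratr q - t| < n.+1%:R^-1.
  have [q] : exists q : rat, ratr q \in `]t, t + n.+1%:R^-1[ by apply: rat_in_itvoo; rewrite ltrDl.
  rewrite in_itv/= => /andP[q1 q2]; exists q; rewrite gtr0_norm ?subr_gt0// ltrBlDl; exact: q2.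
have [a aP] := rat_near x.1.1; have [b bP] := rat_near x.1.2; have [c cP] := rat_near x.2.
exists a => //; exists b => //; exists c => //; exists n => //.
have Bx : B a b c n x by apply/cubeP => /=; split; rewrite distrC.
rewrite /F; case: asboolP => // -[] y /cubeP/= [y1 y2 y3].
apply: xe; apply/ball_cube/cubeP.
have tri (u v w : R) : `|u - v| < n.+1%:R^-1 -> `|w - u| < n.+1%:R^-1 -> `|w - v| < e.
  move=> uv wu; rewrite (_ : w - v = (w - u) + (u - v)); last by ring.
  by rewrite (le_lt_trans (ler_normD _ _))// (lt_trans (ltrD wu uv))// (splitr e) ltrD.
by split; [exact: tri aP y1|exact: tri bP y2|exact: tri cP y3].
Qed.

Lemma continuous_measurable3 (f : R3 R -> R) : continuous f ->
  measurable_fun setT (f : M3 R -> R).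
Proof.
move=> cf mD; apply: (measurability _ (RGenOInfty.measurableE R)) => //.
move=> /= _ [_ [a ->] <-]; rewrite setTI; apply: open_measurable3.
apply: open_comp; last exact: interval_open.
by move=> x _; exact: cf.
Qed.

Lemma compact_sub_cube (K : set (R3 R)) : compact K ->
  exists2 r : R, 0 < r & K `<=` cube 0 r.
Proof.
move=> /compact_bounded[M [_ MK]]; exists (`|M| + 2); first by rewrite ltr_wpDl.
move=> x Kx; have := MK (`|M| + 1) _ x Kx; rewrite /= => /(_ ltac:(have := ler_norm M; lra)).
rewrite !prod_normE !ge_max => /andP[/andP[a b] c].
by apply/cubeP => /=; rewrite !subr0; split; rewrite ?(le_lt_trans a) ?(le_lt_trans b) ?(le_lt_trans c)// ltrD2l; lra.
Qed.

(** Heine-Cantor: the near-covering form of compactness makes the local moduli at points of [K]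
    uniform. *)
Lemma compact_unif_mod (f : R3 R -> R) (K : set (R3 R)) : continuous f -> compact K ->
  (forall x, ~ K x -> f x = 0) -> unif_mod f.
Proof.
move=> cf cK fK eta eta0.
have e20 : 0 < eta / 2 by rewrite divr_gt0.
have loc x : K x ->
    \forall x' \near x & z \near nbhs (0 : R3 R), `|f (x' + z) - f x'| <= eta.
  move=> Kx.
  have /nbhs_ballP[e /= e0 fe] : nbhs x [set y | `|f x - f y| < eta / 2].
    by have /cvgrPdist_lt/(_ _ e20) := cf x.
  have eh : 0 < e / 2 by rewrite divr_gt0.
  exists (ball x (e / 2), ball (0 : R3 R) (e / 2)).
    by split; exact: nbhsx_ballx.
  move=> [y z] /= [xy z0].
  have h1 : `|f x - f y| < eta / 2 by apply: fe; apply: le_ball xy; lra.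
  have h2 : `|f x - f (y + z)| < eta / 2.
    apply: fe; move: xy z0; rewrite !ball_cube !cubeP/= !subr0 => -[a1 a2 a3] [b1 b2 b3].
    have tri (u v w : R) : `|u - v| < e / 2 -> `|w| < e / 2 -> `|u + w - v| < e.
      move=> uv w2; rewrite (_ : u + w - v = (u - v) + w); last by ring.
      rewrite (le_lt_trans (ler_normD _ _))//; lra.
    by split; [exact: tri a1 b1|exact: tri a2 b2|exact: tri a3 b3].
  rewrite distrC (_ : _ - _ = (f x - f (y + z)) - (f x - f y)); last by ring.
  rewrite (le_trans (ler_normB _ _))//; lra.
have cov := iffLR (compact_near_coveringP K) cK _ (nbhs (0 : R3 R))
  (fun z x => `|f (x + z) - f x| <= eta) (nbhs_filter _) loc.
have /nbhs_ballP[d /= d0 dcov] := cov; exists d => // x z dz.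
have [Kx|nKx] := pselect (K x); first by apply: dcov Kx; apply/ball_cube.
rewrite (fK x)//; have [Kxz|nKxz] := pselect (K (x + z)); last by rewrite (fK (x + z))// subrr normr0 ltW.
have /dcov : ball 0 d (- z).
  by apply/ball_cube; move: dz; rewrite !cubeP/= !subr0 !normrN.
by move=> /(_ _ Kxz) /=; rewrite addrK (fK x)// distrC.
Qed.

Lemma tame_continuous (f : R3 R -> R) (K : set (R3 R)) : continuous f -> compact K ->
  (forall x, ~ K x -> f x = 0) -> tame f.
Proof.
move=> cf cK fK; split.
- exact: continuous_measurable3.
- have /compact_bounded[M [_ MK]] : compact (f @` K).
    by apply: continuous_compact => //; exact: continuous_subspaceT.
  exists (`|M| + 1) => x; have [Kx|nKx] := pselect (K x).
    by apply: MK; [have := ler_norm M; lra|exists x].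
  by rewrite fK// normr0 addr_ge0.
- by have [r r0 Kr] := compact_sub_cube cK; exists r => // x nx; apply: fK => /Kr.
- exact: compact_unif_mod cf cK fK.
Qed.

Lemma test_tame (u : R3 R -> R[i]) : test_function u ->
  tame (fun x => complex.Re (u x)) /\ tame (fun x => complex.Im (u x)).
Proof.
move=> [sr si cK]; have z x : ~ closure [set x | u x != 0] x -> u x = 0.
  by move=> nx; apply/eqP; apply: contrapT => /negP ux; apply: nx; exact: subset_closure.
split; (apply: (tame_continuous _ cK); [|by move=> x /z ->]).
- by have := sr 0%N => -[].
- by have := si 0%N => -[].
Qed.

Lemma test_support (u : R3 R -> R[i]) : test_function u ->
  exists2 r : R, 0 < r & forall x, ~ cube 0 r x -> u x = 0.
Proof.
move=> [_ _ cK]; have [r r0 Kr] := compact_sub_cube cK; exists r => // x nx.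
by apply/eqP; apply: contrapT => /negP ux; apply: nx; apply: Kr; exact: subset_closure.
Qed.

Lemma cabs_sqr (z : R[i]) : cabs z ^+ 2 = complex.Re z ^+ 2 + complex.Im z ^+ 2.
Proof. by case: z => a b; rewrite /cabs/= sqr_sqrtr// addr_ge0 ?sqr_ge0. Qed.

Lemma cabs_ge0 (z : R[i]) : 0 <= cabs z.
Proof. by case: z => a b; exact: sqrtr_ge0. Qed.

Section Fourier.
Variable u : R3 R -> R[i].
Hypothesis tu : tame (fun x => complex.Re (u x)) /\ tame (fun x => complex.Im (u x)).
Let a x := complex.Re (u x).
Let b x := complex.Im (u x).

Lemma fourier_sqr xi : cabs (fourier u xi) ^+ 2 =
  (2 * pi) ^- 3 * ((Ct a xi + St b xi) ^+ 2 + (Ct b xi - St a xi) ^+ 2).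
Proof.
have [/tame_rint ia /tame_rint ib] := tu.
have p0 : 0 <= 2 * pi :> R by rewrite mulr_ge0// pi_ge0.
have reE : \int[L]_x complex.Re ((Complex (cos (dot3 x xi)) (- sin (dot3 x xi))) * u x) = Ct a xi + St b xi.
  rewrite /Ct /St -RintegralD//; [|exact: rint_cos|exact: rint_sin].
  by apply: eq_Rintegral => x _; rewrite /a /b; case: (u x) => c d /=; rewrite mulNr opprK.
have imE : \int[L]_x complex.Im ((Complex (cos (dot3 x xi)) (- sin (dot3 x xi))) * u x) = Ct b xi - St a xi.
  rewrite /Ct /St -RintegralB//; [|exact: rint_cos|exact: rint_sin].
  by apply: eq_Rintegral => x _; rewrite /a /b; case: (u x) => c d /=; rewrite mulNr.
rewrite /fourier /cintegral reE imE cabs_sqr /= !mul0r subr0 addr0 !exprMn -mulrDr; congr (_ * _).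
by rewrite exprVn -exprM (mulnC 3 2) exprM sqr_sqrtr// exprMn.
Qed.

Lemma half_adde (I : \bar R) : I = ((2^-1)%:E * (I + I))%E.
Proof.
have h : (0 < (2^-1)%:E :> \bar R)%E by rewrite lte_fin invr_gt0.
case: I => [r| |].
- by rewrite -EFinD -EFinM; congr EFin; lra.
- by change (+oo = (2^-1)%:E * +oo :> \bar R)%E; rewrite gt0_muley.
- by change (-oo = (2^-1)%:E * -oo :> \bar R)%E; rewrite gt0_muleNy.
Qed.

Lemma integral_even_part (F : R3 R -> R) : measurable_fun setT (F : M3 R -> R) ->
  (forall x, 0 <= F x) ->
  (\int[L]_x (F x)%:E = \int[L]_x (2^-1 * (F x + F (- x)))%:E)%E.
Proof.
move=> mF F0; have [mN iN] := @mpres_opp R.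
have mFN : measurable_fun setT (fun x : M3 R => F (- x)) by exact: measurableT_comp mF mN.
rewrite [LHS]half_adde -{2}(iN (fun x => (F x)%:E))//; last exact/measurable_EFinP.
rewrite -ge0_integralD//; last 4 first.
- by move=> x _; rewrite lee_fin.
- exact/measurable_EFinP.
- by move=> x _; rewrite lee_fin.
- exact/measurable_EFinP.
rewrite -ge0_integralZl_EFin//.
- by move=> x _; rewrite adde_ge0 ?lee_fin.
- by apply: emeasurable_funD; exact/measurable_EFinP.
Qed.

Lemma CtN v xi : Ct v (- xi) = Ct v xi.
Proof. by apply: eq_Rintegral => x _; rewrite dot3Nr cosN. Qed.

Lemma StN v xi : rint v -> St v (- xi) = - St v xi.
Proof.
move=> iv; transitivity (-1 * St v xi); last by rewrite mulN1r.
rewrite /St -RintegralZl//; last exact: rint_sin.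
by apply: eq_Rintegral => x _; rewrite dot3Nr sinN mulNr mulN1r.
Qed.

Lemma euclN x : eucl (- x) = eucl x.
Proof. by rewrite /eucl dot3Nl dot3Nr opprK. Qed.

(* The reflection xi -> -xi removes the cross terms between the real and the
   imaginary part. *)
Lemma Bnorm_test (s : R) : 1 / 2 <= s <= 3 / 2 ->
  (Bnorm s a <= 48%:E * \int[L]_xi (eucl xi `^ (2 * s) * cabs (fourier u xi) ^+ 2)%:E)%E /\
  (Bnorm s b <= 48%:E * \int[L]_xi (eucl xi `^ (2 * s) * cabs (fourier u xi) ^+ 2)%:E)%E.
Proof.
move=> hs; have [ta tb] := tu.
have ia := tame_rint ta; have ib := tame_rint tb.
have ma := rint_meas ia; have mb := rint_meas ib.
have p0 : 0 < (2 * pi) ^+ 3 :> R by rewrite exprn_gt0// mulr_gt0// pi_gt0.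
have mX : measurable_fun setT (fun xi : M3 R => eucl xi `^ (2 * s)).
  by apply: (measurableT_comp (measurable_powR _)); apply: measurable_eucl; exact: measurable_id.
pose E xi := (Ct a xi + St b xi) ^+ 2 + (Ct b xi - St a xi) ^+ 2.
have E0 xi : 0 <= E xi by rewrite addr_ge0 ?sqr_ge0.
have mE : measurable_fun setT (E : M3 R -> R).
  apply: measurable_funD; apply: measurable_funX.
    by apply: measurable_funD; [exact: measurable_Ct|exact: measurable_St].
  by apply: measurable_funB; [exact: measurable_Ct|exact: measurable_St].
pose XE xi := eucl xi `^ (2 * s) * E xi.
have XE0 xi : 0 <= XE xi by rewrite mulr_ge0 ?powR_ge0.
have mXE : measurable_fun setT (XE : M3 R -> R) by exact: measurable_funM.
have -> : (\int[L]_xi (eucl xi `^ (2 * s) * cabs (fourier u xi) ^+ 2)%:E =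
    ((2 * pi) ^- 3)%:E * \int[L]_xi (XE xi)%:E)%E.
  rewrite -ge0_integralZl_EFin//.
  - apply: eq_integral => xi _; rewrite fourier_sqr -EFinM; congr EFin.
    by rewrite mulrCA.
  - by move=> xi _; rewrite lee_fin.
  - exact/measurable_EFinP.
  - by rewrite invr_ge0 ltW.
have mXEN : measurable_fun setT (fun xi : M3 R => XE (- xi)).
  exact: measurableT_comp mXE (@mpres_opp R).1.
(* E xi + E (- xi) is twice the sum of the energies of [a] and [b]; the hypothesis keeps one of
   them. *)
have main v : tame v -> (forall xi, 2 * (Ct v xi ^+ 2 + St v xi ^+ 2) <= E xi + E (- xi)) ->
    (Bnorm s v <= 48%:E * (((2 * pi) ^- 3)%:E * \int[L]_xi (XE xi)%:E))%E.
  move=> tv h; have := Bnorm_plancherel hs tv.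
  have mv := rint_meas (tame_rint tv).
  have mG : measurable_fun setT (fun xi : M3 R => eucl xi `^ (2 * s) * (Ct v xi ^+ 2 + St v xi ^+ 2)).
    exact: (measurable_funM mX (measurable_funD (measurable_funX 2 (measurable_Ct mv))
      (measurable_funX 2 (measurable_St mv)))).
  have le : (\int[L]_xi (eucl xi `^ (2 * s) * (Ct v xi ^+ 2 + St v xi ^+ 2))%:E <=
      \int[L]_xi (XE xi)%:E)%E.
    rewrite (integral_even_part mXE XE0).
    apply: ge0_le_integral => //.
    - by move=> xi _; rewrite lee_fin mulr_ge0 ?powR_ge0// addr_ge0 ?sqr_ge0.
    - exact/measurable_EFinP.
    - by apply/measurable_EFinP; apply: measurable_funM => //; exact: measurable_funD.
    - move=> xi _; rewrite lee_fin /XE euclN -mulrDr mulrCA ler_wpM2l ?powR_ge0//.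
      by have := h xi; lra.
  move=> H; rewrite muleCA; rewrite -(@lee_pmul2l _ ((2 * pi) ^+ 3)%:E)// ?lte_fin//.
  rewrite muleA -EFinM mulfV ?gt_eqF// mul1e; apply: (le_trans H).
  by apply: lee_wpmul2l.
split; apply: main => // xi; rewrite /E !CtN !StN//; nra.
Qed.

End Fourier.
End TestFunctionBound.

(** * Lower semicontinuity of the Besov norm *)

Section Semicontinuity.
Variable R : realType.
Local Notation mu := (@lebesgue_measure R).
Local Notation L := (@leb3 R).
Implicit Types (f g a : R3 R -> R) (x y z : R3 R) (s q : R).

Lemma Ek_split q s f a (z : int) x : 1 <= q -> Lq q f -> Lq q a ->
  Ek s f z x <= 2 * (Ek s a z x + Ek s (fun y => f y - a y) z x).
Proof.
move=> q1 fq aq; rewrite /Ek avgB; [|exact: Lq_kern_integrable q1 (dy_gt0 _ _) fq|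
  exact: Lq_kern_integrable q1 (dy_gt0 _ _) aq].
set c := _ `^ _; have c0 : 0 <= c by exact: powR_ge0.
rewrite -mulrDr [leRHS]mulrCA ler_wpM2l//.
move: (f x) (a x) (avg _ f x) (avg _ a x) => u v p r.
have := sqr_ge0 ((v - r) - (u - v - (p - r))); lra.
Qed.

(** On a bounded set a small L^q norm with q >= 2 forces a small L^2 norm: [young_split] at exponent
    q / 2 handles g^2, and [avg_young] makes the averages uniformly small. *)
Lemma Ek_local_small q s (z : int) (r eps : R) : 2 <= q -> 0 < r -> 0 < eps ->
  exists2 d : R, 0 < d & forall g, measurable_fun setT (g : M3 R -> R) ->
    (\int[L]_x (`|g x| `^ q)%:E <= d%:E)%E ->
    (\int[L]_(x in cube 0%R r) (Ek s g z x)%:E <= eps%:E)%E.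
Proof.
move=> q2 r0 e0; set h := dy z : R; have h0 : 0 < h by exact: dy_gt0.
pose c : R := h `^ (- (2 * s)); have c0 : 0 < c by rewrite powR_gt0.
pose V := 8 * r ^+ 3; have V0 : 0 < V by rewrite mulr_gt0 ?exprn_gt0.
pose D := 2 * c * (5 * V + 1).
have D0 : 0 < D by rewrite mulr_gt0 ?mulr_gt0// ltr_wpDl// mulr_ge0// ltW.
(* This form yields both eta <= 1 and D eta <= eps, where D eta bounds the final sum. *)
pose eta := eps / (D + eps).
have De : 0 < D + eps by exact: addr_gt0.
have eta0 : 0 < eta by rewrite divr_gt0.
have eta1 : eta <= 1 by rewrite ler_pdivrMr// mul1r lerDr ltW.
have Deta : D * eta <= eps.
  by rewrite /eta mulrA ler_pdivrMr// mulrC ler_wpM2l ?(ltW e0)// lerDl ltW.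
pose H := 8 * h ^+ 3; have H0 : 0 < H by rewrite mulr_gt0 ?exprn_gt0.
(* The factor 1 in the minimum serves the bound on g^2, the cube volume [H] the bound on the
   averages. *)
exists (eta `^ q * Num.min 1 H).
  by rewrite mulr_gt0 ?powR_gt0// lt_min ltr01.
set d := _ * _ => g mg gd.
have d1 : d <= eta `^ (q / 2).
  apply: (@le_trans _ _ (eta `^ q * 1)).
    by rewrite ler_wpM2l ?powR_ge0// ge_min lexx.
  by rewrite mulr1; apply: ger_powR; [rewrite eta0|lra].
have d2 : d <= eta `^ q * H.
  by rewrite ler_wpM2l ?powR_ge0// ge_min lexx orbT.
have avg_small x : `|avg h g x| <= 2 * eta.
  have q1 : 1 <= q by lra.
  apply: (le_trans (avg_young q1 eta0 h0 mg (le_integral_cube x h mg gd))).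
  rewrite (_ : 2 * eta = eta + eta); last by ring.
  rewrite lerD2l -/H.
  apply: (@le_trans _ _ (eta `^ (1 - q) * (eta `^ q * H / H))).
    by rewrite ler_wpM2l ?powR_ge0// ler_wpM2r// invr_ge0 ltW.
  by rewrite mulfK ?gt_eqF// -powRDp// subrK powRr1// ltW.
pose B := eta `^ (1 - q / 2).
have pw x : Ek s g z x <= 2 * c * (eta + 4 * eta ^+ 2) + 2 * c * B * `|g x| `^ q.
  rewrite /Ek -/h -/c.
  have g2 : g x ^+ 2 <= eta + B * `|g x| `^ q.
    have q21 : 1 <= q / 2 by lra.
    have := young_split q21 eta0 (sqr_ge0 (g x)).
    rewrite -(real_normK (num_real (g x))) -(powR_mulrn 2 (normr_ge0 (g x))) -powRrM.
    by rewrite /B (_ : 2 * (q / 2) = q)//; field.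
  have a2 : avg h g x ^+ 2 <= 4 * eta ^+ 2.
    rewrite -(real_normK (num_real (avg h g x))).
    rewrite (_ : 4 * eta ^+ 2 = (2 * eta) ^+ 2); last by ring.
    by rewrite ler_pXn2r ?nnegrE// mulr_ge0// ltW.
  rewrite (_ : 2 * c * _ + _ = c * (2 * (4 * eta ^+ 2 + (eta + B * `|g x| `^ q)))); last by ring.
  rewrite ler_wpM2l ?(ltW c0)//.
  have sq := sqr_ge0 (g x + avg h g x).
  by move: (B * _) g2 => T g2; clear - g2 a2 sq; lra.
have B0 : 0 <= B by exact: powR_ge0.
have c2 : 0 <= 2 * c by rewrite mulr_ge0// ltW.
have mE : measurable_fun setT (Ek s g z : M3 R -> R) by exact: measurable_Ek.
have mp : measurable_fun setT (fun x : M3 R => `|g x| `^ q) by exact: measurable_powR_norm.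
have Ap : 0 <= 2 * c * (eta + 4 * eta ^+ 2).
  by rewrite mulr_ge0// addr_ge0 ?(ltW eta0)// mulr_ge0// sqr_ge0.
apply: (@le_trans _ _ (\int[L]_(x in cube 0%R r) ((2 * c * (eta + 4 * eta ^+ 2))%:E + (2 * c * B)%:E * (`|g x| `^ q)%:E))%E).
  apply: ge0_le_integral => //.
  - exact: measurable_cube.
  - by move=> x _; rewrite lee_fin Ek_ge0.
  - by apply: measurable_funTS; exact/measurable_EFinP.
  - apply: measurable_funTS; apply: emeasurable_funD => //; apply: measurable_funeM.
    exact/measurable_EFinP.
  - by move=> x _; rewrite -EFinM -EFinD lee_fin.
rewrite ge0_integralD//; last 3 first.
- exact: measurable_cube.
- by move=> x _; rewrite -EFinM lee_fin !mulr_ge0 ?powR_ge0 ?(ltW c0).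
- by apply: measurable_funTS; apply: measurable_funeM; exact/measurable_EFinP.
rewrite integral_cst ?ge0_integralZl_EFin//; last 4 first.
- exact: measurable_cube.
- by apply: measurable_funTS; exact/measurable_EFinP.
- by rewrite mulr_ge0.
- exact: measurable_cube.
rewrite [X in (_ * X + _)%E](_ : _ = V%:E); last exact: leb3_cube.
have h1 := le_integral_cube 0%R r mg gd.
apply: (le_trans (leeD2l _ (lee_wpmul2l _ h1))); first by rewrite lee_fin mulr_ge0.
rewrite -!EFinM -EFinD lee_fin; apply: le_trans Deta.
have Bd : B * d <= eta.
  apply: (@le_trans _ _ (eta `^ (1 - q / 2) * eta `^ (q / 2))); first by rewrite ler_wpM2l.
  by rewrite -powRDp// subrK powRr1// ltW.
have e2 : eta ^+ 2 <= eta by rewrite expr2 ler_piMl ?(ltW eta0).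
rewrite [leLHS](_ : _ = 2 * c * ((eta + 4 * eta ^+ 2) * V + B * d)); last by ring.
rewrite (_ : D * eta = 2 * c * ((eta + 4 * eta) * V + eta)); last by rewrite /D; ring.
by rewrite ler_wpM2l// lerD// ler_wpM2r ?(ltW V0)// lerD2l ler_wpM2l.
Qed.

Definition Bpart s f n x : R :=
  \sum_(0 <= k < n) (Ek s f k%:Z x + Ek s f (- k%:Z) x).

Lemma Bpart_ge0 s f n x : 0 <= Bpart s f n x.
Proof. by apply: sumr_ge0 => k _; rewrite addr_ge0 ?Ek_ge0. Qed.

Lemma measurable_Bpart s f n : measurable_fun setT (f : M3 R -> R) ->
  measurable_fun setT (Bpart s f n : M3 R -> R).
Proof.
move=> mf; apply: measurable_sum => k.
by apply: measurable_funD; exact: measurable_Ek.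
Qed.

Lemma Bpart_le_Bfun s f n x : ((Bpart s f n x)%:E <= Bfun s f x)%E.
Proof.
have := @nneseries_lim_ge R (fun k : nat => (Ek s f k%:Z x + Ek s f (- k%:Z) x)%:E) xpredT 0 n
  (fun (k : nat) _ _ => (_ : (0 <= _)%E)).
by rewrite sumEFin; apply => k; rewrite lee_fin addr_ge0 ?Ek_ge0.
Qed.

Lemma Bpart_local_small q s (n : nat) (r eps : R) : 2 <= q -> 0 < r -> 0 < eps ->
  exists2 d : R, 0 < d & forall g, measurable_fun setT (g : M3 R -> R) ->
    (\int[L]_x (`|g x| `^ q)%:E <= d%:E)%E ->
    (\int[L]_(x in cube 0%R r) (Bpart s g n x)%:E <= eps%:E)%E.
Proof.
move=> q2 r0; elim: n eps => [|n IH] eps e0.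
  exists 1 => // g mg _; rewrite integral0_eq ?lee_fin ?(ltW e0)// => x _.
  by rewrite /Bpart big_nil.
have e3 : 0 < eps / 3 by rewrite divr_gt0.
have [d1 d10 H1] := IH _ e3.
have [d2 d20 H2] := Ek_local_small s n%:Z q2 r0 e3.
have [d3 d30 H3] := Ek_local_small s (- n%:Z) q2 r0 e3.
exists (Num.min d1 (Num.min d2 d3)); first by rewrite !lt_min d10 d20.
move=> g mg gd; have [gd1 gd2 gd3] : [/\ (\int[L]_x (`|g x| `^ q)%:E <= d1%:E)%E,
    (\int[L]_x (`|g x| `^ q)%:E <= d2%:E)%E & (\int[L]_x (`|g x| `^ q)%:E <= d3%:E)%E].
  by split; apply: (le_trans gd); rewrite lee_fin !ge_min lexx ?orbT.
have mE (z : int) : measurable_fun (cube 0%R r) (fun x : M3 R => (Ek s g z x)%:E).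
  by apply: measurable_funTS; apply/measurable_EFinP; exact: measurable_Ek.
rewrite (eq_integral (fun x : M3 R => (Bpart s g n x)%:E + ((Ek s g n%:Z x)%:E + (Ek s g (- n%:Z) x)%:E))%E); last first.
  by move=> x _; rewrite /Bpart big_nat_recr//= !EFinD.
have mB : measurable_fun (cube 0%R r) (fun x : M3 R => (Bpart s g n x)%:E).
  by apply: measurable_funTS; apply/measurable_EFinP; exact: measurable_Bpart.
rewrite ge0_integralD//; last 4 first.
- exact: measurable_cube.
- by move=> x _; rewrite lee_fin Bpart_ge0.
- by move=> x _; rewrite adde_ge0// lee_fin Ek_ge0.
- exact: emeasurable_funD.
rewrite ge0_integralD//; last 3 first.
- exact: measurable_cube.
- by move=> x _; rewrite lee_fin Ek_ge0.
- by move=> x _; rewrite lee_fin Ek_ge0.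
apply: (le_trans (leeD (H1 g mg gd1) (leeD (H2 g mg gd2) (H3 g mg gd3)))).
by rewrite -!EFinD lee_fin; clear; lra.
Qed.

(* The factor 2 spares the extraction of an almost everywhere convergent
   subsequence: [Ek_split] reduces the claim to the smallness of finitely many
   terms of [f - a] on a cube. *)
Lemma Bnorm_lsc q s f (B : \bar R) : 2 <= q -> Lq q f -> (0 <= B)%E ->
  (forall eps : R, 0 < eps -> exists a, [/\ Lq q a, (Bnorm s a <= B)%E &
     (\int[L]_x (`|f x - a x| `^ q)%:E <= eps%:E)%E]) ->
  (Bnorm s f <= 2%:E * B)%E.
Proof.
move=> q2 fq B0 approx; have q1 : 1 <= q by lra.
have mf := fq.1.
have loc (n : nat) : (\int[L]_(x in cube 0%R n.+1%:R) (Bpart s f n x)%:E <= 2%:E * B)%E.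
  apply/lee_addgt0Pr => eps e0.
  have n0 : (0 : R) < n.+1%:R by [].
  have e2 : 0 < eps / 2 by rewrite divr_gt0.
  have [d d0 Hd] := Bpart_local_small s n q2 n0 e2.
  have [a [aq aB ad]] := approx _ d0; have ma := aq.1.
  have mg : measurable_fun setT ((fun x => f x - a x) : M3 R -> R) by exact: measurable_funB.
  have gd := Hd _ mg ad.
  have mBp (u : R3 R -> R) : measurable_fun setT (u : M3 R -> R) ->
      measurable_fun (cube 0%R n.+1%:R) (fun x : M3 R => (Bpart s u n x)%:E).
    by move=> mu_; apply: measurable_funTS; apply/measurable_EFinP; exact: measurable_Bpart.
  apply: (@le_trans _ _ (\int[L]_(x in cube 0%R n.+1%:R) (2%:E * ((Bpart s a n x)%:E + (Bpart s (fun x => f x - a x) n x)%:E)))%E).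
    apply: ge0_le_integral => //.
    - exact: measurable_cube.
    - by move=> x _; rewrite lee_fin Bpart_ge0.
    - exact: mBp.
    - by apply: measurable_funeM; apply: emeasurable_funD; exact: mBp.
    - move=> x _; rewrite -EFinD -EFinM lee_fin /Bpart -big_split/= mulr_sumr.
      apply: ler_sum => k _.
      have := Ek_split s k%:Z x q1 fq aq; have := Ek_split s (- k%:Z) x q1 fq aq; clear; lra.
  rewrite ge0_integralZl_EFin//; last 3 first.
  - exact: measurable_cube.
  - by move=> x _; rewrite adde_ge0// lee_fin Bpart_ge0.
  - by apply: emeasurable_funD; exact: mBp.
  rewrite ge0_integralD//; last 5 first.
  - exact: measurable_cube.
  - by move=> x _; rewrite lee_fin Bpart_ge0.
  - exact: mBp.
  - by move=> x _; rewrite lee_fin Bpart_ge0.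
  - exact: mBp.
  rewrite ge0_muleDr; last 2 first.
  - by apply: integral_ge0 => x _; rewrite lee_fin Bpart_ge0.
  - by apply: integral_ge0 => x _; rewrite lee_fin Bpart_ge0.
  apply: leeD.
    apply: lee_wpmul2l => //; apply: le_trans aB.
    apply: (@le_trans _ _ (\int[L]_x (Bpart s a n x)%:E)%E).
      apply: ge0_subset_integral => //.
      - exact: measurable_cube.
      - by apply/measurable_EFinP; exact: measurable_Bpart.
      - by move=> x _; rewrite lee_fin Bpart_ge0.
    apply: ge0_le_integral => //.
    - by move=> x _; rewrite lee_fin Bpart_ge0.
    - by apply/measurable_EFinP; exact: measurable_Bpart.
    - exact: measurable_Bfun.
    - by move=> x _; exact: Bpart_le_Bfun.
  apply: (le_trans (lee_wpmul2l _ gd)) => //.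
  by rewrite -EFinM lee_fin mulrC divfK.
(* The number of scales and the cube grow together, so monotone convergence recovers the whole norm
   from [loc]. *)
pose G (n : nat) x := (((fun x => (Bpart s f n x)%:E) \_ (cube 0%R n.+1%:R)) x : \bar R).
have G0 (n : nat) x : (0 <= G n x)%E by rewrite /G patchE; case: ifP => // _; rewrite lee_fin Bpart_ge0.
have mG n : measurable_fun setT (G n : M3 R -> \bar R).
  apply/(measurable_restrictT _ (measurable_cube _ _)); apply: measurable_funTS.
  by apply/measurable_EFinP; exact: measurable_Bpart.
have Gnd x : {homo G^~ x : m n / (m <= n)%N >-> (m <= n)%E}.
  move=> m n mn; rewrite /G !patchE; case: ifPn => [xm|_]; last first.
    by case: ifP => // _; rewrite lee_fin Bpart_ge0.
  rewrite ifT; last first.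
    move: xm; rewrite !inE => /cubeP[x1 x2 x3]; apply/cubeP.
    have le : m.+1%:R <= n.+1%:R :> R by rewrite ler_nat ltnS.
    by split; [exact: lt_le_trans x1 le|exact: lt_le_trans x2 le|exact: lt_le_trans x3 le].
  rewrite lee_fin /Bpart [leRHS](big_cat_nat (n := m))//= lerDl.
  by apply: sumr_ge0 => k _; rewrite addr_ge0 ?Ek_ge0.
have Gcvg x : G n x @[n --> \oo] --> Bfun s f x.
  have c : (\sum_(0 <= k < n) (Ek s f k%:Z x + Ek s f (- k%:Z) x)%:E)%E @[n --> \oo] --> Bfun s f x.
    by apply: is_cvg_nneseries => k _ _; rewrite lee_fin addr_ge0 ?Ek_ge0.
  apply: cvg_trans c; apply: near_eq_cvg.
  have [N HN] : exists N : nat, cube 0%R N%:R x.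
    exists (Num.truncn (Num.max `|x.1.1| (Num.max `|x.1.2| `|x.2|))).+1.
    have := truncnS_gt (Num.max `|x.1.1| (Num.max `|x.1.2| `|x.2|)).
    by rewrite !gt_max => /and3P[a b c']; apply/cubeP => /=; rewrite !subr0.
  exists N => // n /= Nn; rewrite /G patchE ifT ?sumEFin//.
  move: HN => /cubeP[x1 x2 x3]; rewrite inE; apply/cubeP.
  have le : N%:R <= n.+1%:R :> R by rewrite ler_nat leqW.
  by split; [exact: lt_le_trans x1 le|exact: lt_le_trans x2 le|exact: lt_le_trans x3 le].
have -> : Bnorm s f = (\int[L]_x limn (G^~ x))%E.
  by apply: eq_integral => x _; apply/esym/cvg_lim.
rewrite monotone_convergence//.
apply: lime_le.
  apply: ereal_nondecreasing_is_cvgn => m n mn; apply: ge0_le_integral => //.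
  by move=> x _; exact: Gnd.
by apply: nearW => n; rewrite -integral_mkcond; exact: loc.
Qed.

End Semicontinuity.

(** * The embedding *)

Section Embedding.
Variable R : realType.
Local Notation mu := (@lebesgue_measure R).
Local Notation L := (@leb3 R).
Implicit Types (f g w : R3 R -> R) (phi : R3 R -> R[i]) (u : nat -> R3 R -> R[i]) (s p q : R).

Lemma avgZ q (c h : R) f x : 1 <= q -> 0 < h -> Lq q f ->
  avg h (fun y => c * f y) x = c * avg h f x.
Proof.
move=> q1 h0 fq; rewrite !avgE -RintegralZl//; last exact: Lq_kern_integrable q1 h0 fq.
by apply: eq_Rintegral => y _; ring.
Qed.

Lemma BnormZ q s (c : R) f : 1 <= q -> Lq q f ->
  (Bnorm s (fun x => c * f x)%R = (c ^+ 2)%:E * Bnorm s f)%E.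
Proof.
move=> q1 fq; rewrite /Bnorm -ge0_integralZl_EFin ?sqr_ge0//; last 2 first.
- by move=> x _; exact: Bfun_ge0.
- exact: measurable_Bfun fq.1.
apply: eq_integral => x _; rewrite /Bfun -nneseriesZl//; last first.
  by move=> k _; rewrite lee_fin addr_ge0 ?Ek_ge0.
apply: eq_eseriesr => k _; rewrite -EFinM; congr EFin.
by rewrite /Ek !(avgZ c x q1 (dy_gt0 R _) fq); ring.
Qed.

Lemma integral_powZ q (c : R) f : 0 < c -> measurable_fun setT (f : M3 R -> R) ->
  (\int[L]_x (`|c * f x| `^ q)%:E = (c `^ q)%:E * \int[L]_x (`|f x| `^ q)%:E)%E.
Proof.
move=> c0 mf; rewrite -ge0_integralZl_EFin ?powR_ge0//.
- apply: eq_integral => x _; rewrite -EFinM; congr EFin.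
  by rewrite normrM (gtr0_norm c0) powRM// ltW.
- by apply/measurable_EFinP; exact: measurable_powR_norm.
Qed.

Lemma LqZ q (c : R) f : 0 < c -> Lq q f -> Lq q (fun x => c * f x).
Proof.
move=> c0 [mf fi]; split; first exact: measurable_funM.
by rewrite integral_powZ// lte_mul_pinfty// lee_fin powR_ge0.
Qed.

Lemma tame_Lq q v : 0 < q -> tame v -> Lq q v.
Proof.
move=> q0 [mv [M vM] [r r0 vr] _]; split => //.
have M0 : 0 <= M by rewrite (le_trans _ (vM 0)).
have /integrableP[_] := rint_cube 0 (M `^ q) r0.
apply: le_lt_trans; apply: ge0_le_integral => //.
- by apply/measurable_EFinP; exact: measurable_powR_norm.
- do 2 apply: measurableT_comp => //; apply: measurable_funM => //.
  by apply: measurable_indic; exact: measurable_cube.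
- move=> x _; rewrite /= lee_fin normrM (ger0_norm (powR_ge0 _ _)) indicE normr_nat.
  have [xr|xr] := pselect (cube 0%R r x).
    by rewrite mem_set// mulr1 ge0_ler_powR ?nnegrE// ltW.
  by rewrite memNset// mulr0 vr// normr0 powR0// gt_eqF.
Qed.

Lemma rot_invZ (c : R) f : rot_inv f -> rot_inv (fun x => c * f x).
Proof.
move=> rf a b ab; have [h1 h2] := rf a b ab.
by split; [apply: ae_imply h1|apply: ae_imply h2] => x ->.
Qed.

Lemma rescale (N : R) f : 0 < N -> (fun x => N * (N^-1 * f x)) = f.
Proof. by move=> N0; apply/funext => x; rewrite mulrA mulfV ?gt_eqF// mul1r. Qed.

Lemma scaled_le1 (N : R) n (x : \bar R) : 0 < N -> (0 <= x)%E -> (x <= (N ^+ n)%:E)%E ->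
  ((N^-1 ^+ n)%:E * x <= 1)%E.
Proof.
move=> N0 x0 xN; apply: (@le_trans _ _ ((N^-1 ^+ n)%:E * (N ^+ n)%:E)%E).
  by apply: lee_wpmul2l => //; rewrite lee_fin exprn_ge0// invr_ge0 ltW.
by rewrite -EFinM -exprMn mulVf ?gt_eqF// expr1n.
Qed.

Lemma coul_ge0 f : (0 <= coul f)%E.
Proof.
by apply: integral_ge0 => z _; rewrite lee_fin divr_ge0 ?eucl_ge0// mulr_ge0 ?sqr_ge0.
Qed.

Lemma Bnorm_ge0 s f : (0 <= Bnorm s f)%E.
Proof. by apply: integral_ge0 => x _; exact: Bfun_ge0. Qed.

Lemma eucl_cube_le (r : R) (x : R3 R) : 0 < r -> cube 0 r x -> eucl x <= 2 * r.
Proof.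
move=> r0 /cubeP/=; rewrite !subr0 => -[x1 x2 x3].
have sq (a : R) : `|a| < r -> a ^+ 2 <= r ^+ 2.
  by move=> ah; rewrite -(real_normK (num_real a)) ler_pXn2r ?nnegrE ?(ltW r0)// ltW.
have r2 : 0 <= 2 * r by rewrite mulr_ge0// ltW.
rewrite -(ler_pXn2r (n := 2)) ?nnegrE ?eucl_ge0// eucl_sqr.
have := sqr_ge0 r; have := sq _ x1; have := sq _ x2; have := sq _ x3; lra.
Qed.

(** 96 is the constant of [Bnorm_limit] at T = 1, and 10 is a number whose square exceeds it. *)
Lemma shift_sqr (c : R) : 0 <= c -> 96 * 1 ^+ 2 <= (c + 10) ^+ 2.
Proof. by move=> c0; have := sqr_ge0 c; lra. Qed.

Lemma coulombE phi : coulomb phi = coul (fun x => cabs (phi x)).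
Proof. by []. Qed.

Section Exponents.
Variables s p : R.
Hypothesis hs : 1 / 2 < s < 3 / 2.
Hypothesis hp : (16 * s + 2) / (6 * s + 1) < p <= 6 / (3 - 2 * s).
Let q := 6 / (3 - 2 * s).

Lemma q_ge3 : 3 <= q.
Proof.
have /andP[s1 s2] := hs; have d0 : 0 < 3 - 2 * s by lra.
by rewrite /q ler_pdivlMr//; lra.
Qed.

Lemma p_gt1 : 1 < p.
Proof.
have /andP[s1 s2] := hs; have /andP[p1 _] := hp; have d0 : 0 < 6 * s + 1 by lra.
by apply: lt_trans p1; rewrite ltr_pdivlMr//; lra.
Qed.

(** [Bnorm] has degree 2 and [coul] degree 4, so dividing by [N] normalizes both to 1. The function
    plays both roles f and w, which allows the smallest radius r0 = 16. *)
Lemma embedding_bound : exists C : R, 0 < C /\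
  forall f (N : R), 0 < N -> Lq q f -> rot_inv f -> (Bnorm s f <= (N ^+ 2)%:E)%E ->
  (coul f <= (N ^+ 4)%:E)%E -> (\int[L]_x (`|f x| `^ p)%:E <= (C * N `^ p)%:E)%E.
Proof.
have /andP[s1 s2] := hs; have s03 : 0 <= s < 3 / 2 by apply/andP; split; lra.
have q1 : 1 <= q by have := q_ge3; lra.
have [C1 [C10 H1]] := sobolev_embedding s03.
have [C2 [C20 H2]] := radial_Lp_bound hs hp.
pose C := 8 * (2 * 16) ^+ 3 + C2 + C1 : R.
have C0 : 0 < C by rewrite /C !addr_gt0.
exists C; split => // f N N0 fq rf fB fD; have mf := fq.1.
have Ni : 0 < N^-1 by rewrite invr_gt0.
pose g x := N^-1 * f x.
have gq : Lq q g by exact: LqZ.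
have gB : (Bnorm s g <= 1)%E.
  by rewrite (BnormZ s N^-1 q1 fq); apply: scaled_le1 => //; exact: Bnorm_ge0.
have gD : (coul g <= 1)%E.
  by rewrite coulZ//; apply: scaled_le1 => //; exact: coul_ge0.
have gp : (\int[L]_x (`|g x| `^ p)%:E <= C%:E)%E.
  apply: (le_trans (H2 g g 16 gq.1 (rot_invZ _ rf) gD gq.1 gB (lexx _) (fun x _ => erefl))).
  by rewrite /C [leRHS]EFinD; apply: leeD => //; exact: (H1 q).
rewrite -(rescale f N0) integral_powZ//; last exact: gq.1.
by rewrite mulrC EFinM; apply: lee_wpmul2l => //; rewrite lee_fin powR_ge0.
Qed.

(** The radius beyond which f = w depends on [r], so this yields finiteness but no uniform
    constant. *)
Lemma embedding_finite f w (N r : R) : 0 < N -> 0 < r -> Lq q f -> rot_inv f -> Lq q w ->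
  (Bnorm s w <= (N ^+ 2)%:E)%E -> (coul f <= (N ^+ 4)%:E)%E ->
  (forall x, ~ cube 0 r x -> w x = f x) -> (\int[L]_x (`|f x| `^ p)%:E < +oo)%E.
Proof.
move=> N0 r0 fq rf wq wB fD wf; have mf := fq.1.
have q1 : 1 <= q by have := q_ge3; lra.
have [C [C0 HC]] := radial_Lp_bound hs hp.
have Ni : 0 < N^-1 by rewrite invr_gt0.
pose g x := N^-1 * f x.
have gq : Lq q g by exact: LqZ.
have gB : (Bnorm s (fun x => N^-1 * w x)%R <= 1)%E.
  by rewrite (BnormZ s N^-1 q1 wq); apply: scaled_le1 => //; exact: Bnorm_ge0.
have gD : (coul g <= 1)%E.
  by rewrite coulZ//; apply: scaled_le1 => //; exact: coul_ge0.
(* Points of the cube satisfy |x| <= 2 r, which is less than half of 16 + 4 r. *)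
have far x : (16 + 4 * r) / 2 <= eucl x -> N^-1 * w x = g x.
  move=> xr; rewrite wf// => /(eucl_cube_le r0) xr'.
  have := le_trans xr xr'; rewrite ler_pdivrMr// (_ : 2 * r * 2 = 0 + 4 * r); last by ring.
  by rewrite lerD2r lern0.
rewrite -(rescale f N0) integral_powZ//; last exact: gq.1.
rewrite lte_mul_pinfty ?lee_fin ?powR_ge0//.
apply: (le_lt_trans (HC g _ (16 + 4 * r) gq.1 (rot_invZ _ rf) gD _ gB _ far)).
- exact: measurable_funM wq.1.
- by rewrite lerDl mulr_ge0// ltW.
- by rewrite lte_add_pinfty// ?ltry//; exact: gq.2.
Qed.

Definition comp (b : bool) (z : R[i]) : R := if b then complex.Re z else complex.Im z.

Lemma compB b z z' : comp b (z - z') = comp b z - comp b z'.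
Proof. by case: b; case: z => ? ?; case: z'. Qed.

Lemma comp_le b z : `|comp b z| <= cabs z.
Proof.
rewrite -(ger0_norm (cabs_ge0 z)) -(ler_pXn2r (n := 2)) ?nnegrE// !real_normK ?num_real//.
by rewrite cabs_sqr; case: b => /=; [rewrite lerDl sqr_ge0|rewrite lerDr sqr_ge0].
Qed.

Lemma cabs_le z : cabs z <= `|comp true z| + `|comp false z|.
Proof.
rewrite -(ger0_norm (cabs_ge0 z)) -[leRHS]ger0_norm ?addr_ge0//.
rewrite -(ler_pXn2r (n := 2)) ?nnegrE// !real_normK ?num_real//.
rewrite cabs_sqr sqrrD !real_normK ?num_real//= lerD2r lerDl mulrn_wge0// mulr_ge0//.
Qed.

Lemma measurable_comp b phi : cmeasurable phi ->
  measurable_fun setT (fun x : M3 R => comp b (phi x)).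
Proof. by case: b => -[]. Qed.

Lemma measurable_cabs phi : cmeasurable phi ->
  measurable_fun setT (fun x : M3 R => cabs (phi x)).
Proof.
move=> [m1 m2].
rewrite (_ : (fun _ => _) = (fun x : M3 R =>
    `|complex.Re (phi x) ^+ 2 + complex.Im (phi x) ^+ 2| `^ 2^-1)).
  by apply: measurable_powR_norm; apply: measurable_funD; exact: measurable_funX.
apply/funext => x; rewrite -cabs_sqr normrX (ger0_norm (cabs_ge0 _)).
by rewrite -powR_mulrn ?cabs_ge0// -powRrM mulfV// powRr1// cabs_ge0.
Qed.

Lemma Lpnorm_poweR r phi : 0 < r ->
  (Lpnorm r phi `^ r = \int[L]_x (cabs (phi x) `^ r)%:E)%E.
Proof.
move=> r0; have rn : r != 0 by rewrite gt_eqF.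
apply: (etrans (poweR_Lnorm L (fun x => (cabs (phi x))%:E) rn)); apply: eq_integral => x _.
by rewrite abse_EFin poweR_EFin (ger0_norm (cabs_ge0 _)).
Qed.

Lemma lee_poweR (x y : \bar R) r : 0 <= r -> (0 <= x)%E -> (x <= y)%E ->
  (x `^ r <= y `^ r)%E.
Proof.
move=> r0 x0 xy; apply: gt0_ler_poweR => //; rewrite in_itv/= leey andbT//.
exact: le_trans xy.
Qed.

Lemma comp_Lq b r phi : 0 < r -> Lpspace r phi -> Lq r (fun x => comp b (phi x)).
Proof.
move=> r0 [mphi fin]; have mc := measurable_comp b mphi; split => //.
apply: (@le_lt_trans _ _ (\int[L]_x (cabs (phi x) `^ r)%:E)%E); last first.
  by rewrite -Lpnorm_poweR// poweR_lty.
apply: ge0_le_integral => //.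
- by apply/measurable_EFinP; exact: measurable_powR_norm.
- apply/measurable_EFinP; apply: (measurableT_comp (measurable_powR _)).
  exact: measurable_cabs.
- by move=> x _; rewrite lee_fin ge0_ler_powR ?nnegrE ?cabs_ge0 ?comp_le// ltW.
Qed.

Lemma Bnorm_comp b (v : R3 R -> R[i]) (T : R) :
  (forall c, tame (fun x => comp c (v x))) -> 0 < T -> (Hnorm_test s v < T%:E)%E ->
  (Bnorm s (fun x => comp b (v x)) <= (48 * T ^+ 2)%:E)%E.
Proof.
move=> tv T0 vT; have /andP[s1 s2] := hs.
have hs' : 1 / 2 <= s <= 3 / 2 by rewrite !ltW.
have tv' : tame (fun x => complex.Re (v x)) /\ tame (fun x => complex.Im (v x)).
  by split; [exact: (tv true)|exact: (tv false)].
have [B1 B2] := Bnorm_test tv' hs'.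
apply: (@le_trans _ _ (48%:E * \int[L]_xi (eucl xi `^ (2 * s) * cabs (fourier v xi) ^+ 2)%:E)%E).
  by case: b.
rewrite EFinM; apply: lee_wpmul2l => //.
move: vT; rewrite /Hnorm_test; set I := (X in (X `^ _)%E) => vT.
have I0 : (0 <= I)%E by apply: integral_ge0 => x _; rewrite lee_fin mulr_ge0 ?powR_ge0 ?sqr_ge0.
have e : I = ((I `^ 2^-1) `^ 2)%E by rewrite -poweRrM mulVf// poweRe1.
rewrite -[X in (X <= _)%E]/I e.
have -> : ((T ^+ 2)%:E = T%:E `^ 2 :> \bar R)%E by rewrite poweR_EFin powR_mulrn// ltW.
by apply: lee_poweR => //; [exact: poweR_ge0|exact: ltW].
Qed.

(** 96 = 2 * 48, from [Bnorm_lsc] and [Bnorm_test]. Stated for tame sequences so as to cover the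
    differences [u n - u N] as well. *)
Lemma Bnorm_limit b u phi (T : R) : (forall n c, tame (fun x => comp c (u n x))) ->
  cmeasurable phi -> Lq q (fun x => comp b (phi x)) ->
  ((fun n => Lpnorm q (u n \- phi)) @ \oo --> 0%E) -> 0 < T ->
  (exists N : nat, forall n, (N <= n)%N -> (Hnorm_test s (u n) < T%:E)%E) ->
  (Bnorm s (fun x => comp b (phi x)) <= (96 * T ^+ 2)%:E)%E.
Proof.
move=> tu mphi phiq ucv T0 [N uN]; have q3 := q_ge3.
have q0 : 0 < q by lra.
have q2 : 2 <= q by lra.
rewrite (_ : 96 * T ^+ 2 = 2 * (48 * T ^+ 2)); last by ring.
rewrite EFinM; apply: (Bnorm_lsc q2 phiq).
  by rewrite lee_fin mulr_ge0// sqr_ge0.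
move=> eps e0.
have d0 : (0 < (eps `^ q^-1)%:E :> \bar R)%E by rewrite lte_fin powR_gt0.
have [M _ uM] : \forall n \near \oo, (Lpnorm q (u n \- phi)%R < (eps `^ q^-1)%:E)%E.
  exact: (ucv _ (open_ereal_lt' d0)).
pose n := maxn N M; have un := uN n (leq_maxl _ _); have := uM n (leq_maxr _ _) => /= dn.
have mun : cmeasurable (u n).
  by split; [have [] := tu n true|have [] := tu n false].
have mun' : cmeasurable (u n \- phi).
  split.
  - apply: (eq_measurable_fun (fun x => complex.Re (u n x) - complex.Re (phi x))).
      by move=> x _ /=; case: (u n x) => ? ?; case: (phi x).
    by apply: measurable_funB; [exact: mun.1|exact: mphi.1].
  - apply: (eq_measurable_fun (fun x => complex.Im (u n x) - complex.Im (phi x))).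
      by move=> x _ /=; case: (u n x) => ? ?; case: (phi x).
    by apply: measurable_funB; [exact: mun.2|exact: mphi.2].
have diff : (\int[L]_x (`|comp b (phi x) - comp b (u n x)| `^ q)%:E <= eps%:E)%E.
  apply: (@le_trans _ _ (\int[L]_x (cabs ((u n \- phi)%R x) `^ q)%:E)%E).
    apply: ge0_le_integral => //.
    - apply/measurable_EFinP; apply: measurable_powR_norm.
      by apply: measurable_funB; apply: measurable_comp; [exact: mphi|exact: mun].
    - apply/measurable_EFinP; apply: (measurableT_comp (measurable_powR _)).
      exact: measurable_cabs mun'.
    - move=> x _; rewrite lee_fin ge0_ler_powR ?nnegrE ?cabs_ge0 ?(ltW q0)//.
      by rewrite distrC -compB; exact: comp_le.
  rewrite -Lpnorm_poweR//.
  have -> : eps%:E = ((eps `^ q^-1)%:E `^ q)%E.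
    by rewrite poweR_EFin -powRrM mulVf ?gt_eqF// powRr1// ltW.
  by apply: lee_poweR; [exact: ltW|exact: Lnorm_ge0|exact: ltW].
exists (fun x => comp b (u n x)); split; [exact: tame_Lq (tu n b)| |exact: diff].
exact: Bnorm_comp.
Qed.

Lemma powR_add_le (a b r : R) : 0 <= a -> 0 <= b -> 0 <= r ->
  (a + b) `^ r <= 2 `^ r * (a `^ r + b `^ r).
Proof.
have le c d : 0 <= c -> c <= d -> 0 <= r -> (c + d) `^ r <= 2 `^ r * (c `^ r + d `^ r).
  move=> c0 cd r0; have d0 : 0 <= d by exact: le_trans cd.
  apply: (@le_trans _ _ ((2 * d) `^ r)).
    by apply: ge0_ler_powR => //; rewrite ?nnegrE ?addr_ge0 ?mulr_ge0//; lra.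
  by rewrite powRM// ler_wpM2l ?powR_ge0// lerDr powR_ge0.
move=> a0 b0 r0; have [ab|/ltW ba] := leP a b; first exact: le.
by rewrite addrC [X in _ * X]addrC; exact: le.
Qed.

Lemma LqB r f g : 0 <= r -> Lq r f -> Lq r g -> Lq r (fun x => f x - g x).
Proof.
move=> r0 [mf fi] [mg gi]; split; first exact: measurable_funB.
have mp v : measurable_fun setT (v : M3 R -> R) ->
    measurable_fun setT (fun x : M3 R => (`|v x| `^ r)%:E).
  by move=> mv; apply/measurable_EFinP; exact: measurable_powR_norm.
apply: (@le_lt_trans _ _ (\int[L]_x ((2 `^ r)%:E * ((`|f x| `^ r)%:E + (`|g x| `^ r)%:E)))%E).
  apply: ge0_le_integral => //.
  - by apply: mp; exact: measurable_funB.
  - by apply: measurable_funeM; apply: emeasurable_funD; exact: mp.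
  - move=> x _; rewrite -EFinD -EFinM lee_fin; apply: le_trans (powR_add_le _ _ r0) => //.
    by apply: ge0_ler_powR; rewrite ?nnegrE ?addr_ge0// ler_normB.
rewrite ge0_integralZl_EFin ?powR_ge0//; last 2 first.
- by move=> x _; rewrite -EFinD lee_fin addr_ge0 ?powR_ge0.
- by apply: emeasurable_funD; exact: mp.
rewrite ge0_integralD//; [|exact: mp|exact: mp].
apply: lte_mul_pinfty; [by rewrite lee_fin powR_ge0|by []|].
exact: lte_add_pinfty fi gi.
Qed.

Lemma cabs_integral phi : cmeasurable phi ->
  (\int[L]_x (cabs (phi x) `^ p)%:E <= (2 `^ p)%:E *
    (\int[L]_x (`|comp true (phi x)| `^ p)%:E + \int[L]_x (`|comp false (phi x)| `^ p)%:E))%E.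
Proof.
move=> mphi; have p0 : 0 <= p by have := p_gt1; lra.
have mp b : measurable_fun setT (fun x : M3 R => (`|comp b (phi x)| `^ p)%:E).
  by apply/measurable_EFinP; apply: measurable_powR_norm; exact: measurable_comp.
rewrite -ge0_integralD//.
rewrite -ge0_integralZl_EFin ?powR_ge0//; last 2 first.
- by move=> x _; rewrite -EFinD lee_fin addr_ge0 ?powR_ge0.
- exact: emeasurable_funD.
apply: ge0_le_integral => //.
- by move=> x _; rewrite lee_fin powR_ge0.
- apply/measurable_EFinP; apply: (measurableT_comp (measurable_powR _)).
  exact: measurable_cabs.
- by apply: measurable_funeM; exact: emeasurable_funD.
- move=> x _; rewrite -EFinD -EFinM lee_fin; apply: le_trans (powR_add_le _ _ p0) => //.
  by apply: ge0_ler_powR; rewrite ?nnegrE ?addr_ge0 ?cabs_ge0// cabs_le.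
Qed.

Lemma coul_comp b phi : cmeasurable phi -> (coul (fun x => comp b (phi x)) <= coulomb phi)%E.
Proof.
move=> mphi; rewrite coulombE; apply: coul_le; [exact: measurable_comp|exact: measurable_cabs|].
by move=> x; rewrite (ger0_norm (cabs_ge0 _)); exact: comp_le.
Qed.

Lemma test_tame_comp (v : R3 R -> R[i]) b : test_function v -> tame (fun x => comp b (v x)).
Proof. by move=> /test_tame[]; case: b. Qed.

(* [phi - u N] has finite Besov norm and agrees with phi outside a cube. *)
Lemma Espace_Lp phi : Espace s phi -> Lpspace p phi.
Proof.
move=> [[[phiq [u [tu cu ucv]]] rphi] Dphi]; have mphi := phiq.1.
have q0 : 0 < q by have := q_ge3; lra.
have p0 : 0 < p by have := p_gt1; lra.
split => //.
(* With [N] fixed, the Cauchy condition bounds the norms of [u n - u N] by 1 for all later [n],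
   although no bound on the norms of the [u n] themselves is at hand. *)
have [N uN] := cu 1 ltr01.
have [r r0 ur] := test_support (tu N).
pose c : R := fine (coulomb phi).
have D0 : (0 <= coulomb phi)%E by rewrite coulombE; exact: coul_ge0.
have c0 : 0 <= c by rewrite fine_ge0.
have cE : coulomb phi = c%:E by rewrite /c fineK// ge0_fin_numE.
(* c + 10 serves as the normalizing factor: its square exceeds 96 and its fourth power exceeds the
   Coulomb energy [c]. *)
have c10 : 1 <= c + 10 by rewrite ler_wpDl// ler1n.
have fin b : (\int[L]_x (`|comp b (phi x)| `^ p)%:E < +oo)%E.
  apply: (@embedding_finite _ (fun x => comp b ((phi \- u N) x)) (c + 10) r) => //.
  - exact: lt_le_trans c10.
  - exact: comp_Lq.
  - exact: radial_rot_inv.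
  - have -> : (fun x => comp b ((phi \- u N) x)) = (fun x => comp b (phi x) - comp b (u N x)).
      by apply/funext => x; exact: compB.
    apply: LqB; [exact: ltW|exact: comp_Lq|].
    by apply: tame_Lq => //; exact: test_tame_comp.
  - apply: (@le_trans _ _ (96 * 1 ^+ 2)%:E); last first.
      by rewrite lee_fin; exact: shift_sqr.
    apply: (@Bnorm_limit b (fun n => u n \- u N) (phi \- u N) 1) => //.
    + move=> n d; have -> : (fun x => comp d ((u n \- u N) x)) = (fun x => comp d (u n x) - comp d (u N x)).
        by apply/funext => x; exact: compB.
      by apply: tameB; exact: test_tame_comp.
    + have m d : measurable_fun setT (fun x : M3 R => comp d ((phi \- u N) x)).
        have -> : (fun x : M3 R => comp d ((phi \- u N) x)) = (fun x => comp d (phi x) - comp d (u N x)).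
          by apply/funext => x; exact: compB.
        apply: measurable_funB; first exact: measurable_comp.
        by have [] := test_tame_comp d (tu N).
      by split; [exact: (m true)|exact: (m false)].
    + have -> : (fun x => comp b ((phi \- u N) x)) = (fun x => comp b (phi x) - comp b (u N x)).
        by apply/funext => x; exact: compB.
      apply: LqB; [exact: ltW|exact: comp_Lq|].
      by apply: tame_Lq => //; exact: test_tame_comp.
    + have -> : (fun n => Lpnorm q ((u n \- u N) \- (phi \- u N))) = (fun n => Lpnorm q (u n \- phi)).
        apply/funext => n; congr Lpnorm; apply/funext => x /=.
        by rewrite opprB addrA subrK.
      exact: ucv.
    + by exists N => n Nn; exact: uN.
  - apply: (le_trans (coul_comp b mphi)); rewrite cE lee_fin.
    apply: (@le_trans _ _ (c + 10)); first by rewrite lerDl.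
    by rewrite ler_eXnr.
  - by move=> x nx /=; rewrite ur// subr0.
apply: (@lty_poweRy _ _ p); first by rewrite gt_eqF.
rewrite Lpnorm_poweR//; apply: (le_lt_trans (cabs_integral mphi)).
by rewrite lte_mul_pinfty ?lee_fin ?powR_ge0// lte_add_pinfty.
Qed.

Lemma Hnorm_ge0 phi : (0 <= Hnorm s phi)%E.
Proof.
apply: le_ereal_inf_tmp => l [u [_ ul]].
rewrite -(cvg_lim (@ereal_hausdorff R) ul); apply: lime_ge; first by apply/cvg_ex; exists l.
by apply: nearW => n; exact: poweR_ge0.
Qed.

(** An infinite norm leaves nothing to show. For a finite one, every larger T bounds the norms of
    some representing sequence from some index on, and T is finally let down to the norm. *)
Lemma Espace_bound : exists C : R, 0 < C /\ forall phi, Espace s phi ->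
  (Lpnorm p phi <= C%:E * Enorm s phi)%E.
Proof.
have [C [C0 HC]] := embedding_bound.
have q0 : 0 < q by have := q_ge3; lra.
have p0 : 0 < p by have := p_gt1; lra.
(* The 10 absorbs 96 T^2 <= (10 T)^2; 2^p and the 2 come from splitting into real and imaginary
   parts. *)
pose K := (2 `^ p * (2 * C)) `^ p^-1 * 10.
have K1 : 0 < 2 `^ p * (2 * C) by rewrite mulr_gt0 ?powR_gt0// mulr_gt0.
have K0 : 0 < K by rewrite mulr_gt0// powR_gt0.
exists K; split => // phi [[[phiq _] rphi] Dphi]; have mphi := phiq.1.
have main (T : R) : 0 < T -> (Enorm s phi < T%:E)%E -> (Lpnorm p phi <= (K * T)%:E)%E.
  move=> T0 ET; pose X := (Hnorm s phi ^+ 2 + coulomb phi `^ 2^-1)%E.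
  have D0 : (0 <= coulomb phi)%E by rewrite coulombE; exact: coul_ge0.
  have H0 := Hnorm_ge0 phi.
  have XT : (X < (T ^+ 2)%:E)%E.
    rewrite ltNge; apply/negP => TX; move: ET; rewrite ltNge => /negP; apply.
    have -> : T%:E = ((T ^+ 2)%:E `^ 2^-1)%E.
      by rewrite poweR_EFin -powR_mulrn ?(ltW T0)// -powRrM mulfV// powRr1// ltW.
    by apply: lee_poweR => //; rewrite lee_fin sqr_ge0.
  have HT : (Hnorm s phi < T%:E)%E.
    rewrite ltNge; apply/negP => TH; move: XT; rewrite ltNge => /negP; apply.
    apply: (@le_trans _ _ (Hnorm s phi ^+ 2)%E); last by rewrite /X leeDl// poweR_ge0.
    by rewrite expe2 expr2 EFinM lee_pmul// lee_fin ltW.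
  have DT : (coulomb phi <= (T ^+ 4)%:E)%E.
    have -> : coulomb phi = ((coulomb phi `^ 2^-1) `^ 2)%E by rewrite -poweRrM mulVf// poweRe1.
    have -> : ((T ^+ 4)%:E = (T ^+ 2)%:E `^ 2)%E.
      by rewrite poweR_EFin powR_mulrn ?sqr_ge0// -exprM.
    apply: lee_poweR => //; first exact: poweR_ge0.
    by apply: le_trans (ltW XT); rewrite /X leeDr// expe2 mule_ge0.
  (* The strict inequality turns the infimum into an actual sequence, whose norms converge to some l
     < T. *)
  have [l [u [[tu _ ucv] ul]] lT] := ereal_inf_lt HT.
  have [M _ uM] : \forall n \near \oo, (Hnorm_test s (u n) < T%:E)%E.
    exact: (ul _ (open_ereal_lt' lT)).
  have T10 : 0 < 10 * T by rewrite mulr_gt0.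
  have fb b : (\int[L]_x (`|comp b (phi x)| `^ p)%:E <= (C * (10 * T) `^ p)%:E)%E.
    apply: HC => //.
    - exact: comp_Lq.
    - exact: radial_rot_inv.
    - apply: (@le_trans _ _ (96 * T ^+ 2)%:E); last first.
        by rewrite lee_fin exprMn ler_wpM2r ?sqr_ge0// -natrX ler_nat.
      apply: (@Bnorm_limit b u phi T) => //.
      + by move=> n d; exact: test_tame_comp.
      + exact: comp_Lq.
      + by exists M => n Mn; exact: uM.
    - apply: (le_trans (coul_comp b mphi)); apply: (le_trans DT).
      rewrite lee_fin exprMn ler_peMl//; first by rewrite exprn_ge0// ltW.
      by rewrite exprn_ege1// ler1n.
  have P0 : (0 <= Lpnorm p phi)%E by exact: Lnorm_ge0.
  have -> : Lpnorm p phi = ((Lpnorm p phi `^ p) `^ p^-1)%E.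
    by rewrite -poweRrM mulfV ?gt_eqF// poweRe1.
  have -> : ((K * T)%:E = ((2 `^ p * (2 * C)) * (10 * T) `^ p)%:E `^ p^-1)%E.
    rewrite poweR_EFin powRM ?powR_ge0 ?(ltW K1)// -powRrM mulfV ?gt_eqF// powRr1 ?(ltW T10)//.
    by rewrite /K -!mulrA.
  apply: lee_poweR; [by rewrite invr_ge0 ltW|exact: poweR_ge0|].
  rewrite Lpnorm_poweR//; apply: (le_trans (cabs_integral mphi)).
  rewrite -mulrA EFinM; apply: lee_wpmul2l; first by rewrite lee_fin powR_ge0.
  apply: (le_trans (leeD (fb true) (fb false))); rewrite -EFinD lee_fin.
  by rewrite le_eqVlt; apply/orP; left; apply/eqP; ring.
have E0 : (0 <= Enorm s phi)%E by exact: poweR_ge0.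
case: (Enorm s phi) E0 main => [e| |]// e0 main; last by rewrite gt0_muley ?lte_fin// leey.
rewrite lee_fin in e0; apply/lee_addgt0Pr => eps eps0.
have eK : 0 < eps / K by rewrite divr_gt0.
have := main (e + eps / K); rewrite lte_fin ltrDl eK ltr_wpDl// => /(_ isT isT).
by rewrite mulrDr EFinD EFinM (mulrC K (eps / K)) divfK// gt_eqF.
Qed.

End Exponents.
End Embedding.

Theorem theorem0p3 (R : realType) (s p : R)
    (hs : 1 / 2 < s < 3 / 2)
    (hp : (16 * s + 2) / (6 * s + 1) < p <= 6 / (3 - 2 * s)) :
  (forall phi : R3 R -> R[i], Espace s phi -> Lpspace p phi) /\
  (exists C : R, 0 < C /\
    forall phi : R3 R -> R[i], Espace s phi ->
      (Lpnorm p phi <= C%:E * Enorm s phi)%E).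
Proof. by split; [exact: Espace_Lp|exact: Espace_bound]. Qed.
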